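(* Let $f:\mathbb R^n\to\mathbb R$ be a metric function such that each connected component of the set of critical points of $f$ is either a point or a regular surface, and each such component is isolated from the others. Then the level surfaces of $f$ (connected components of level sets) form a foliation (possibly with singularities) of one of the following types: (1) $F$ consists of parallel hyperplanes; (2) $F$ consists of concentric hyperspheres together with their common center (a point); (3) $F$ consists of concentric cylinders of the form $S^{n-k-1}\times\mathbb R^k$ together with a singular leaf $\mathbb R^k$ (the common axis), where $k$ is the minimum of the dimensions of the critical level surfaces and $1\le k\le n-2$.
   Context: A metric function on a manifold $M$ is a function $f\in C^2(M,\mathbb R)$ such that $|\operatorname{grad}f|$ is constant on each connected component of each level set of $f$. $S^m$ denotes the $m$-sphere. *)

(* Defs.v *)
From mathcomp Require Import ssreflect ssrfun ssrbool eqtype ssrnat fintype bigop.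
From Stdlib Require Import Reals.
Set Implicit Arguments. Unset Strict Implicit. Unset Printing Implicit Defensive.
Open Scope R_scope.

Definition vec (n : nat) := 'I_n -> R.

Definition vzero {n} : vec n := fun _ => 0.
Definition vadd {n} (x y : vec n) : vec n := fun i => x i + y i.
Definition vsub {n} (x y : vec n) : vec n := fun i => x i - y i.
Definition dot {n} (x y : vec n) : R := \big[Rplus/0]_(i < n) (x i * y i).
Definition nrm2 {n} (x : vec n) : R := dot x x.

Definition is_open {n} (U : vec n -> Prop) : Prop :=
  forall x, U x -> exists r, 0 < r /\ forall y, nrm2 (vsub y x) < r * r -> U y.

Definition connected {n} (A : vec n -> Prop) : Prop :=
  ~ exists U V : vec n -> Prop,
      is_open U /\ is_open V /\
      (forall x, A x -> U x \/ V x) /\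
      (exists x, A x /\ U x) /\ (exists x, A x /\ V x) /\
      (forall x, A x -> U x -> V x -> False).

Definition conn_comp {n} (S : vec n -> Prop) (x y : vec n) : Prop :=
  exists A : vec n -> Prop, connected A /\ (forall z, A z -> S z) /\ A x /\ A y.

Definition has_grad {n} (f : vec n -> R) (x g : vec n) : Prop :=
  forall eps, 0 < eps -> exists delta, 0 < delta /\
    forall h : vec n, nrm2 h < delta * delta ->
      Rsqr (f (vadd x h) - f x - dot g h) <= eps * eps * nrm2 h.

Definition continuous_Rn {n} (f : vec n -> R) : Prop :=
  forall x eps, 0 < eps -> exists delta, 0 < delta /\
    forall y, nrm2 (vsub y x) < delta * delta -> Rabs (f y - f x) < eps.

Fixpoint Ck {n} (k : nat) (f : vec n -> R) : Prop :=
  match k with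
  | O => continuous_Rn f
  | S k' => exists G : vec n -> vec n,
      (forall x, has_grad f x (G x)) /\ (forall i, Ck k' (fun x => G x i))
  end.

Definition smooth {n} (f : vec n -> R) : Prop := forall k, Ck k f.

Definition crit {n} (f : vec n -> R) (x : vec n) : Prop := has_grad f x vzero.

Definition level {n} (f : vec n -> R) (x : vec n) : vec n -> Prop :=
  fun y => f y = f x.

Definition leaf {n} (f : vec n -> R) (x y : vec n) : Prop :=
  conn_comp (level f x) x y.

Definition metric_function {n} (f : vec n -> R) : Prop :=
  Ck 2 f /\
  forall x y gx gy, leaf f x y -> has_grad f x gx -> has_grad f y gy ->
    nrm2 gx = nrm2 gy.

(* M is a regular surface of dimension d, 1 <= d <= n-1: a smooth embedded
   submanifold, locally the regular zero set of n-d smooth functions *)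
Definition reg_surface_dim {n} (d : nat) (M : vec n -> Prop) : Prop :=
  is_true (leq 1 d) /\ is_true (leq (S d) n) /\
  forall p, M p -> exists r, 0 < r /\
    exists F : 'I_(subn n d) -> vec n -> R,
      (forall j, smooth (F j)) /\
      (forall y, nrm2 (vsub y p) < r * r -> (M y <-> forall j, F j y = 0)) /\
      (forall y, nrm2 (vsub y p) < r * r -> M y ->
         forall G : 'I_(subn n d) -> vec n, (forall j, has_grad (F j) y (G j)) ->
         forall c : 'I_(subn n d) -> R,
           (forall i, \big[Rplus/0]_(j < subn n d) (c j * G j i) = 0) ->
           forall j, c j = 0).

Definition reg_surface {n} (M : vec n -> Prop) : Prop :=
  exists d, reg_surface_dim d M.

Definition dist2_affine {n k} (p : vec n) (e : 'I_k -> vec n) (y : vec n) : R :=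
  nrm2 (vsub y p) - \big[Rplus/0]_(i < k) Rsqr (dot (vsub y p) (e i)).

Definition orthonormal {n k} (e : 'I_k -> vec n) : Prop :=
  forall i j, dot (e i) (e j) = if i == j then 1 else 0.

(* Main.v *)
(* Let C be the critical set and N = grad f / |grad f| outside C. Near a regular
   point |grad f| is a function of f, so some function of f has a gradient of
   norm one; its gradient N is then constant along the straight lines in
   direction N. Transporting |grad f| between neighbouring normal lines shows
   that a nearest point of C to a regular x lies on the normal line through x.
   By the equations of its components, C has a linear space of normals at each
   of its points, all of them proximal, and so normal lines continue through
   critical points.

   Call a critical point focal if it has two orthogonal normals. On the normal
   lines through a focal point p the distances from p to the critical points do
   not change when the line is rotated inside the normal space. Two focal points
   on one line would therefore generate, by reflection in each other, infinitely
   many focal points on it with pairwise orthogonal normal directions. So a normal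
   line through a focal point contains only this one; hence the focal points, if
   there are any, form an affine subspace perpendicular to all normal lines
   through them, and f depends on the distance to this subspace only.

   If there is no focal point, N extends up to sign to a field that is locally a
   gradient (of a signed distance near C). The local potentials glue to one on
   R^n, where |grad u| = 1 forces the normal lines to be parallel. *)

From Stdlib Require Import Reals Psatz FunctionalExtensionality ClassicalEpsilon.
From Coquelicot Require Import Coquelicot.
From HB Require Import structures.
From mathcomp Require Import ssreflect ssrfun ssrbool eqtype ssrnat seq fintype bigop.
Require Import Defs.
Set Implicit Arguments. Unset Strict Implicit. Unset Printing Implicit Defensive.
Open Scope R_scope.

(** The shape of the proof comes from lack of smoothness. The potentials with unit gradient occur in
    three forms, as functions of [f], as signed distances to the critical set and as glued
    functions, and only differentiability is at hand for all of them. So there is no gradient flow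
    and no curvature: a differentiable [u] with unit gradient is 1-Lipschitz and gains exactly [t]
    within distance [t], and this metric fact alone yields straight lines and a Lipschitz gradient.

    The field [N] cannot be continued through critical points, as [f] = square of a coordinate
    shows: it flips sign there. Directions are therefore handled up to sign, and normals at critical
    points are described by balls that miss the critical set. Such balls depend on the set only and
    come for free from nearest points; a locally uniform radius for them takes the place of a
    tubular neighbourhood.

    The infinitely many reflected focal points are impossible because their normals perpendicular to
    the line would be n+1 orthonormal vectors. *)

Lemma Rplus_opA : associative Rplus. Proof. by move=> x y z; ring. Qed.
Lemma Rplus_opC : commutative Rplus. Proof. by move=> x y; ring. Qed.
Lemma Rplus_op0 : left_id 0 Rplus. Proof. by move=> x; ring. Qed.
HB.instance Definition _ := Monoid.isComLaw.Build R 0 Rplus Rplus_opA Rplus_opC Rplus_op0.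

(** * Finite sums of reals and elementary inequalities *)

Lemma sumR_add (I : finType) (F H : I -> R) :
  \big[Rplus/0]_i (F i + H i) = \big[Rplus/0]_i F i + \big[Rplus/0]_i H i.
Proof. by rewrite big_split. Qed.

Lemma sumR_scal (I : finType) (a : R) (F : I -> R) :
  \big[Rplus/0]_i (a * F i) = a * \big[Rplus/0]_i F i.
Proof. by elim/big_rec2: _ => [|i x y _ ->]; ring. Qed.

Lemma sumR_ge0 (I : finType) (F : I -> R) :
  (forall i, 0 <= F i) -> 0 <= \big[Rplus/0]_i F i.
Proof. by move=> F0; elim/big_ind: _ => [|x y|i _]; [lra|lra|exact: F0]. Qed.

Lemma sumR_le (I : finType) (F H : I -> R) :
  (forall i, F i <= H i) -> \big[Rplus/0]_i F i <= \big[Rplus/0]_i H i.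
Proof. by move=> FH; elim/big_ind2: _ => [|a b c d|i _]; [lra|lra|exact: FH]. Qed.

Lemma sumR_ge_term (I : finType) (F : I -> R) (j : I) :
  (forall i, 0 <= F i) -> F j <= \big[Rplus/0]_i F i.
Proof.
move=> F0; rewrite (bigD1 j) //=.
suff: 0 <= \big[Rplus/0]_(i | i != j) F i by lra.
by elim/big_ind: _ => [|x y|i _]; [lra|lra|exact: F0].
Qed.

Lemma sumR_const (m : nat) (a : R) : \big[Rplus/0]_(i < m) a = INR m * a.
Proof.
elim: m => [|m IH]; first by rewrite big_ord0 /=; ring.
by rewrite big_ord_recr /= IH -/(INR m.+1) S_INR; ring.
Qed.

Lemma Rlt_minl x a b : x < Rmin a b -> x < a.
Proof. by move=> H; apply: Rlt_le_trans H (Rmin_l _ _). Qed.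
Lemma Rlt_minr x a b : x < Rmin a b -> x < b.
Proof. by move=> H; apply: Rlt_le_trans H (Rmin_r _ _). Qed.
Lemma sqr_ge0 x : x * x >= 0.
Proof. exact/Rle_ge/Rle_0_sqr. Qed.

Lemma abs_sqr x : Rabs x * Rabs x = x * x.
Proof. by rewrite -Rabs_mult Rabs_right //; exact: sqr_ge0. Qed.
Lemma abs_sign sg t : sg = 1 \/ sg = -1 -> Rabs (sg * t) = Rabs t.
Proof. by rewrite Rabs_mult => -[] ->; rewrite ?Rabs_Ropp Rabs_R1; ring. Qed.

(** * Euclidean geometry of [vec n] *)

Section Vectors.
Context {n : nat}.
Implicit Types x y z v w : vec n.

Definition vscal (a : R) (x : vec n) : vec n := fun i => a * x i.
Definition pt (x : vec n) (t : R) (v : vec n) : vec n := vadd x (vscal t v).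
Definition vnorm (x : vec n) : R := sqrt (nrm2 x).
Definition vdist (x y : vec n) : R := vnorm (vsub x y).

Lemma dotC x y : dot x y = dot y x.
Proof. by rewrite /dot; apply: eq_bigr => i _; ring. Qed.
Lemma dotDl x y z : dot (vadd x y) z = dot x z + dot y z.
Proof. by rewrite /dot -sumR_add; apply: eq_bigr => i _; rewrite /vadd; ring. Qed.
Lemma dotZl a x z : dot (vscal a x) z = a * dot x z.
Proof. by rewrite /dot -sumR_scal; apply: eq_bigr => i _; rewrite /vscal; ring. Qed.
Lemma vsubE x y : vsub x y = vadd x (vscal (-1) y).
Proof. by apply: functional_extensionality => i; rewrite /vsub /vadd /vscal; ring. Qed.
Lemma dotBl x y z : dot (vsub x y) z = dot x z - dot y z.
Proof. by rewrite vsubE dotDl dotZl; ring. Qed.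
Lemma dotDr x y z : dot x (vadd y z) = dot x y + dot x z.
Proof. by rewrite !(dotC x) dotDl. Qed.
Lemma dotBr x y z : dot x (vsub y z) = dot x y - dot x z.
Proof. by rewrite !(dotC x) dotBl. Qed.
Lemma dotZr a x z : dot x (vscal a z) = a * dot x z.
Proof. by rewrite !(dotC x) dotZl. Qed.
Lemma dot0l x : dot vzero x = 0.
Proof. by rewrite /dot big1 // => i _; rewrite /vzero; ring. Qed.
Lemma dot0r x : dot x vzero = 0.
Proof. by rewrite dotC dot0l. Qed.

Definition dotE := (@dotDl, @dotDr, @dotBl, @dotBr, @dotZl, @dotZr, @dot0l, @dot0r).

Lemma nrm2_ge0 x : 0 <= nrm2 x.
Proof. by apply: sumR_ge0 => i; nra. Qed.

Lemma nrm2_eq0 x : nrm2 x = 0 -> x = vzero.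
Proof.
move=> x0; apply: functional_extensionality => i; rewrite /vzero.
have := @sumR_ge_term _ (fun i => x i * x i) i (fun i => Rle_0_sqr (x i)).
rewrite -/(dot x x) -/(nrm2 x) x0 /=; nra.
Qed.

Lemma vnorm_ge0 x : 0 <= vnorm x. Proof. exact: sqrt_pos. Qed.
Lemma vnorm_sqr x : vnorm x * vnorm x = nrm2 x.
Proof. by rewrite /vnorm sqrt_sqrt //; exact: nrm2_ge0. Qed.
Lemma vnorm_eq0 x : vnorm x = 0 -> x = vzero.
Proof. by move=> x0; apply: nrm2_eq0; rewrite -vnorm_sqr x0; ring. Qed.
Lemma vnorm0 : vnorm (vzero : vec n) = 0.
Proof. by rewrite /vnorm /nrm2 dot0l sqrt_0. Qed.

Lemma sqr_le_le a b : 0 <= b -> a * a <= b * b -> a <= b.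
Proof. by move=> b0 ab; nra. Qed.
Lemma sqr_lt_lt a b : 0 <= b -> a * a < b * b -> a < b.
Proof. by move=> b0 ab; nra. Qed.
Lemma sqr_eq_eq a b : 0 <= a -> 0 <= b -> a * a = b * b -> a = b.
Proof. by move=> a0 b0 ab; nra. Qed.

Lemma cauchy_schwarz_sqr x y : dot x y * dot x y <= nrm2 x * nrm2 y.
Proof.
have [y0|y0] : nrm2 y = 0 \/ 0 < nrm2 y by have := nrm2_ge0 y; lra.
  by rewrite y0 (nrm2_eq0 y0) dot0r; lra.
have := nrm2_ge0 (vsub (vscal (nrm2 y) x) (vscal (dot x y) y)).
rewrite /nrm2 !dotE (dotC y x) -/(nrm2 x) -/(nrm2 y).
set a := nrm2 x; set b := nrm2 y; set c := dot x y => H.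
have : 0 <= b * (a * b - c * c) by nra.
by rewrite -/b in y0; nra.
Qed.

Lemma cauchy_schwarz x y : Rabs (dot x y) <= vnorm x * vnorm y.
Proof.
have := vnorm_ge0 x; have := vnorm_ge0 y => y0 x0.
apply: sqr_le_le; first nra.
rewrite -Rabs_mult Rabs_right; last exact: sqr_ge0.
have := cauchy_schwarz_sqr x y; rewrite -!vnorm_sqr; nra.
Qed.
Lemma dot_le x y : dot x y <= vnorm x * vnorm y.
Proof. exact: Rle_trans (Rle_abs _) (cauchy_schwarz x y). Qed.

Lemma vnorm_tri x y : vnorm (vadd x y) <= vnorm x + vnorm y.
Proof.
have := vnorm_ge0 x; have := vnorm_ge0 y => y0 x0.
apply: sqr_le_le; first lra.
rewrite vnorm_sqr /nrm2 !dotE (dotC y x) -!/(nrm2 _) -!vnorm_sqr.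
have := dot_le x y; nra.
Qed.

Lemma vnormZ a x : vnorm (vscal a x) = Rabs a * vnorm x.
Proof.
have := vnorm_ge0 x => x0; have := Rabs_pos a => a0.
apply: sqr_eq_eq; [exact: vnorm_ge0|nra|].
rewrite vnorm_sqr /nrm2 !dotE -/(nrm2 x) -vnorm_sqr.
have := abs_sqr a.
nra.
Qed.

Lemma vdistC x y : vdist x y = vdist y x.
Proof.
rewrite /vdist (_ : vsub x y = vscal (-1) (vsub y x)).
  by rewrite vnormZ Rabs_Ropp Rabs_R1; ring.
by apply: functional_extensionality => i; rewrite /vsub /vscal; ring.
Qed.
Lemma vdist_ge0 x y : 0 <= vdist x y. Proof. exact: vnorm_ge0. Qed.
Lemma vdist_tri x y z : vdist x z <= vdist x y + vdist y z.
Proof.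
rewrite /vdist (_ : vsub x z = vadd (vsub x y) (vsub y z)); first exact: vnorm_tri.
by apply: functional_extensionality => i; rewrite /vsub /vadd; ring.
Qed.
Lemma vdist_xx x : vdist x x = 0.
Proof.
rewrite /vdist (_ : vsub x x = vzero) ?vnorm0 //.
by apply: functional_extensionality => i; rewrite /vsub /vzero; ring.
Qed.
Lemma vdist_eq0 x y : vdist x y = 0 -> x = y.
Proof.
move=> /vnorm_eq0 xy; apply: functional_extensionality => i.
have := f_equal (fun g => g i) xy; rewrite /vsub /vzero; lra.
Qed.
Lemma vnorm_gt0 x : x <> vzero -> 0 < vnorm x.
Proof. by move=> ne; case: (Rle_lt_or_eq_dec _ _ (vnorm_ge0 x)) => // /esym /vnorm_eq0. Qed.
Lemma vdist_gt0 x y : x <> y -> 0 < vdist x y.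
Proof. by move=> ne; case: (Rle_lt_or_eq_dec _ _ (vdist_ge0 x y)) => // /esym /vdist_eq0. Qed.
Lemma vdist_sqr x y : vdist x y * vdist x y = nrm2 (vsub x y).
Proof. exact: vnorm_sqr. Qed.

Lemma nrm2_lt x r : 0 < r -> nrm2 x < r * r <-> vnorm x < r.
Proof.
move=> r0; rewrite -vnorm_sqr; have := vnorm_ge0 x => x0.
by split=> [|H]; [apply: sqr_lt_lt; lra|nra].
Qed.

Lemma pt0 x v : pt x 0 v = x.
Proof. by apply: functional_extensionality => i; rewrite /pt /vadd /vscal; ring. Qed.
Lemma pt_pt x s t v : pt (pt x s v) t v = pt x (s + t) v.
Proof. by apply: functional_extensionality => i; rewrite /pt /vadd /vscal; ring. Qed.
Lemma pt_scal x s a v : pt x s (vscal a v) = pt x (s * a) v.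
Proof. by apply: functional_extensionality => i; rewrite /pt /vadd /vscal; ring. Qed.
Lemma pt_sub x v s t : vsub (pt x s v) (pt x t v) = vscal (s - t) v.
Proof. by apply: functional_extensionality => i; rewrite /pt /vadd /vsub /vscal; ring. Qed.
Lemma pt1_sub x y : pt x 1 (vsub y x) = y.
Proof. by apply: functional_extensionality => i; rewrite /pt /vadd /vsub /vscal; ring. Qed.
Lemma ptK x t v : vsub (pt x t v) x = vscal t v.
Proof. by apply: functional_extensionality => i; rewrite /pt /vadd /vsub /vscal; ring. Qed.
Lemma addK x h : vsub (vadd x h) x = h.
Proof. by apply: functional_extensionality => i; rewrite /vadd /vsub; ring. Qed.
Lemma subK x y : vadd x (vsub y x) = y.
Proof. by apply: functional_extensionality => i; rewrite /vadd /vsub; ring. Qed.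
Lemma sub_pt x y t v : vsub x (pt y t v) = vsub (vsub x y) (vscal t v).
Proof. by apply: functional_extensionality => i; rewrite /pt /vadd /vsub /vscal; ring. Qed.
Lemma vdist_pt x v s t : vdist (pt x s v) (pt x t v) = Rabs (s - t) * vnorm v.
Proof. by rewrite /vdist pt_sub vnormZ. Qed.
Lemma vdist_pt0 x v t : vdist (pt x t v) x = Rabs t * vnorm v.
Proof. by rewrite /vdist ptK vnormZ. Qed.
Lemma vscal1 v : vscal 1 v = v.
Proof. by apply: functional_extensionality => i; rewrite /vscal; ring. Qed.
Lemma vscal0 v : vscal 0 v = vzero.
Proof. by apply: functional_extensionality => i; rewrite /vscal /vzero; ring. Qed.
Lemma vscalA a b v : vscal a (vscal b v) = vscal (a * b) v.
Proof. by apply: functional_extensionality => i; rewrite /vscal; ring. Qed.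
Lemma vnormN v : vnorm (vscal (-1) v) = vnorm v.
Proof. by rewrite vnormZ Rabs_Ropp Rabs_R1; ring. Qed.

Lemma unit_dot1 v w : vnorm v = 1 -> vnorm w = 1 -> 1 <= dot v w -> v = w.
Proof.
move=> v1 w1 vw; apply: vdist_eq0.
have : vdist v w * vdist v w <= 0; last by have := vdist_ge0 v w; nra.
rewrite vdist_sqr /nrm2 !dotE (dotC w v) -!/(nrm2 _) -!vnorm_sqr v1 w1; lra.
Qed.

Lemma vnorm_comp x i : Rabs (x i) <= vnorm x.
Proof.
apply: sqr_le_le; first exact: vnorm_ge0.
rewrite vnorm_sqr -Rabs_mult Rabs_right; last exact: sqr_ge0.
exact: (@sumR_ge_term _ (fun i => x i * x i) i (fun i => Rle_0_sqr (x i))).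
Qed.

Lemma vnorm_le_comp x r : 0 <= r -> (forall i, Rabs (x i) <= r) -> vnorm x <= INR n * r.
Proof.
move=> r0 H; have n0 := pos_INR n.
apply: sqr_le_le; first nra.
rewrite vnorm_sqr /nrm2 /dot.
apply: (@Rle_trans _ (\big[Rplus/0]_(i < n) (r * r))).
  apply: sumR_le => i; have := H i; have := Rabs_pos (x i).
  have := abs_sqr (x i).
  nra.
rewrite sumR_const.
have [->|n1] : INR n = 0 \/ 1 <= INR n.
  case: (n) => [|m]; [by left|right; rewrite S_INR; have := pos_INR m; lra].
- by right; ring.
- have : 0 <= r * r by nra.
  nra.
Qed.

End Vectors.

Ltac vec_ring := apply: functional_extensionality => ?; rewrite /pt /vadd /vsub /vscal /vzero; ring.

(** Induction along an interval by a supremum argument. A single step at [b] combines the passage to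
    the limit (from some [b0] just below [b]) and the continuation beyond [b]; it serves below
    wherever a compactness or continuation argument on an interval is needed. *)
Lemma real_ind (Q : R -> Prop) (B : R) : 0 <= B -> Q 0 ->
  (forall b, 0 <= b <= B -> exists eps, 0 < eps /\
     forall b0, 0 <= b0 -> b - eps < b0 <= b -> Q b0 ->
     forall b1, b <= b1 < b + eps -> b1 <= B -> Q b1) ->
  Q B.
Proof.
move=> B0 Q0 step.
pose S b := 0 <= b <= B /\ Q b.
have [s [sub slub]] : {s | is_lub S s}.
  apply: completeness; first by exists B => b [[_ ?] _].
  by exists 0; split=> //; lra.
have s0 : 0 <= s by apply: sub; split=> //; lra.
have sB : s <= B by apply: slub => b [[_ ?] _].
have [eps [eps0 H]] := step s (conj s0 sB).
have [b0 [Sb0 lb0]] : exists b0, S b0 /\ s - eps < b0.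
  apply: NNPP => N.
  have : s <= s - eps; last lra.
  apply: slub => b Sb; case: (Rle_dec b (s - eps)) => // nb.
  by case: N; exists b; split=> //; lra.
have b0s : b0 <= s by exact: sub.
have Hs := H b0 (proj1 (proj1 Sb0)) (conj lb0 b0s) (proj2 Sb0).
case: (Req_dec s B) => [<-|nsB]; first by apply: Hs => //; lra.
pose b1 := Rmin B (s + eps / 2).
have b1B : b1 <= B by exact: Rmin_l.
have b1s : b1 <= s + eps / 2 by exact: Rmin_r.
have sb1 : s < b1 by apply: Rmin_glb_lt; lra.
have : b1 <= s; last lra.
by apply: sub; split; [lra|apply: Hs; lra].
Qed.

(** * Continuity, open sets and connectedness *)

Definition cont_at {n} (D : vec n -> R) (x : vec n) : Prop :=
  forall eps, 0 < eps -> exists delta, 0 < delta /\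
    forall y, vdist y x < delta -> Rabs (D y - D x) < eps.

Definition vcont_at {n m} (D : vec n -> vec m) (x : vec n) : Prop :=
  forall eps, 0 < eps -> exists delta, 0 < delta /\
    forall y, vdist y x < delta -> vdist (D y) (D x) < eps.

Lemma is_openP {n} (U : vec n -> Prop) :
  is_open U <-> forall x, U x -> exists r, 0 < r /\ forall y, vdist y x < r -> U y.
Proof.
split=> H x /H [r [r0 Hr]]; exists r; split=> // y yx; apply: Hr.
  by apply/nrm2_lt.
by apply/nrm2_lt.
Qed.

Lemma open_lt {n} (D : vec n -> R) (c : R) :
  (forall x, cont_at D x) -> is_open (fun x => D x < c).
Proof.
move=> Dc; apply/is_openP => x xc.
have [|d [d0 H]] := Dc x (c - D x); first lra.
exists d; split=> // y /H; move/Rabs_def2; lra.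
Qed.

Lemma open_gt {n} (D : vec n -> R) (c : R) :
  (forall x, cont_at D x) -> is_open (fun x => c < D x).
Proof.
move=> Dc; apply/is_openP => x xc.
have [|d [d0 H]] := Dc x (D x - c); first lra.
exists d; split=> // y /H; move/Rabs_def2; lra.
Qed.

Lemma connected_ivt {n} (A : vec n -> Prop) (D : vec n -> R) x y c :
  connected A -> (forall z, cont_at D z) -> A x -> A y -> D x < c < D y ->
  exists z, A z /\ D z = c.
Proof.
move=> cA Dc Ax Ay [xc cy]; apply: NNPP => N; apply: cA.
exists (fun z => D z < c), (fun z => c < D z).
split; first exact: open_lt.
split; first exact: open_gt.
split.
  move=> z Az; case: (Rtotal_order (D z) c) => [|[e|]]; [by left| |by right].
  by case: N; exists z.
split; first by exists x.
split; first by exists y.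
by move=> z _; lra.
Qed.

Lemma conn_comp_trans {n} (S : vec n -> Prop) x y z :
  conn_comp S x y -> conn_comp S y z -> conn_comp S x z.
Proof.
move=> [A [cA [AS [Ax Ay]]]] [B [cB [BS [By Bz]]]].
exists (fun w => A w \/ B w); split; last first.
  by split; [move=> w [/AS|/BS]|split; [left|right]].
(* The two separating sets are interchangeable, so it suffices to treat the one that contains the
   common point [y]. *)
have half U V : is_open U -> is_open V -> (forall w, A w \/ B w -> U w \/ V w) ->
    (forall w, A w \/ B w -> U w -> V w -> False) -> U y ->
    (exists w, (A w \/ B w) /\ V w) -> False.
  move=> oU oV cov dis Uy [w [[Aw|Bw] Vw]].
    apply: cA; exists U, V; do 2![split=> //].
    split; first by move=> u Au; apply: cov; left.
    split; first by exists y.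
    split; first by exists w.
    by move=> u Au; apply: dis; left.
  apply: cB; exists U, V; do 2![split=> //].
  split; first by move=> u Au; apply: cov; right.
  split; first by exists y.
  split; first by exists w.
  by move=> u Au; apply: dis; right.
move=> [U [V [oU [oV [cov [exU [exV dis]]]]]]].
case: (cov y (or_introl Ay)) => [Uy|Vy].
  exact: (half U V).
apply: (half V U) => //.
  by move=> w /cov [|]; [right|left].
by move=> w Hw Vw Uw; exact: (dis w).
Qed.

Definition path_cont {n} (g : R -> vec n) : Prop :=
  forall t, 0 <= t <= 1 -> forall eps, 0 < eps -> exists delta, 0 < delta /\
    forall s, 0 <= s <= 1 -> Rabs (s - t) < delta -> vdist (g s) (g t) < eps.

Lemma path_conn {n} (S : vec n -> Prop) (g : R -> vec n) :
  path_cont g -> (forall t, 0 <= t <= 1 -> S (g t)) -> conn_comp S (g 0) (g 1).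
Proof.
move=> gc gS; exists (fun z => exists t, 0 <= t <= 1 /\ z = g t).
split; last first.
  split; first by move=> z [t [t01 ->]]; exact: gS.
  by split; [exists 0; split=> //; lra|exists 1; split=> //; lra].
have half U V : is_open U -> is_open V ->
    (forall z, (exists t, 0 <= t <= 1 /\ z = g t) -> U z \/ V z) ->
    (forall z, (exists t, 0 <= t <= 1 /\ z = g t) -> U z -> V z -> False) ->
    U (g 0) -> forall B, 0 <= B <= 1 -> U (g B).
  move=> /is_openP oU /is_openP oV cov dis U0 B B01.
  apply: (@real_ind (fun t => U (g t)) B) => //; first lra.
  move=> b bB; have b01 : 0 <= b <= 1 by lra.
  have [Ub|Vb] := cov (g b) (ex_intro _ b (conj b01 erefl)).
    have [r [r0 Hr]] := oU _ Ub; have [d [d0 Hd]] := gc b b01 r r0.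
    exists d; split=> // b0 b00 b0b _ b1 b1b b1B; apply: Hr; apply: Hd; first lra.
    by apply: Rabs_def1; lra.
  have [r [r0 Hr]] := oV _ Vb; have [d [d0 Hd]] := gc b b01 r r0.
  exists d; split=> // b0 b00 b0b Ub0; exfalso.
  apply: (dis (g b0)) => //; first by exists b0; split=> //; lra.
  by apply: Hr; apply: Hd; [lra|apply: Rabs_def1; lra].
move=> [U [V [oU [oV [cov [[_ [[a [a01 ->]] Ua]] [[_ [[b [b01 ->]] Vb]] dis]]]]]]].
have [U0|V0] : U (g 0) \/ V (g 0) by apply: cov; exists 0; split=> //; lra.
  by apply: (dis (g b)) => //; [exists b|apply: (half U V)].
apply: (dis (g a)) => //; first by exists a.
apply: (half V U) => //; first by move=> z /cov [|]; [right|left].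
by move=> z Hz Vz Uz; exact: (dis z).
Qed.

Lemma pt_path_cont {n} (x v : vec n) : path_cont (fun t => pt x t v).
Proof.
move=> t _ eps eps0; have v0 := vnorm_ge0 v.
exists (eps / (vnorm v + 1)); split; first by apply: Rdiv_lt_0_compat; lra.
move=> s _ st; rewrite vdist_pt.
have : Rabs (s - t) * (vnorm v + 1) < eps.
  by move: st => /(Rmult_lt_compat_r (vnorm v + 1)); rewrite /Rdiv Rmult_assoc Rinv_l; lra.
have := Rabs_pos (s - t); nra.
Qed.

(** * Compactness *)

(** The condition [m <= phi m] stands in for strict monotonicity: it suffices for limits, is stable
    under composition and lets each index be chosen independently. *)
Lemma real_subseq (u : nat -> R) (K : R) : (forall m, Rabs (u m) <= K) ->
  exists (phi : nat -> nat) (l : R), (forall m, (m <= phi m)%N) /\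
    forall eps, 0 < eps -> exists M, forall m, (M <= m)%N -> Rabs (u (phi m) - l) < eps.
Proof.
move=> uK.
have [l Hl] : exists l, ValAdh u l.
  apply: (@Bolzano_Weierstrass u (fun c => - K <= c <= K)); first exact: compact_P3.
  by move=> m; have := uK m; move/Rabs_le_between.
have nxt m : exists p, (m <= p)%N /\ Rabs (u p - l) < / INR m.+1.
  have m0 : 0 < / INR m.+1 by apply: Rinv_0_lt_compat; apply: lt_0_INR; lia.
  have [|p [Np Hp]] := Hl (disc l (mkposreal _ m0)) m.
    by exists (mkposreal _ m0).
  by exists p; split; [apply/leP|].
exists (fun m => proj1_sig (constructive_indefinite_description _ (nxt m))), l.
split=> [m|eps eps0].
  by case: (constructive_indefinite_description _ _) => p [].
have [M [HM M0]] := archimed_cor1 eps eps0.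
exists M => m /leP Mm.
case: (constructive_indefinite_description _ _) => p [_ /= Hp].
apply: Rlt_trans Hp _; apply: Rle_lt_trans HM.
apply: Rinv_le_contravar; first by apply: lt_0_INR.
by rewrite -/(INR m.+1); apply: le_INR; lia.
Qed.

Definition vlim {n} (x : nat -> vec n) (l : vec n) : Prop :=
  forall eps, 0 < eps -> exists M, forall m, (M <= m)%N -> vdist (x m) l < eps.

Lemma vec_subseq {n} (x : nat -> vec n) (K : R) : (forall m, vnorm (x m) <= K) ->
  exists (phi : nat -> nat) (l : vec n), (forall m, (m <= phi m)%N) /\
    vlim (fun m => x (phi m)) l.
Proof.
move=> xK.
(* The coordinates are made to converge one at a time, each by refining the previous subsequence. *)
have H k : exists (phi : nat -> nat) (l : vec n), (forall m, (m <= phi m)%N) /\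
    forall i : 'I_n, (i < k)%N ->
    forall eps, 0 < eps -> exists M, forall m, (M <= m)%N -> Rabs (x (phi m) i - l i) < eps.
  elim: k => [|k [phi [l [phim Hl]]]]; first by exists id, vzero.
  case: (ltnP k n) => [kn|nk]; last first.
    exists phi, l; split=> // i _; apply: Hl; exact: leq_trans (ltn_ord i) nk.
  have [|psi [c [psim Hc]]] := @real_subseq (fun m => x (phi m) (Ordinal kn)) K.
    by move=> m; exact: Rle_trans (vnorm_comp _ _) (xK _).
  exists (fun m => phi (psi m)), (fun i => if i == Ordinal kn then c else l i).
  split=> [m|i ik eps eps0]; first exact: leq_trans (psim m) (phim _).
  case: eqP => [->|/eqP ne]; first exact: Hc.
  have {}ik : (i < k)%N.
    by move: ik; rewrite ltnS leq_eqVlt => /orP [/eqP e|//]; case/eqP: ne; exact/val_inj.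
  have [M HM] := Hl i ik eps eps0; exists M => m Mm; apply: HM.
  exact: leq_trans Mm (psim m).
have [phi [l [phim Hl]]] := H n.
exists phi, l; split=> // eps eps0.
have n0 := pos_INR n.
have e0 : 0 < eps / (INR n + 1) by apply: Rdiv_lt_0_compat; lra.
have /choice [M HM] : forall i, exists M, forall m, (M <= m)%N -> Rabs (x (phi m) i - l i) < eps / (INR n + 1).
  by move=> i; exact: (Hl i (ltn_ord i) _ e0).
exists (\max_i M i) => m Mm.
apply: (@Rle_lt_trans _ (INR n * (eps / (INR n + 1)))).
  apply: vnorm_le_comp; first lra.
  move=> i; apply/Rlt_le/HM; apply: leq_trans Mm; exact: leq_bigmax.
have : (INR n + 1) * (eps / (INR n + 1)) = eps by field; lra.
nra.
Qed.

Definition closed_set {n} (K : vec n -> Prop) : Prop :=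
  forall x, ~ K x -> exists r, 0 < r /\ forall y, vdist y x < r -> ~ K y.

Lemma closed_lim {n} (K : vec n -> Prop) (x : nat -> vec n) l :
  closed_set K -> (forall m, K (x m)) -> vlim x l -> K l.
Proof.
move=> cK Kx xl; apply: NNPP => /cK [r [r0 Hr]].
by have [M HM] := xl r r0; apply: (Hr (x M)) => //; exact: HM.
Qed.

Lemma compact_max {n} (K : vec n -> Prop) (B : R) (u : vec n -> R) :
  closed_set K -> (forall x, K x -> vnorm x <= B) -> (exists x, K x) ->
  (forall x, K x -> forall eps, 0 < eps -> exists delta, 0 < delta /\
     forall y, K y -> vdist y x < delta -> Rabs (u y - u x) < eps) ->
  exists x, K x /\ forall y, K y -> u y <= u x.
Proof.
move=> cK KB [x0 Kx0] uc.
have bnd : exists S, forall y, K y -> u y <= S.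
  apply: NNPP => N.
  have /choice [x Hx] : forall m, exists y, K y /\ INR m < u y.
    move=> m; apply: NNPP => N'; apply: N; exists (INR m) => y Ky.
    by apply: Rnot_lt_le => H; apply: N'; exists y.
  have [phi [l [phim Hl]]] := @vec_subseq n x B (fun m => KB _ (proj1 (Hx m))).
  have Kl : K l by apply: (closed_lim cK _ Hl) => m; exact: (proj1 (Hx _)).
  have [d [d0 Hd]] := uc l Kl 1 Rlt_0_1.
  have [M HM] := Hl d d0.
  have [N1 HN1] := INR_unbounded (u l + 1).
  have Mm := leq_maxl M N1; have Nm := leq_maxr M N1.
  have := Hd _ (proj1 (Hx (phi (maxn M N1)))) (HM _ Mm) => /Rabs_def2.
  have := proj2 (Hx (phi (maxn M N1))).
  have : INR N1 <= INR (phi (maxn M N1)).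
    by apply: le_INR; apply/leP; apply: leq_trans Nm (phim _).
  lra.
case: bnd => S HS.
have [s [sub slub]] : {s | is_lub (fun r => exists y, K y /\ r = u y) s}.
  apply: completeness; first by exists S => r [y [Ky ->]]; exact: HS.
  by exists (u x0), x0.
have /choice [x Hx] : forall m : nat, exists y, K y /\ s - / INR m.+1 < u y.
  move=> m; apply: NNPP => N'.
  have m0 : 0 < / INR m.+1 by apply: Rinv_0_lt_compat; apply: lt_0_INR; lia.
  have : s <= s - / INR m.+1; last lra.
  apply: slub => r [y [Ky ->]]; apply: Rnot_lt_le => H; apply: N'; by exists y.
have [phi [l [phim Hl]]] := @vec_subseq n x B (fun m => KB _ (proj1 (Hx m))).
have Kl : K l by apply: (closed_lim cK _ Hl) => m; exact: (proj1 (Hx _)).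
exists l; split=> // y Ky.
apply: (@Rle_trans _ s); first by apply: sub; exists y.
apply: le_epsilon => eps eps0.
have [d [d0 Hd]] := uc l Kl (eps / 2) ltac:(lra).
have [M HM] := Hl d d0.
have [N1 [HN1 N10]] := archimed_cor1 (eps / 2) ltac:(lra).
have Mm := leq_maxl M N1; have Nm := leq_maxr M N1.
have := Hd _ (proj1 (Hx (phi (maxn M N1)))) (HM _ Mm) => /Rabs_def2.
have := proj2 (Hx (phi (maxn M N1))).
have : / INR (phi (maxn M N1)).+1 <= / INR N1.
  apply: Rinv_le_contravar; first by apply: lt_0_INR.
  apply: le_INR; apply/leP; apply: leq_trans Nm _; apply: leq_trans (phim _) _; exact: leqnSn.
lra.
Qed.

Lemma closed_ball_closed {n} (c : vec n) r : closed_set (fun y => vdist y c <= r).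
Proof.
move=> x /Rnot_le_lt H; exists (vdist x c - r); split; first lra.
move=> y yx; have := vdist_tri x y c; rewrite (vdistC x y); lra.
Qed.

Lemma vnorm_le_dist {n} (x c : vec n) : vnorm x <= vnorm c + vdist x c.
Proof. by rewrite -{1}(subK c x); exact: vnorm_tri. Qed.

Lemma ball_max {n} (c : vec n) r (u : vec n -> R) : 0 <= r ->
  (forall x, vdist x c <= r -> cont_at u x) ->
  exists x, vdist x c <= r /\ forall y, vdist y c <= r -> u y <= u x.
Proof.
move=> r0 uc; apply: (@compact_max n _ (vnorm c + r)).
- exact: closed_ball_closed.
- by move=> x xr; have := vnorm_le_dist x c; lra.
- by exists c; rewrite vdist_xx.
- move=> x /uc H eps /H [d [d0 Hd]]; exists d; split=> // y _; exact: Hd.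
Qed.

Lemma dist_cont {n} (c x : vec n) : cont_at (fun y => vdist y c) x.
Proof.
move=> eps eps0; exists eps; split=> // y yx.
have := vdist_tri x y c; have := vdist_tri y x c; rewrite (vdistC x y) => *.
by apply: Rabs_def1; lra.
Qed.

Lemma nearest {n} (K : vec n -> Prop) (x : vec n) :
  closed_set K -> (exists p, K p) ->
  exists p, K p /\ forall q, K q -> vdist x p <= vdist x q.
Proof.
move=> cK [p0 Kp0].
(* Cutting with the closed ball about [x] through a known point [p0] makes the set bounded without
   losing the nearest points. *)
pose K' p := K p /\ vdist p x <= vdist p0 x.
have [||||p [[Kp px] Hp]] :=
  @compact_max n K' (vnorm x + vdist p0 x) (fun p => - vdist p x).
- move=> y nK'; have [Ky|/cK [r [r0 Hr]]] := classic (K y); last first.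
    by exists r; split=> // z /Hr nKz [].
  have nb : ~ vdist y x <= vdist p0 x by move=> H; apply: nK'.
  have [r [r0 Hr]] := closed_ball_closed nb.
  by exists r; split=> // z /Hr nKz [].
- by move=> p [_ H]; have := vnorm_le_dist p x; lra.
- by exists p0; split=> //; lra.
- move=> y _ eps eps0; have [d [d0 Hd]] := dist_cont x y eps0.
  exists d; split=> // z _ /Hd H.
  by rewrite (_ : _ - _ = - (vdist z x - vdist y x)) ?Rabs_Ropp //; ring.
exists p; split=> // q Kq; rewrite !(vdistC x).
case: (Rle_dec (vdist q x) (vdist p0 x)) => [H|]; last lra.
by have := Hp q (conj Kq H); lra.
Qed.

(** * Gradients: chain rule and mean value theorem *)

Lemma has_gradP {n} (f : vec n -> R) x g : has_grad f x g <->
  forall eps, 0 < eps -> exists delta, 0 < delta /\ forall y, vdist y x < delta ->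
    Rabs (f y - f x - dot g (vsub y x)) <= eps * vdist y x.
Proof.
have E (a e h : R) : 0 <= e -> 0 <= h -> Rsqr a <= e * e * (h * h) <-> Rabs a <= e * h.
  move=> e0 h0; have eh : 0 <= e * h by nra.
  have aa : Rabs a * Rabs a = Rsqr a.
    by rewrite -Rabs_mult Rabs_right //; exact: sqr_ge0.
  rewrite -aa (_ : e * e * (h * h) = (e * h) * (e * h)); last ring.
  split; first exact: sqr_le_le.
  by have := Rabs_pos a; nra.
split=> H eps eps0; have [d [d0 Hd]] := H eps eps0; exists d; split=> //.
  move=> y yx; apply/E; [lra|exact: vdist_ge0|].
  have := Hd (vsub y x); rewrite subK vdist_sqr; apply; exact/nrm2_lt.
move=> h /(nrm2_lt _ d0) hd; rewrite -vnorm_sqr; apply/E; [lra|exact: vnorm_ge0|].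
by have := Hd (vadd x h); rewrite /vdist addK; apply.
Qed.

Lemma has_grad_cont {n} (f : vec n -> R) x g : has_grad f x g -> cont_at f x.
Proof.
move=> /has_gradP H eps eps0; have [d [d0 Hd]] := H 1 Rlt_0_1.
have g0 := vnorm_ge0 g.
have e0 : 0 < eps / (vnorm g + 1) by apply: Rdiv_lt_0_compat; lra.
exists (Rmin d (eps / (vnorm g + 1))); split; first by apply: Rmin_glb_lt.
move=> y yx.
have yd : vdist y x < d by exact: Rlt_minl yx.
have ye : vdist y x < eps / (vnorm g + 1) by exact: Rlt_minr yx.
have := Hd y yd; have := cauchy_schwarz g (vsub y x); rewrite -/(vdist y x) => cs H1.
have : vdist y x * (vnorm g + 1) < eps.
  by move: ye => /(Rmult_lt_compat_r (vnorm g + 1)); rewrite /Rdiv Rmult_assoc Rinv_l; lra.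
have := Rabs_triang (f y - f x - dot g (vsub y x)) (dot g (vsub y x)).
rewrite (_ : f y - f x - _ + _ = f y - f x); last ring.
lra.
Qed.

Lemma has_grad_line {n} (f : vec n -> R) x t v g :
  has_grad f (pt x t v) g -> is_derive (fun s => f (pt x s v)) t (dot g v).
Proof.
move=> /has_gradP H; apply/is_derive_Reals => eps eps0.
have v0 := vnorm_ge0 v.
have [|d [d0 Hd]] := H (eps / (2 * (vnorm v + 1))); first by apply: Rdiv_lt_0_compat; lra.
have e0 : 0 < d / (vnorm v + 1) by apply: Rdiv_lt_0_compat; lra.
exists (mkposreal _ e0) => h h0 /= hd.
have hh : 0 < Rabs h by apply: Rabs_pos_lt.
have hv : Rabs h * (vnorm v + 1) < d.
  by move: hd => /(Rmult_lt_compat_r (vnorm v + 1)); rewrite /Rdiv Rmult_assoc Rinv_l; lra.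
have := Hd (pt x (t + h) v); rewrite vdist_pt pt_sub (_ : t + h - t = h); last ring.
move=> /(_ ltac:(nra)); rewrite dotZr => H1.
rewrite (_ : (_ - _) / h - dot g v = (f (pt x (t + h) v) - f (pt x t v) - h * dot g v) / h); last by field.
rewrite Rabs_div //.
apply: (Rmult_lt_reg_r (Rabs h)) => //.
rewrite /Rdiv Rmult_assoc Rinv_l; last lra.
rewrite Rmult_1_r; apply: Rle_lt_trans H1 _.
have E : eps / (2 * (vnorm v + 1)) * (vnorm v + 1) = eps / 2 by field; lra.
have : 0 < eps / (2 * (vnorm v + 1)) by apply: Rdiv_lt_0_compat; lra.
set c := eps / _ in E *; nra.
Qed.

Lemma has_grad_uniq {n} (f : vec n -> R) x g g' : has_grad f x g -> has_grad f x g' -> g = g'.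
Proof.
move=> H H'; apply: vdist_eq0.
have : dot g (vsub g g') = dot g' (vsub g g').
  have D : has_grad f (pt x 0 (vsub g g')) g by rewrite pt0.
  have D' : has_grad f (pt x 0 (vsub g g')) g' by rewrite pt0.
  by rewrite -(is_derive_unique _ _ _ (has_grad_line D)) -(is_derive_unique _ _ _ (has_grad_line D')).
move=> E; have := vdist_sqr g g'; rewrite /nrm2 {1}vsubE dotDl dotZl E; have := vdist_ge0 g g'; nra.
Qed.

Lemma mvt {n} (f : vec n -> R) (G : vec n -> vec n) x y :
  (forall t, 0 <= t <= 1 -> has_grad f (pt x t (vsub y x)) (G (pt x t (vsub y x)))) ->
  exists t, 0 <= t <= 1 /\ f y - f x = dot (G (pt x t (vsub y x))) (vsub y x).
Proof.
move=> H; have E1 : Rmin 0 1 = 0 by apply: Rmin_left; lra.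
have E2 : Rmax 0 1 = 1 by apply: Rmax_right; lra.
have [||t [t01 Ht]] := @MVT_gen (fun s => f (pt x s (vsub y x))) 0 1
   (fun s => dot (G (pt x s (vsub y x))) (vsub y x)).
- by rewrite E1 E2 => t t01; apply: has_grad_line; apply: H; lra.
- rewrite E1 E2 => t t01; apply/continuity_pt_filterlim; apply: ex_derive_continuous.
  eexists; apply: has_grad_line; apply: H; lra.
rewrite E1 E2 in t01; exists t; split=> //.
by move: Ht; rewrite pt0 pt1_sub => ->; ring.
Qed.

Lemma seg_ball {n} (c x y : vec n) r t :
  vdist x c < r -> vdist y c < r -> 0 <= t <= 1 -> vdist (pt x t (vsub y x)) c < r.
Proof.
move=> xr yr t01.
rewrite /vdist (_ : vsub _ c = vadd (vscal (1 - t) (vsub x c)) (vscal t (vsub y c))); last first.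
  by vec_ring.
apply: Rle_lt_trans (vnorm_tri _ _) _.
rewrite !vnormZ !Rabs_right; try lra.
rewrite -/(vdist x c) -/(vdist y c).
have [m [mr [xm ym]]] : exists m, m < r /\ vdist x c <= m /\ vdist y c <= m.
  exists (Rmax (vdist x c) (vdist y c)); split; first exact: Rmax_lub_lt.
  by split; [exact: Rmax_l|exact: Rmax_r].
nra.
Qed.

Lemma has_grad_comp {n} (f : vec n -> R) x g (phi : R -> R) l :
  has_grad f x g -> is_derive phi (f x) l -> has_grad (fun y => phi (f y)) x (vscal l g).
Proof.
move=> fg /is_derive_Reals phl; have fc := has_grad_cont fg.
move/has_gradP: fg => fg; apply/has_gradP => eps eps0.
have g0 := vnorm_ge0 g; have l0 := Rabs_pos l.
pose e1 := eps / (2 * (vnorm g + 1)).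
have e10 : 0 < e1 by apply: Rdiv_lt_0_compat; lra.
pose e2 := Rmin 1 (eps / (2 * (Rabs l + 1))).
have e20 : 0 < e2 by apply: Rmin_glb_lt; [lra|apply: Rdiv_lt_0_compat; lra].
have e21 : e2 <= 1 by exact: Rmin_l.
have e2l : e2 * (Rabs l + 1) <= eps / 2.
  apply: (@Rle_trans _ (eps / (2 * (Rabs l + 1)) * (Rabs l + 1))).
    by apply: Rmult_le_compat_r; [lra|exact: Rmin_r].
  by apply: Req_le; field; lra.
have [d1 Hd1] := phl e1 e10.
have [d2 [d20 Hd2]] := fg e2 e20.
have [d3 [d30 Hd3]] := fc d1 (cond_pos d1).
exists (Rmin d2 d3); split; first exact: Rmin_glb_lt.
move=> y yx.
have {}Hd2 := Hd2 y (Rlt_minl yx).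
have {}Hd3 := Hd3 y (Rlt_minr yx).
have cs := cauchy_schwarz g (vsub y x); rewrite -/(vdist y x) in cs.
have df : Rabs (f y - f x) <= (vnorm g + 1) * vdist y x.
  have := Rabs_triang (f y - f x - dot g (vsub y x)) (dot g (vsub y x)).
  rewrite (_ : f y - f x - _ + _ = f y - f x); last ring.
  have := vdist_ge0 y x; nra.
have A : Rabs (phi (f y) - phi (f x) - l * (f y - f x)) <= e1 * Rabs (f y - f x).
  case: (Req_dec (f y) (f x)) => [->|ne].
    rewrite !Rminus_diag Rmult_0_r Rminus_0_r Rabs_R0; lra.
  have ne0 : f y - f x <> 0 by lra.
  have := Hd1 (f y - f x) ne0 Hd3; rewrite (_ : f x + (f y - f x) = f y); last ring.
  move=> H1.
  rewrite (_ : _ - l * _ = ((phi (f y) - phi (f x)) / (f y - f x) - l) * (f y - f x)); last by field.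
  rewrite Rabs_mult; have := Rabs_pos (f y - f x); nra.
rewrite dotZl.
rewrite (_ : _ - l * _ = (phi (f y) - phi (f x) - l * (f y - f x)) + l * (f y - f x - dot g (vsub y x))); last ring.
apply: Rle_trans (Rabs_triang _ _) _; rewrite Rabs_mult.
have E1 : e1 * (vnorm g + 1) = eps / 2 by rewrite /e1; field; lra.
have d0 := vdist_ge0 y x.
have : e1 * Rabs (f y - f x) <= eps / 2 * vdist y x by rewrite -E1 Rmult_assoc; apply: Rmult_le_compat_l; lra.
have : Rabs l * Rabs (f y - f x - dot g (vsub y x)) <= Rabs l * (e2 * vdist y x) by apply: Rmult_le_compat_l.
have : Rabs l * e2 <= eps / 2 by nra.
nra.
Qed.

Lemma has_grad_scal {n} (f : vec n -> R) x g a :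
  has_grad f x g -> has_grad (fun y => a * f y) x (vscal a g).
Proof.
move=> H; apply: (@has_grad_comp n f x g (fun s => a * s) a H).
by auto_derive => //; ring.
Qed.

Lemma has_grad_add {n} (f h : vec n -> R) x g g' :
  has_grad f x g -> has_grad h x g' -> has_grad (fun y => f y + h y) x (vadd g g').
Proof.
move=> /has_gradP H /has_gradP H'; apply/has_gradP => eps eps0.
have [|d [d0 Hd]] := H (eps / 2); first lra.
have [|d' [d'0 Hd']] := H' (eps / 2); first lra.
exists (Rmin d d'); split; first exact: Rmin_glb_lt.
move=> y yx.
have {}Hd := Hd y (Rlt_minl yx).
have {}Hd' := Hd' y (Rlt_minr yx).
rewrite dotDl.
rewrite (_ : _ - _ = (f y - f x - dot g (vsub y x)) + (h y - h x - dot g' (vsub y x))); last ring.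
apply: Rle_trans (Rabs_triang _ _) _; lra.
Qed.

Lemma has_grad_local {n} (f h : vec n -> R) x g r : 0 < r ->
  (forall y, vdist y x < r -> h y = f y) -> has_grad f x g -> has_grad h x g.
Proof.
move=> r0 E /has_gradP H; apply/has_gradP => eps eps0; have [d [d0 Hd]] := H eps eps0.
exists (Rmin d r); split; first exact: Rmin_glb_lt.
move=> y yx.
have {}Hd := Hd y (Rlt_minl yx).
by rewrite !E //; [rewrite vdist_xx|exact: Rlt_minr yx].
Qed.

Lemma has_grad_aff {n} (a : vec n) (c : R) x : has_grad (fun y => dot a y + c) x a.
Proof.
apply/has_gradP => eps eps0; exists 1; split; first lra.
move=> y _; rewrite dotBr (_ : _ - _ = 0); last ring.
by rewrite Rabs_R0; have := vdist_ge0 y x; nra.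
Qed.

(** Needed at the ends of a segment, where [u] is known to be affine on one side only; as the
    gradient exists, one side determines its component along [e]. *)
Lemma dir_deriv {n} (u : vec n -> R) z g e c s0 : vnorm e = 1 -> has_grad u z g -> 0 < s0 ->
  (forall s, 0 < s < s0 -> u (pt z s e) = u z + s * c) -> dot g e = c.
Proof.
move=> e1 /has_gradP H s00 E.
suff A : forall eps, 0 < eps -> Rabs (dot g e - c) <= eps.
  have : Rabs (dot g e - c) <= 0 by apply: le_epsilon => eps /A; lra.
  by have := Rle_abs (dot g e - c); have := Rle_abs (- (dot g e - c)); rewrite Rabs_Ropp; lra.
move=> eps eps0; have [d [d0 Hd]] := H eps eps0.
pose s := Rmin d s0 / 2.
have m0 : 0 < Rmin d s0 by exact: Rmin_glb_lt.
have s1 : 0 < s by rewrite /s; lra.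
have sd : s < d by have := Rmin_l d s0; rewrite /s; lra.
have ss : s < s0 by have := Rmin_r d s0; rewrite /s; lra.
have := Hd (pt z s e); rewrite vdist_pt0 e1 ptK dotZr (E s (conj s1 ss)).
rewrite (Rabs_right s); last lra.
move=> /(_ ltac:(lra)).
rewrite (_ : _ - s * dot g e = s * (c - dot g e)); last ring.
rewrite Rabs_mult (Rabs_right s) ?Rmult_1_r; last lra.
rewrite Rabs_minus_sym; have := Rabs_pos (dot g e - c); nra.
Qed.

(** * Functions with gradient of norm one *)

Definition eikonal {n} (u : vec n -> R) (N : vec n -> vec n) (x : vec n) (r : R) : Prop :=
  forall y, vdist y x < r -> has_grad u y (N y) /\ vnorm (N y) = 1.

Lemma eik_lip {n} u (N : vec n -> vec n) x r : eikonal u N x r ->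
  forall y z, vdist y x < r -> vdist z x < r -> u y - u z <= vdist y z.
Proof.
move=> H y z yr zr.
have [t t01|t [t01 ->]] := @mvt n u N z y; first by apply: (proj1 (H _ _)); exact: seg_ball.
apply: Rle_trans (dot_le _ _) _; rewrite (proj2 (H _ (seg_ball zr yr t01))) -/(vdist y z); lra.
Qed.

(** The maximum of [u] over the closed ball of radius [t] about [x] is [u x + t]: the Lipschitz
    bound gives one inequality. For the other, [u] minus (1-eps) times the distance to [x] has no
    interior maximum, because a step along the gradient raises [u] at rate almost 1. The maximum is
    then attained at distance [t], [u] grows at unit speed on the whole radius to it, and both end
    gradients must be the direction of this radius. *)
Lemma eik_line_pos {n} u (N : vec n -> vec n) x R : eikonal u N x R ->
  forall t, 0 < t < R -> u (pt x t (N x)) = u x + t /\ N (pt x t (N x)) = N x.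
Proof.
move=> H r [r0 rR].
have lip := eik_lip H.
have xR : vdist x x < R by rewrite vdist_xx; lra.
have N1 : vnorm (N x) = 1 by exact: (proj2 (H x xR)).
have [y1 [y1r y1max]] : exists y1, vdist y1 x <= r /\ forall y, vdist y x <= r -> u y <= u y1.
  apply: ball_max; first lra.
  by move=> y yr; apply: (has_grad_cont (proj1 (H y _))); lra.
have big : u x + r <= u y1.
  apply: le_epsilon => eps0 eps00.
  (* This choice gives [eps] <= 1 and [eps * r] <= [eps0], the error left over when the maximum is
     compared with the value at [x]. *)
  pose eps := eps0 / (eps0 + r).
  have epsr : eps * (eps0 + r) = eps0 by rewrite /eps; field; lra.
  have eps_pos : 0 < eps by apply: Rdiv_lt_0_compat; lra.
  have [y [yr ymax]] : exists y, vdist y x <= r /\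
      forall z, vdist z x <= r -> u z - (1 - eps) * vdist z x <= u y - (1 - eps) * vdist y x.
    apply: ball_max; first lra.
    move=> y yr e e0.
    have e2 : 0 < e / 2 by lra.
    have [d [d0 Hd]] := has_grad_cont (proj1 (H y (Rle_lt_trans _ _ _ yr rR))) e2.
    have k0 : 0 < e / (2 * (Rabs (1 - eps) + 1)).
      by apply: Rdiv_lt_0_compat; have := Rabs_pos (1 - eps); lra.
    have [d' [d'0 Hd']] := dist_cont x y k0.
    exists (Rmin d d'); split; first exact: Rmin_glb_lt.
    move=> z zy.
    have {}Hd := Hd z (Rlt_minl zy).
    have {}Hd' := Hd' z (Rlt_minr zy).
    rewrite (_ : _ - _ = (u z - u y) + - ((1 - eps) * (vdist z x - vdist y x))); last ring.
    apply: Rle_lt_trans (Rabs_triang _ _) _; rewrite Rabs_Ropp Rabs_mult.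
    have E : e / (2 * (Rabs (1 - eps) + 1)) * (Rabs (1 - eps) + 1) = e / 2.
      by field; have := Rabs_pos (1 - eps); lra.
    have := Rabs_pos (1 - eps); set c := e / (2 * _) in Hd' E k0 *.
    have := Rabs_pos (vdist z x - vdist y x); nra.
  have yR : vdist y x < R by lra.
  have {}yr : vdist y x = r.
    apply: Rle_antisym => //; apply: Rnot_lt_le => ylt.
    have [/has_gradP G g1] := H y yR.
    have [|d [d0 Hd]] := G (eps / 2); first lra.
    pose s := Rmin d (r - vdist y x) / 2.
    have m0 : 0 < Rmin d (r - vdist y x) by apply: Rmin_glb_lt; lra.
    have s0 : 0 < s by rewrite /s; lra.
    have sd : s < d by have := Rmin_l d (r - vdist y x); rewrite /s; lra.
    have sr : s < r - vdist y x by have := Rmin_r d (r - vdist y x); rewrite /s; lra.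
    have sE : vdist (pt y s (N y)) y = s by rewrite vdist_pt0 g1 Rabs_right; lra.
    have tri := vdist_tri (pt y s (N y)) y x.
    have := ymax (pt y s (N y)) ltac:(lra).
    have := Hd (pt y s (N y)); rewrite sE ptK dotZr -/(nrm2 (N y)) -vnorm_sqr g1.
    move=> /(_ sd) /Rabs_le_between.
    have e1 : eps <= 1.
      by apply: (Rmult_le_reg_r (eps0 + r)); lra.
    nra.
  have := ymax x; rewrite vdist_xx yr; have := y1max y; nra.
have up : u y1 - u x <= vdist y1 x by apply: lip => //; lra.
have d1 : vdist y1 x = r by lra.
have u1 : u y1 = u x + r by lra.
pose e := vscal (/ r) (vsub y1 x).
have e1 : vnorm e = 1.
  rewrite /e vnormZ -/(vdist y1 x) d1 Rabs_right; first by field; lra.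
  by apply/Rle_ge/Rlt_le/Rinv_0_lt_compat.
have y1E : y1 = pt x r e.
  rewrite /e pt_scal (_ : r * / r = 1); last by field; lra.
  by rewrite pt1_sub.
have lin s : 0 <= s <= r -> u (pt x s e) = u x + s.
  move=> sr.
  have ds : vdist (pt x s e) x = s by rewrite vdist_pt0 e1 Rabs_right; lra.
  have ds' : vdist y1 (pt x s e) = r - s by rewrite y1E vdist_pt e1 Rabs_right; lra.
  have := lip (pt x s e) x ltac:(lra) xR.
  have := lip y1 (pt x s e) ltac:(lra) ltac:(lra).
  lra.
have NE : N x = e.
  apply: unit_dot1 => //.
  have -> : dot (N x) e = 1; last lra.
  apply: (@dir_deriv n u x _ e 1 r) => //; first exact: (proj1 (H x xR)).
  by move=> s sr; rewrite lin; lra.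
rewrite NE -y1E; split=> //.
have [y1g y1n] := H y1 ltac:(lra).
(* The same argument seen from the far end: going back from [y1] the function falls at unit
   speed. *)
have E : dot (N y1) (vscal (-1) e) = -1.
  apply: (@dir_deriv n u y1 _ _ (-1) r) => //; first by rewrite vnormN.
  move=> s sr; rewrite {1}y1E pt_scal pt_pt lin; lra.
apply: unit_dot1 => //; rewrite dotZr in E; lra.
Qed.

Lemma eikonal_opp {n} u (N : vec n -> vec n) x R : eikonal u N x R ->
  eikonal (fun y => (-1) * u y) (fun y => vscal (-1) (N y)) x R.
Proof. by move=> H y /H [Hg H1]; split; [exact: has_grad_scal|rewrite vnormN]. Qed.

Lemma vscalN1K {n} (v : vec n) : vscal (-1) (vscal (-1) v) = v.
Proof. by rewrite vscalA (_ : -1 * -1 = 1) ?vscal1 //; ring. Qed.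

Lemma eik_line {n} u (N : vec n -> vec n) x R : eikonal u N x R ->
  forall t, Rabs t < R -> u (pt x t (N x)) = u x + t /\ N (pt x t (N x)) = N x.
Proof.
move=> H t tR; case: (Rtotal_order t 0) => [t0|[->|t0]].
- have [|] := eik_line_pos (eikonal_opp H) (t := - t).
    by rewrite Rabs_left in tR; lra.
  rewrite pt_scal (_ : - t * -1 = t); last ring.
  by move=> ? /(f_equal (vscal (-1))); rewrite !vscalN1K; split=> //; lra.
- by rewrite pt0; split=> //; ring.
- by apply: (eik_line_pos H); rewrite Rabs_right in tR; lra.
Qed.

Lemma dist_quad {n} (v h : vec n) t : vnorm v = 1 -> 0 < t ->
  vnorm (vadd h (vscal t v)) <= t + dot h v + nrm2 h / (2 * t).
Proof.
move=> v1 t0.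
have E : nrm2 (vadd h (vscal t v)) = nrm2 h + 2 * t * dot h v + t * t.
  rewrite /nrm2 !dotE (dotC v h) -!/(nrm2 _) -(vnorm_sqr v) v1; ring.
have q : 2 * t * (nrm2 h / (2 * t)) = nrm2 h by field; lra.
have := nrm2_ge0 (vadd h (vscal t v)); rewrite E => E0.
set a := nrm2 h / (2 * t) in q *; set b := dot h v in E E0 *.
have p : 0 <= t + b + a.
  apply: (Rmult_le_reg_l (2 * t)); first lra.
  by rewrite Rmult_0_r !Rmult_plus_distr_l q; nra.
apply: sqr_le_le => //; rewrite vnorm_sqr E -q; have := Rle_0_sqr (a + b); rewrite /Rsqr => ?.
nra.
Qed.

(** The two distance cones with apexes at [pt z t v] and [pt z (- t) v] enclose [u] from below and
    above. Both touch it at [z] with gradient [v], so by [dist_quad] the deviation of [u] from its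
    linear part is quadratic. *)
Lemma quad_bound {n} (u : vec n -> R) z v h t : vnorm v = 1 -> 0 < t ->
  u (pt z t v) = u z + t -> u (pt z (- t) v) = u z - t ->
  u (vadd z h) - u (pt z (- t) v) <= vdist (vadd z h) (pt z (- t) v) ->
  u (pt z t v) - u (vadd z h) <= vdist (pt z t v) (vadd z h) ->
  Rabs (u (vadd z h) - u z - dot v h) <= nrm2 h / (2 * t).
Proof.
move=> v1 t0 Ep Em L1 L2.
have D1 : vdist (vadd z h) (pt z (- t) v) = vnorm (vadd h (vscal t v)).
  by congr vnorm; vec_ring.
have D2 : vdist (pt z t v) (vadd z h) = vnorm (vadd (vscal (-1) h) (vscal t v)).
  by congr vnorm; vec_ring.
have := dist_quad (vscal (-1) h) v1 t0; have := dist_quad h v1 t0.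
rewrite -D1 -D2 (_ : nrm2 (vscal (-1) h) = nrm2 h); last by rewrite /nrm2 !dotE; ring.
rewrite dotZl (dotC v h) => B1 B2.
by apply: Rabs_le; lra.
Qed.

(** A differentiability criterion for functions built from distances: a Lipschitz bound and unit
    growth along one line already produce the gradient. It is applied to the signed distance from a
    critical hypersurface. *)
Lemma has_grad_of_line {n} (u : vec n -> R) z v r : vnorm v = 1 -> 0 < r ->
  (forall a b, vdist a z < r -> vdist b z < r -> u a - u b <= vdist a b) ->
  (forall t, Rabs t < r -> u (pt z t v) = u z + t) -> has_grad u z v.
Proof.
move=> v1 r0 lip lin; apply/has_gradP => eps eps0.
exists (Rmin (r / 2) (eps * r)); split; first by apply: Rmin_glb_lt; nra.
move=> y yz.
have yr : vdist y z < r / 2 by exact: Rlt_minl yz.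
have ye : vdist y z < eps * r by exact: Rlt_minr yz.
have A : Rabs (r / 2) < r by rewrite Rabs_right; lra.
have A' : Rabs (- (r / 2)) < r by rewrite Rabs_Ropp.
have := @quad_bound n u z v (vsub y z) (r / 2) v1 ltac:(lra) (lin _ A).
rewrite (lin _ A') subK => /(_ ltac:(lra)) Q.
apply: Rle_trans (Q _ _) _.
- have := lip y (pt z (- (r / 2)) v) ltac:(lra); rewrite vdist_pt0 v1 (lin _ A'); apply; lra.
- have := lip (pt z (r / 2) v) y; rewrite vdist_pt0 v1 (lin _ A); apply; lra.
rewrite -vdist_sqr (_ : 2 * (r / 2) = r); last field.
have d0 := vdist_ge0 y z.
apply: (Rmult_le_reg_r r) => //.
rewrite /Rdiv Rmult_assoc Rinv_l; last lra.
nra.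
Qed.

(** The quadratic estimate holds at every point near [x] with one constant. Comparing the expansions
    of [u] at [x] and at [y] in a common point bounds the inner product of [N y - N x] with the
    increment, so [N] is even Lipschitz at [x]. *)
Lemma eik_grad_cont {n} u (N : vec n -> vec n) x R : 0 < R -> eikonal u N x R -> vcont_at N x.
Proof.
move=> R0 H.
have lip := eik_lip H.
have quad z h : vdist z x < R / 4 -> vnorm h < R / 4 ->
    Rabs (u (vadd z h) - u z - dot (N z) h) <= nrm2 h * (2 / R).
  move=> zr hr.
  have Hz : eikonal u N z (R / 2).
    by move=> y yz; apply: H; have := vdist_tri y z x; lra.
  have N1 : vnorm (N z) = 1 by apply: (proj2 (H z _)); lra.
  have A : Rabs (R / 4) < R / 2 by rewrite Rabs_right; lra.
  have A' : Rabs (- (R / 4)) < R / 2 by rewrite Rabs_Ropp.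
  have hz : vdist (vadd z h) z = vnorm h by rewrite /vdist addK.
  have t1 := vdist_tri (vadd z h) z x.
  have t2 := vdist_tri (pt z (R / 4) (N z)) z x.
  have t3 := vdist_tri (pt z (- (R / 4)) (N z)) z x.
  rewrite vdist_pt0 N1 Rabs_right in t2; last lra.
  rewrite vdist_pt0 N1 Rabs_Ropp Rabs_right in t3; last lra.
  rewrite (_ : nrm2 h * (2 / R) = nrm2 h / (2 * (R / 4))); last by field; lra.
  apply: quad_bound => //; first lra.
  - exact: (proj1 (eik_line Hz A)).
  - exact: (proj1 (eik_line Hz A')).
  - by apply: lip; lra.
  - by apply: lip; lra.
have key y : vdist y x < R / 8 -> vdist (N y) (N x) <= 12 / R * vdist y x.
  move=> yr.
  have d0 := vdist_ge0 y x.
  have [w0|w0] : vdist (N y) (N x) = 0 \/ 0 < vdist (N y) (N x) by have := vdist_ge0 (N y) (N x); lra.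
    by rewrite w0; apply: Rmult_le_pos => //; apply/Rlt_le/Rdiv_lt_0_compat; lra.
  pose k := vsub y x; pose w := vsub (N y) (N x).
  (* The increment is taken parallel to [N y - N x] and as long as [y - x]. The squared lengths 4,
     1, 1 of the three increments, times 2/R, give the constant 12/R. *)
  pose a := vnorm k / vnorm w; pose h := vscal a w.
  have w00 : 0 < vnorm w by [].
  have a0 : 0 <= a by rewrite /a; apply: Rdiv_le_0_compat => //; exact: vnorm_ge0.
  have hk : vnorm h = vnorm k.
    rewrite /h vnormZ Rabs_right; last lra.
    by rewrite /a /Rdiv Rmult_assoc Rinv_l; lra.
  have kd : vnorm k = vdist y x by [].
  have xx : vdist x x < R / 4 by rewrite vdist_xx; lra.
  have kh : vnorm (vadd k h) <= 2 * vnorm k by have := vnorm_tri k h; lra.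
  have Q1 := quad x (vadd k h) xx ltac:(lra).
  have Q2 := quad x k xx ltac:(lra).
  have Q3 := quad y h ltac:(lra) ltac:(lra).
  have yE : vadd x k = y by exact: subK.
  have yhE : vadd x (vadd k h) = vadd y h.
    by rewrite -yE; vec_ring.
  rewrite yhE in Q1; rewrite yE in Q2.
  move/Rabs_le_between: Q1 => Q1; move/Rabs_le_between: Q2 => Q2; move/Rabs_le_between: Q3 => Q3.
  rewrite dotDr in Q1.
  have E : dot (N y) h - dot (N x) h = vnorm k * vnorm w.
    rewrite -dotBl -/w /h dotZr -/(nrm2 w) -vnorm_sqr /a; field; lra.
  rewrite -!vnorm_sqr hk in Q1 Q2 Q3.
  have R2 : 0 < 2 / R by apply: Rdiv_lt_0_compat; lra.
  have kh2 : vnorm (vadd k h) * vnorm (vadd k h) <= 4 * (vnorm k * vnorm k).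
    by have := vnorm_ge0 (vadd k h); have := vnorm_ge0 k; nra.
  have : vnorm k * vnorm w <= 6 * (vnorm k * vnorm k) * (2 / R) by nra.
  have k0 : 0 <= vnorm k by exact: vnorm_ge0.
  have [k00|k00] : vnorm k = 0 \/ 0 < vnorm k by lra.
    have yx : y = x by apply: vdist_eq0.
    by move: w0; rewrite yx vdist_xx; lra.
  move=> I; rewrite -/w -kd -/(vnorm w).
  apply: (Rmult_le_reg_l (vnorm k)) => //; apply: Rle_trans I _; apply: Req_le; field; lra.
move=> eps eps0.
have c0 : 0 < 12 / R by apply: Rdiv_lt_0_compat; lra.
exists (Rmin (R / 8) (eps / (12 / R))); split.
  by apply: Rmin_glb_lt; [lra|apply: Rdiv_lt_0_compat].
move=> y yx.
apply: Rle_lt_trans (key y (Rlt_minl yx)) _.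
have := Rlt_minr yx => yx2.
by have := Rmult_lt_compat_l _ _ _ c0 yx2; rewrite (_ : 12 / R * (eps / (12 / R)) = eps); last by field; lra.
Qed.

(** * Continuously differentiable functions *)

Lemma vcont_of_comp {n m} (G : vec n -> vec m) x :
  (forall i, cont_at (fun y => G y i) x) -> vcont_at G x.
Proof.
move=> H eps eps0; have m0 := pos_INR m.
have e0 : 0 < eps / (INR m + 1) by apply: Rdiv_lt_0_compat; lra.
have /choice [d Hd] := fun i => H i _ e0.
have [d0 [d00 Hd0]] : exists d0, 0 < d0 /\ forall i, d0 <= d i.
  have : exists d0, 0 < d0 /\ forall i : 'I_m, i \in enum 'I_m -> d0 <= d i.
    elim: (enum _) => [|i s [d0 [d00 Hd0]]]; first by exists 1; split; [lra|].
    exists (Rmin d0 (d i)); split; first by apply: Rmin_glb_lt => //; exact: (proj1 (Hd i)).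
    move=> j; rewrite in_cons => /orP [/eqP ->|/Hd0 H0]; first exact: Rmin_r.
    exact: Rle_trans (Rmin_l _ _) H0.
  by move=> [d0 [d00 Hd0]]; exists d0; split=> // i; apply: Hd0; rewrite mem_enum.
exists d0; split=> // y yx.
apply: (@Rle_lt_trans _ (INR m * (eps / (INR m + 1)))).
  apply: vnorm_le_comp; first lra.
  by move=> i; apply: Rlt_le; apply: (proj2 (Hd i)); apply: Rlt_le_trans yx _.
have : (INR m + 1) * (eps / (INR m + 1)) = eps by field; lra.
nra.
Qed.

Lemma continuous_RnP {n} (f : vec n -> R) : continuous_Rn f -> forall x, cont_at f x.
Proof.
move=> H x eps eps0; have [d [d0 Hd]] := H x eps eps0; exists d; split=> // y yx.
by apply: Hd; apply/nrm2_lt.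
Qed.

Lemma Ck_cont {n} k (f : vec n -> R) : Ck k f -> forall x, cont_at f x.
Proof.
case: k => [|k] /=; first exact: continuous_RnP.
by move=> [G [HG _]] x; exact: has_grad_cont (HG x).
Qed.

(** The local Lipschitz bound is meant for the functions that define the critical surfaces; it
    controls the second-order deviation of a surface from its tangent space. *)
Lemma C2_grad {n} (f : vec n -> R) : Ck 2 f -> exists G : vec n -> vec n,
  (forall x, has_grad f x (G x)) /\ (forall x, vcont_at G x) /\
  forall p, exists d K, 0 < d /\ 0 < K /\ forall y z, vdist y p < d -> vdist z p < d ->
     vdist (G y) (G z) <= K * vdist y z.
Proof.
move=> [G [HG HC]]; exists G; split=> //; split.
  by move=> x; apply: vcont_of_comp => i; exact: (@Ck_cont n 1 _ (HC i)).
move=> p.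
have comp i : exists d K, 0 < d /\ 0 < K /\ forall y z, vdist y p < d -> vdist z p < d ->
     Rabs (G y i - G z i) <= K * vdist y z.
  have [H [HH Hc]] := HC i.
  have Hcp : vcont_at H p by apply: vcont_of_comp => j; exact: (@Ck_cont n 0 _ (Hc j)).
  have [d [d0 Hd]] := Hcp 1 Rlt_0_1.
  exists d, (vnorm (H p) + 1); split=> //; split; first by have := vnorm_ge0 (H p); lra.
  move=> y z yd zd.
  have [t _|t [t01 ->]] := @mvt n (fun x => G x i) H z y; first exact: HH.
  apply: Rle_trans (cauchy_schwarz _ _) _; apply: Rmult_le_compat_r; first exact: vnorm_ge0.
  have := Hd _ (seg_ball zd yd t01); have := vnorm_le_dist (H (pt z t (vsub y z))) (H p); lra.
have : exists d K, 0 < d /\ 0 < K /\ forall i : 'I_n, i \in enum 'I_n -> forall y z, vdist y p < d -> vdist z p < d ->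
     Rabs (G y i - G z i) <= K * vdist y z.
  elim: (enum _) => [|i s [d [K [d0 [K0 HK]]]]]; first by exists 1, 1; do 2![split; first lra].
  have [d' [K' [d'0 [K'0 HK']]]] := comp i.
  exists (Rmin d d'), (K + K'); split; first exact: Rmin_glb_lt.
  split; first lra.
  move=> j; rewrite in_cons => /orP jis y z yd zd.
  have y1 := Rlt_minl yd; have y2 := Rlt_minr yd.
  have z1 := Rlt_minl zd; have z2 := Rlt_minr zd.
  have := vdist_ge0 y z.
  by case: jis => [/eqP ->|/HK H]; [have := HK' y z y2 z2; nra|have := H y z y1 z1; nra].
move=> [d [K [d0 [K0 HK]]]].
have n0 := pos_INR n.
exists d, (INR n * K + 1); split=> //; split; first nra.
move=> y z yd zd; have dd := vdist_ge0 y z.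
apply: Rle_trans (@vnorm_le_comp _ _ (K * vdist y z) _ _) _; first nra.
  by move=> i; apply: HK => //; rewrite mem_enum.
nra.
Qed.

(** * Regular points of a metric function *)

Definition unitize {n} (v : vec n) : vec n := vscal (/ vnorm v) v.

Lemma unitize_norm {n} (v : vec n) : 0 < vnorm v -> vnorm (unitize v) = 1.
Proof.
move=> v0; rewrite /unitize vnormZ Rabs_right; first by field; lra.
by apply/Rle_ge/Rlt_le/Rinv_0_lt_compat.
Qed.

Lemma dot_unitize {n} (v : vec n) : 0 < vnorm v -> dot v (unitize v) = vnorm v.
Proof. by move=> v0; rewrite /unitize dotZr -/(nrm2 v) -vnorm_sqr; field; lra. Qed.

Lemma cont_line {n} (f : vec n -> R) (G : vec n -> vec n) x v :
  (forall x, has_grad f x (G x)) -> Ranalysis1.continuity (fun t => f (pt x t v)).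
Proof.
move=> HG t; apply/continuity_pt_filterlim; apply: ex_derive_continuous.
by eexists; apply: has_grad_line; exact: HG.
Qed.

Section Local.
Context {n : nat} (f : vec n -> R) (G : vec n -> vec n).
Hypothesis HG : forall x, has_grad f x (G x).
Hypothesis Gc : forall x, vcont_at G x.

Lemma mono_cone x0 : 0 < vnorm (G x0) -> exists r m, 0 < r /\ 0 < m /\
  (forall y, vdist y x0 < r -> 0 < vnorm (G y)) /\
  forall z s t, s <= t -> vdist (pt z s (unitize (G x0))) x0 < r ->
    vdist (pt z t (unitize (G x0))) x0 < r ->
    m * (t - s) <= f (pt z t (unitize (G x0))) - f (pt z s (unitize (G x0))).
Proof.
move=> g0; set e := unitize _.
have e1 : vnorm e = 1 by exact: unitize_norm.
have [|r [r0 Hr]] := @Gc x0 (vnorm (G x0) / 2); first lra.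
exists r, (vnorm (G x0) / 2); do 2![split; first lra].
split=> [y /Hr yr|z s t st zs zt].
  by have := vnorm_le_dist (G x0) (G y); rewrite vdistC; lra.
have [u _|u [u01 ->]] := @mvt n f G (pt z s e) (pt z t e); first exact: HG.
have := Hr _ (seg_ball zs zt u01).
set g := G _ => gd; rewrite pt_sub dotZr.
have : dot (G x0) e - dot g e <= vnorm (G x0) / 2.
  rewrite -dotBl; apply: Rle_trans (dot_le _ _) _; rewrite e1 -/(vdist (G x0) g) vdistC; lra.
rewrite dot_unitize //; nra.
Qed.

(** An implicit function argument over the segment from [y] to [y']: from each of its points one
    moves along the gradient direction of [x0] by the height [T s] at which [f] has the value [f y].
    Uniform monotonicity in this direction makes the height unique and continuous, and it vanishes
    at both ends, so a path in the level set results. *)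
Lemma local_leaf x0 : 0 < vnorm (G x0) -> exists r, 0 < r /\
  forall y y', vdist y x0 < r -> vdist y' x0 < r -> f y = f y' -> leaf f y y'.
Proof.
move=> g0; have [R [m [R0 [m0 [_ mono]]]]] := mono_cone g0; move: mono.
set e := unitize _ => mono.
have e1 : vnorm e = 1 by exact: unitize_norm.
pose r1 := R / 3; have r1E : 3 * r1 = R by rewrite /r1; field.
have [|r2 [r20 Hr2]] := has_grad_cont (HG x0) (eps := m * r1 / 2).
  by nra.
exists (Rmin r1 r2); split; first by apply: Rmin_glb_lt => //; rewrite /r1; lra.
move=> y y' yr y'r fE; rewrite /leaf.
have r10 : 0 < r1 by rewrite /r1; lra.
pose b s := pt y s (vsub y' y).
have bb s : 0 <= s <= 1 -> vdist (b s) x0 < Rmin r1 r2 by move=> s01; exact: seg_ball.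
have br s t : 0 <= s <= 1 -> - r1 <= t <= r1 -> vdist (pt (b s) t e) x0 < R.
  move=> /bb bs t1; apply: Rle_lt_trans (vdist_tri _ (b s) _) _.
  rewrite vdist_pt0 e1; have := Rmin_l r1 r2; have : Rabs t <= r1 by apply: Rabs_le.
  lra.
have fb s : 0 <= s <= 1 -> Rabs (f (b s) - f x0) < m * r1 / 2.
  by move=> /bb bs; apply: Hr2; exact: Rlt_minr bs.
(* On the segment [f] stays within [m * r1 / 2] of [f x0], while a shift by [r1] changes it by at
   least [m * r1]; hence the values at heights [- r1] and [r1] lie on both sides of [f y]. *)
have exT s : exists t, 0 <= s <= 1 -> - r1 <= t <= r1 /\ f (pt (b s) t e) = f y.
  have [s01|ns] := classic (0 <= s <= 1); last by exists 0.
  have fy : Rabs (f y - f x0) < m * r1 / 2.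
    by have := @fb 0; rewrite /b pt0; apply; lra.
  have := fb s s01; move/Rabs_def2: fy => fy /Rabs_def2 fs.
  have M1 := @mono (b s) 0 r1 ltac:(lra) (br s 0 s01 ltac:(lra)) (br s r1 s01 ltac:(lra)).
  have M2 := @mono (b s) (- r1) 0 ltac:(lra) (br s (- r1) s01 ltac:(lra)) (br s 0 s01 ltac:(lra)).
  rewrite pt0 in M1 M2.
  have [|t [tb tE]] := IVT_gen (fun t => f (pt (b s) t e)) (- r1) r1 (f y) (cont_line _ _ HG).
    by rewrite Rmin_left ?Rmax_right; nra.
  by rewrite Rmin_left ?Rmax_right in tb; try lra; exists t.
have /choice [T HT] := exT.
have Tdiff s t : 0 <= s <= 1 -> - r1 <= t <= r1 ->
    m * Rabs (T s - t) <= Rabs (f (pt (b s) t e) - f y).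
  move=> s01 t1; have [Tb TE] := HT s s01; rewrite -TE.
  have D1 := br s t s01 t1; have D2 := br s (T s) s01 Tb.
  case: (Rle_dec t (T s)) => H.
    have := mono _ _ _ H D1 D2; rewrite (Rabs_right (T s - t)); last lra.
    by rewrite Rabs_minus_sym; have := Rle_abs (f (pt (b s) (T s) e) - f (pt (b s) t e)); lra.
  have := mono (b s) (T s) t ltac:(lra) D2 D1; rewrite (Rabs_left (T s - t)); last lra.
  by have := Rle_abs (f (pt (b s) t e) - f (pt (b s) (T s) e)); lra.
have T0 : T 0 = 0.
  have := Tdiff 0 0 ltac:(lra) ltac:(lra); rewrite /b !pt0 Rminus_diag Rabs_R0.
  have := Rabs_pos (T 0 - 0) => p H; have : Rabs (T 0 - 0) = 0 by nra.
  by case: (Req_dec (T 0) 0) => // ne; have := Rabs_pos_lt (T 0 - 0); lra.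
have T1 : T 1 = 0.
  have := Tdiff 1 0 ltac:(lra) ltac:(lra); rewrite /b pt0 pt1_sub fE Rminus_diag Rabs_R0.
  have := Rabs_pos (T 1 - 0) => p H; have : Rabs (T 1 - 0) = 0 by nra.
  by case: (Req_dec (T 1) 0) => // ne; have := Rabs_pos_lt (T 1 - 0); lra.
have -> : conn_comp (level f y) y y' = conn_comp (level f y) (pt (b 0) (T 0) e) (pt (b 1) (T 1) e).
  by rewrite T0 T1 !pt0 /b pt0 pt1_sub.
apply: (@path_conn n _ (fun s => pt (b s) (T s) e)); last first.
  by move=> s s01; rewrite /level; exact: (proj2 (HT s s01)).
move=> s s01 eps eps0.
have [Tb TE] := HT s s01.
have [|d [d0 Hd]] := has_grad_cont (HG (pt (b s) (T s) e)) (eps := m * (eps / 2)); first nra.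
have [|d' [d'0 Hd']] := @pt_path_cont n y (vsub y' y) s s01 (Rmin d (eps / 2)).
  by apply: Rmin_glb_lt; lra.
exists d'; split=> // s' s'01 ss'.
have {Hd'}bd : vdist (b s') (b s) < Rmin d (eps / 2) by exact: Hd'.
have tr : vdist (pt (b s') (T s) e) (pt (b s) (T s) e) = vdist (b s') (b s).
  by congr vnorm; vec_ring.
have := Hd (pt (b s') (T s) e); rewrite tr TE => /(_ (Rlt_minl bd)) fd.
have := Tdiff s' (T s) s'01 Tb => TT.
apply: Rle_lt_trans (vdist_tri _ (pt (b s') (T s) e) _) _.
rewrite tr vdist_pt e1 Rmult_1_r.
have := Rlt_minr bd; have : Rabs (T s' - T s) < eps / 2 by nra.
lra.
Qed.

Hypothesis Hm : forall x y, leaf f x y -> vnorm (G x) = vnorm (G y).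

(* On a neighbourhood of a regular point |G| is a function h of f, and a primitive of 1/h turns f into a function with unit gradient. *)
Lemma local_eikonal x0 : 0 < vnorm (G x0) -> exists r u, 0 < r /\
  (forall y, vdist y x0 < r -> 0 < vnorm (G y)) /\
  eikonal u (fun y => unitize (G y)) x0 r /\
  forall y y', vdist y x0 < r -> vdist y' x0 < r -> 
    (u y = u y' -> f y = f y') /\ (f y = f y' -> u y = u y' /\ vnorm (G y) = vnorm (G y')).
Proof.
move=> g0; have [R [m [R0 [m0 [pos mono]]]]] := mono_cone g0; move: mono.
set e := unitize _ => mono.
have e1 : vnorm e = 1 by exact: unitize_norm.
have [R' [R'0 lf]] := local_leaf g0.
pose r1 := Rmin R R' / 2.
have mm : 0 < Rmin R R' by exact: Rmin_glb_lt.
have r10 : 0 < r1 by rewrite /r1; lra.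
have r1R : r1 < R by have := Rmin_l R R'; rewrite /r1; lra.
have r1R' : r1 < R' by have := Rmin_r R R'; rewrite /r1; lra.
pose c t := f (pt x0 t e).
have dpt t : - r1 <= t <= r1 -> vdist (pt x0 t e) x0 <= r1.
  by move=> tb; rewrite vdist_pt0 e1 Rmult_1_r; apply: Rabs_le.
have cm s t : - r1 <= s -> s <= t -> t <= r1 -> m * (t - s) <= c t - c s.
  by move=> s1 st t1; apply: mono => //; apply: Rle_lt_trans (dpt _ _) _; lra.
have exT s : exists t, c (- r1) < s < c r1 -> - r1 < t < r1 /\ c t = s.
  have [sJ|] := classic (c (- r1) < s < c r1); last by exists 0.
  have [|t [tb tE]] := IVT_gen c (- r1) r1 s (cont_line _ _ HG).
    by rewrite Rmin_left ?Rmax_right; lra.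
  rewrite Rmin_left ?Rmax_right in tb; try lra.
  exists t => _; split=> //; case: tb => t1 t2; split.
    by case: (Rle_lt_or_eq_dec _ _ t1) => // E; move: tE; rewrite -E; lra.
  by case: (Rle_lt_or_eq_dec _ _ t2) => // E; move: tE; rewrite E; lra.
have /choice [T HT] := exT.
(* [h] is read off on the transversal line through [x0], where each value [s] is attained at [T s];
   [local_leaf] and [Hm] then extend the relation to all nearby points. *)
pose h s := vnorm (G (pt x0 (T s) e)).
have hpos s : c (- r1) < s < c r1 -> 0 < h s.
  by move=> /HT [tb _]; apply: pos; apply: Rle_lt_trans (dpt _ _) _; lra.
have hf y : vdist y x0 < Rmin R R' -> c (- r1) < f y < c r1 -> h (f y) = vnorm (G y).
  move=> yr /HT [tb tE]; apply: Hm; apply: lf => //.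
    by apply: Rle_lt_trans (dpt _ _) _; lra.
  exact: Rlt_minr yr.
have hc s : c (- r1) < s < c r1 -> continuous (fun s => / h s) s.
  move=> sJ; apply: (@continuous_comp R_UniformSpace R_UniformSpace R_UniformSpace h Rinv); last first.
    apply: continuous_Rinv; apply: Rgt_not_eq; exact: hpos.
  have [tb tE] := HT s sJ.
  apply/filterlim_locally => -[eps eps0].
  have [d [d0 Hd]] := @Gc (pt x0 (T s) e) eps eps0.
  have k0 : 0 < Rmin (m * d) (Rmin (s - c (- r1)) (c r1 - s)).
    by apply: Rmin_glb_lt; [nra|apply: Rmin_glb_lt; lra].
  exists (mkposreal _ k0) => s' /= bs.
  have ss1 : Rabs (s' - s) < m * d by exact: Rlt_minl bs.
  have ss2 : Rabs (s' - s) < Rmin (s - c (- r1)) (c r1 - s) by exact: Rlt_minr bs.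
  have ss3 := Rlt_minl ss2.
  have ss4 := Rlt_minr ss2.
  have s'J : c (- r1) < s' < c r1 by move/Rabs_def2: ss3; move/Rabs_def2: ss4; lra.
  have [tb' tE'] := HT s' s'J.
  have TT : m * Rabs (T s' - T s) <= Rabs (s' - s).
    rewrite -{2}tE' -{2}tE; case: (Rle_dec (T s) (T s')) => H.
      by rewrite Rabs_right; last lra; apply: Rle_trans (Rle_abs _); apply: cm; lra.
    rewrite Rabs_left; last lra; rewrite Rabs_minus_sym; apply: Rle_trans (Rle_abs _).
    by rewrite Ropp_minus_distr; apply: cm; lra.
  have := Hd (pt x0 (T s') e); rewrite vdist_pt e1 => /(_ ltac:(nra)) Gd.
  have N1 := vnorm_le_dist (G (pt x0 (T s') e)) (G (pt x0 (T s) e)).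
  have N2 := vnorm_le_dist (G (pt x0 (T s) e)) (G (pt x0 (T s') e)).
  rewrite (vdistC (G (pt x0 (T s) e))) in N2.
  by rewrite /ball /= /AbsRing_ball /= /abs /minus /plus /opp /=; apply: Rabs_def1; rewrite /h; lra.
pose Phi s := RInt (fun s => / h s) (f x0) s.
have c0 : c 0 = f x0 by rewrite /c pt0.
have fx0 : c (- r1) < f x0 < c r1.
  rewrite -c0; have := @cm 0 r1 ltac:(lra) ltac:(lra) ltac:(lra).
  by have := @cm (- r1) 0 ltac:(lra) ltac:(lra) ltac:(lra); nra.
have dPhi s : c (- r1) < s < c r1 -> is_derive Phi s (/ h s).
  move=> sJ; apply: (@is_derive_RInt R_NormedModule (fun s => / h s) Phi (f x0) s _ (hc s sJ)).
  have k0 : 0 < Rmin (s - c (- r1)) (c r1 - s) by apply: Rmin_glb_lt; lra.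
  exists (mkposreal _ k0) => s' /= bs; apply: RInt_correct.
  apply: (@ex_RInt_continuous R_CompleteNormedModule) => z zb; apply: hc.
  have ss3 : Rabs (s' - s) < s - c (- r1) := Rlt_minl bs.
  have ss4 : Rabs (s' - s) < c r1 - s := Rlt_minr bs.
  have s'J : c (- r1) < s' < c r1 by move/Rabs_def2: ss3; move/Rabs_def2: ss4; lra.
  move: zb; rewrite /Rmin /Rmax; case: Rle_dec => _ ?; lra.
(* Strict monotonicity of [Phi] allows the return from equal values of [u] to equal values of
   [f]. *)
have Pinj s s' : c (- r1) < s < c r1 -> c (- r1) < s' < c r1 -> s < s' -> Phi s < Phi s'.
  move=> sJ s'J ss'.
  have [||z [zb Hz]] := @MVT_gen Phi s s' (fun s => / h s).
  - by rewrite Rmin_left ?Rmax_right; try lra; move=> z zb; apply: dPhi; lra.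
  - rewrite Rmin_left ?Rmax_right; try lra; move=> z zb.
    apply/continuity_pt_filterlim; apply: ex_derive_continuous; eexists; apply: dPhi; lra.
  rewrite Rmin_left ?Rmax_right in zb; try lra.
  have : 0 < / h z by apply: Rinv_0_lt_compat; apply: hpos; lra.
  nra.
have k0 : 0 < Rmin (f x0 - c (- r1)) (c r1 - f x0) by apply: Rmin_glb_lt; lra.
have [d [d0 Hd]] := has_grad_cont (HG x0) k0.
have fJ y : vdist y x0 < Rmin d (Rmin R R') -> c (- r1) < f y < c r1.
  move=> yr; have yd := Hd y (Rlt_minl yr).
  have := Rlt_minl yd; have := Rlt_minr yd.
  by move=> /Rabs_def2 + /Rabs_def2; lra.
have rr y : vdist y x0 < Rmin d (Rmin R R') -> vdist y x0 < Rmin R R'.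
  by move=> yr; exact: Rlt_minr yr.
have pos' y : vdist y x0 < Rmin d (Rmin R R') -> 0 < vnorm (G y).
  by move=> /rr yr; apply: pos; exact: Rlt_minl yr.
exists (Rmin d (Rmin R R')), (fun y => Phi (f y)).
split; first exact: Rmin_glb_lt.
split; first exact: pos'.
split=> [y yr|y y' yr y'r].
  split; last by apply: unitize_norm; exact: pos'.
  rewrite /unitize -(hf y (rr _ yr) (fJ _ yr)).
  by apply: has_grad_comp; [exact: HG|apply: dPhi; exact: fJ].
split=> [E|E]; last first.
  by rewrite E; split=> //; rewrite -(hf y (rr _ yr) (fJ _ yr)) -(hf y' (rr _ y'r) (fJ _ y'r)) E.
have J := fJ _ yr; have J' := fJ _ y'r.
case: (Rtotal_order (f y) (f y')) => [H|[//|H]].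
  by have := Pinj _ _ J J' H; lra.
by have := Pinj _ _ J' J H; lra.
Qed.

End Local.

Lemma eikonal_sub {n} u (N : vec n -> vec n) x r z r' :
  eikonal u N x r -> vdist z x + r' <= r -> eikonal u N z r'.
Proof. by move=> H zr y yr; apply: H; have := vdist_tri y z x; lra. Qed.

Lemma vdist_pt_pt {n} (a a' v v' : vec n) s s' :
  vdist (pt a s v) (pt a' s' v') <= vdist a a' + Rabs s * vdist v v' + Rabs (s - s') * vnorm v'.
Proof.
rewrite /vdist (_ : vsub _ _ = vadd (vadd (vsub a a') (vscal s (vsub v v'))) (vscal (s - s') v')); last first.
  by vec_ring.
by apply: Rle_trans (vnorm_tri _ _) _; rewrite -!vnormZ; have := vnorm_tri (vsub a a') (vscal s (vsub v v')); lra.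
Qed.

Lemma vnorm_dist_le {n} (x y : vec n) : Rabs (vnorm x - vnorm y) <= vdist x y.
Proof.
have := vnorm_le_dist x y; have := vnorm_le_dist y x; rewrite (vdistC y x) => *.
by apply: Rabs_le; lra.
Qed.

(** * Transport of the gradient norm between neighbouring normal lines *)

Section Transport.
Context {n : nat} (f : vec n -> R) (G : vec n -> vec n).
Hypothesis HG : forall x, has_grad f x (G x).
Hypothesis Gc : forall x, vcont_at G x.
Hypothesis Hm : forall x y, leaf f x y -> vnorm (G x) = vnorm (G y).
Let N y := unitize (G y).
Let reg y := 0 < vnorm (G y).

Lemma N_unit x : reg x -> vnorm (N x) = 1. Proof. exact: unitize_norm. Qed.

Lemma local_eik x0 : reg x0 -> exists r u, 0 < r /\
  (forall y, vdist y x0 < r -> reg y) /\ eikonal u N x0 r /\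
  forall y y', vdist y x0 < r -> vdist y' x0 < r ->
    (u y = u y' -> f y = f y') /\ (f y = f y' -> u y = u y' /\ vnorm (G y) = vnorm (G y')).
Proof. exact: local_eikonal HG Gc Hm x0. Qed.

Lemma N_cont x : reg x -> vcont_at N x.
Proof.
by move=> /local_eik [r [u [r0 [_ [ek _]]]]]; exact: eik_grad_cont ek.
Qed.

Lemma line_const x sg B : (sg = 1 \/ sg = -1) -> 0 <= B ->
  (forall t, 0 <= t <= B -> reg (pt x (sg * t) (N x))) -> N (pt x (sg * B) (N x)) = N x.
Proof.
move=> sg1 B0 H.
have sgA t := abs_sign t sg1.
have rx : reg x by have := H 0; rewrite Rmult_0_r pt0; apply; lra.
apply: (@real_ind (fun b => N (pt x (sg * b) (N x)) = N x)) => //; first by rewrite Rmult_0_r pt0.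
move=> b bB; have [r [u [r0 [_ [ek _]]]]] := local_eik (H b bB).
exists (r / 4); split; first lra.
move=> b0 b00 b0b Nb0 b1 b1b b1B.
have dz : vdist (pt x (sg * b0) (N x)) (pt x (sg * b) (N x)) <= r / 4.
  rewrite vdist_pt N_unit // -Rmult_minus_distr_l sgA Rmult_1_r; apply: Rabs_le; lra.
have ek' := @eikonal_sub _ _ _ _ _ (pt x (sg * b0) (N x)) (3 * r / 4) ek ltac:(lra).
have [|_] := eik_line ek' (t := sg * (b1 - b0)); first by rewrite sgA; apply: Rabs_def1; lra.
rewrite Nb0 pt_pt (_ : sg * b0 + sg * (b1 - b0) = sg * b1); last ring.
by [].
Qed.

(** Along both normal lines every local potential changes at unit speed. Once the potentials agree
    at one pair of points they agree further on, and with them [f] and the gradient norm. The offset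
    [eta] synchronizes the two lines; [sg] selects the sense in which they are run through. *)
Lemma transport z sg B : (sg = 1 \/ sg = -1) -> 0 <= B ->
  (forall s, 0 <= s <= B -> reg (pt z (sg * s) (N z))) ->
  exists d, 0 < d /\ forall z' eta, vdist z' z < d -> Rabs eta <= vdist z' z ->
    f z' = f (pt z eta (N z)) ->
    forall s, 0 <= s <= B ->
      f (pt z' (sg * s - eta) (N z')) = f (pt z (sg * s) (N z)) /\
      vnorm (G (pt z' (sg * s - eta) (N z'))) = vnorm (G (pt z (sg * s) (N z))) /\
      N (pt z' (sg * s - eta) (N z')) = N z'.
Proof.
move=> sg1 B0 H.
have sgA t := abs_sign t sg1.
have rz : reg z by have := H 0; rewrite Rmult_0_r pt0; apply; lra.
have Nw s : 0 <= s <= B -> N (pt z (sg * s) (N z)) = N z.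
  move=> sB; apply: line_const => //; first lra.
  by move=> t tB; apply: H; lra.
pose Q b := exists d, 0 < d /\ forall z' eta, vdist z' z < d -> Rabs eta <= vdist z' z ->
    f z' = f (pt z eta (N z)) ->
    forall s, 0 <= s <= b ->
      f (pt z' (sg * s - eta) (N z')) = f (pt z (sg * s) (N z)) /\
      vnorm (G (pt z' (sg * s - eta) (N z'))) = vnorm (G (pt z (sg * s) (N z))) /\
      N (pt z' (sg * s - eta) (N z')) = N z'.
apply: (@real_ind Q B) => //.
  have [r [u [r0 [_ [ek uf]]]]] := local_eik rz.
  exists (r / 4); split; first lra.
  move=> z' eta z'r er fE s s0; have -> : s = 0 by lra.
  rewrite Rmult_0_r pt0 Rminus_0_l.
  have ek' := @eikonal_sub _ _ _ _ _ z' (r / 2) ek ltac:(lra).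
  have [|u1 N1] := eik_line ek' (t := - eta); first by rewrite Rabs_Ropp; lra.
  have [|u2 N2] := eik_line ek (t := eta); first by lra.
    have z'1 : vnorm (N z') = 1 by apply: (proj2 (ek z' _)); lra.
  have D1 : vdist (pt z' (- eta) (N z')) z < r.
    by apply: Rle_lt_trans (vdist_tri _ z' _) _; rewrite vdist_pt0 z'1 Rabs_Ropp; lra.
  have D2 : vdist (pt z eta (N z)) z < r by rewrite vdist_pt0 N_unit //; lra.
  have [_ /(_ fE) [uE _]] := uf z' (pt z eta (N z)) ltac:(lra) D2.
  have [/(_ ltac:(lra)) fE' /(_ _) U] := uf (pt z' (- eta) (N z')) z D1 ltac:(rewrite vdist_xx; lra).
  by split=> //; split=> //; have [] := U fE'.
move=> b bB; have [r [u [r0 [_ [ek uf]]]]] := local_eik (H b bB).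
exists (r / 8); split; first lra.
move=> b0 b00 b0b [d [d0 Hd]] b1 b1b b1B.
(* The two lines have to stay within r/8 of each other: r/32 for the starting points, r/16 for the
   angle [kap] over a length of at most B+1, and r/32 for [eta]. *)
pose kap := r / (16 * (B + 1)).
have kap0 : 0 < kap by apply: Rdiv_lt_0_compat; lra.
have kapE : kap * (B + 1) = r / 16 by rewrite /kap; field; lra.
have [dN [dN0 HdN]] := N_cont rz kap0.
have [d' [d'0 [dd [dN' [d1 dr]]]]] : exists d', 0 < d' /\ d' <= d /\ d' <= dN /\ d' <= 1 /\ d' <= r / 32.
  exists (Rmin d (Rmin dN (Rmin 1 (r / 32)))).
  split; first by repeat apply: Rmin_glb_lt => //; lra.
  have A1 := Rmin_l d (Rmin dN (Rmin 1 (r / 32))); have A2 := Rmin_r d (Rmin dN (Rmin 1 (r / 32))).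
  have A3 := Rmin_l dN (Rmin 1 (r / 32)); have A4 := Rmin_r dN (Rmin 1 (r / 32)).
  have A5 := Rmin_l 1 (r / 32); have A6 := Rmin_r 1 (r / 32).
  lra.
exists d'; split=> // z' eta z'd er fE s sb1.
case: (Rle_dec s b0) => [sb0|sb0]; first by apply: Hd => //; lra.
have [fb0 [gb0 Nb0]] := Hd z' eta ltac:(lra) er fE b0 ltac:(lra).
pose w' t := pt z' (sg * t - eta) (N z'); pose w t := pt z (sg * t) (N z).
rewrite -!/(w b) in ek uf; rewrite -!/(w' _) -!/(w _) in fb0 gb0 Nb0 *.
have close t : 0 <= t <= B -> vdist (w' t) (w t) <= r / 8.
  move=> tB; apply: Rle_trans (vdist_pt_pt _ _ _ _ _ _) _.
  rewrite N_unit // (_ : sg * t - eta - sg * t = - eta); last ring.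
  rewrite Rabs_Ropp.
  have : Rabs (sg * t - eta) <= B + 1.
    apply: Rle_trans (Rabs_triang _ _) _; rewrite sgA Rabs_Ropp Rabs_right; lra.
  have := HdN z' ltac:(lra); have := vdist_ge0 (N z') (N z); have := Rabs_pos (sg * t - eta).
  nra.
have ww t : vdist (w t) (w b) = Rabs (t - b).
  by rewrite vdist_pt N_unit // -Rmult_minus_distr_l sgA Rmult_1_r.
have wb0 : vdist (w b0) (w b) <= r / 8 by rewrite ww; apply: Rabs_le; lra.
have ws : vdist (w s) (w b) <= r / 8 by rewrite ww; apply: Rabs_le; lra.
have w'b0 := vdist_tri (w' b0) (w b0) (w b).
have w's := vdist_tri (w' s) (w s) (w b).
have cb0 := close b0 ltac:(lra); have cs := close s ltac:(lra).
have [|u1 N1] := eik_line (@eikonal_sub _ _ _ _ _ (w' b0) (r / 2) ek ltac:(lra)) (t := sg * (s - b0)).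
  by rewrite sgA; apply: Rabs_def1; lra.
have [|u2 N2] := eik_line (@eikonal_sub _ _ _ _ _ (w b0) (r / 2) ek ltac:(lra)) (t := sg * (s - b0)).
  by rewrite sgA; apply: Rabs_def1; lra.
have E1 : pt (w' b0) (sg * (s - b0)) (N (w' b0)) = w' s.
  by rewrite Nb0 /w' pt_pt; congr pt; ring.
have E2 : pt (w b0) (sg * (s - b0)) (N (w b0)) = w s.
  by rewrite /w (Nw b0) ?pt_pt; [congr pt; ring|lra].
rewrite E1 in u1 N1; rewrite E2 in u2 N2.
have [_ /(_ fb0) [ub0 _]] := uf (w' b0) (w b0) ltac:(lra) ltac:(lra).
have [A1 A2] := uf (w' s) (w s) ltac:(lra) ltac:(lra).
have fs := A1 ltac:(lra).
split=> //; split; first by have [] := A2 fs.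
by rewrite -/(w' s) N1 Nb0.
Qed.

Section Base.
Variables (x : vec n) (d : R).
Hypothesis xreg : forall t, Rabs t <= d -> reg (pt x t (N x)).

(* z lies, up to leaves, at time tau of the normal line through x. *)
Definition shifted (z : vec n) (tau : R) : Prop :=
  reg z /\ forall t, Rabs t <= d -> vnorm (G (pt z (t - tau) (N z))) = vnorm (G (pt x t (N x))).

(** The time shift changes by [u z' - u z] for a local potential [u], which is at most the distance
    moved. Covering all times in [-d, d] takes a transport of length d - tau forwards and d + tau
    backwards. *)
Lemma shifted_step z tau : Rabs tau <= d -> shifted z tau -> exists e, 0 < e /\
  forall z', vdist z' z < e -> exists tau', Rabs (tau' - tau) <= vdist z' z /\ shifted z' tau'.
Proof.
move=> /Rabs_le_between td [rz Hz].
have regz t : Rabs t <= d -> reg (pt z (t - tau) (N z)).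
  by move=> t1; rewrite /reg Hz //; exact: xreg.
have [||e1 [e10 He1]] := @transport z 1 (d - tau) (or_introl erefl); first lra.
  by move=> s sb; rewrite (_ : 1 * s = (s + tau) - tau); [apply: regz; apply: Rabs_le; lra|ring].
have [||e2 [e20 He2]] := @transport z (-1) (d + tau) (or_intror erefl); first lra.
  by move=> s sb; rewrite (_ : -1 * s = (tau - s) - tau); [apply: regz; apply: Rabs_le; lra|ring].
have [r [u [r0 [regr [ek uf]]]]] := local_eik rz.
exists (Rmin r (Rmin e1 e2)); split; first by repeat apply: Rmin_glb_lt.
move=> z' z'z.
have z'r := Rlt_le_trans _ _ _ z'z (Rmin_l _ _).
have z'e := Rlt_le_trans _ _ _ z'z (Rmin_r _ _).
have z'e1 := Rlt_le_trans _ _ _ z'e (Rmin_l _ _).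
have z'e2 := Rlt_le_trans _ _ _ z'e (Rmin_r _ _).
have zz : vdist z z < r by rewrite vdist_xx.
pose eta := u z' - u z.
have er : Rabs eta <= vdist z' z.
  have L1 := eik_lip ek z'r zz; have L2 := eik_lip ek zz z'r.
  by rewrite (vdistC z) in L2; apply: Rabs_le; rewrite /eta; lra.
have [|u1 _] := eik_line ek (t := eta); first lra.
have D : vdist (pt z eta (N z)) z < r by rewrite vdist_pt0 N_unit //; lra.
have [fE _] := uf z' _ z'r D.
have {}fE := fE ltac:(rewrite u1 /eta; lra).
exists (tau + eta); split; first by rewrite (_ : tau + eta - tau = eta) //; ring.
split; first exact: regr.
move=> t /[dup] td' /Rabs_le_between tb; rewrite -Hz //.
case: (Rle_dec tau t) => H.
  have [_ [E _]] := He1 z' eta z'e1 er fE (t - tau) ltac:(lra).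
  by rewrite !Rmult_1_l in E; rewrite -E; congr (vnorm (G _)); congr pt; ring.
have [_ [E _]] := He2 z' eta z'e2 er fE (tau - t) ltac:(lra).
rewrite (_ : t - tau = -1 * (tau - t)); last ring.
by rewrite -E; congr (vnorm (G _)); congr pt; ring.
Qed.

Lemma vlim_gnorm (y : nat -> vec n) l (c : nat -> R) (c0 : R) : vlim y l ->
  (forall m, vnorm (G (y m)) = c m) ->
  (forall eps, 0 < eps -> exists M, forall m, (M <= m)%N -> Rabs (c m - c0) < eps) ->
  vnorm (G l) = c0.
Proof.
move=> yl yc cc; apply: NNPP => ne.
have e0 : 0 < Rabs (vnorm (G l) - c0) / 2 by have := Rabs_pos_lt (vnorm (G l) - c0); lra.
have [e [e1 He]] := Gc l e0.
have [M1 HM1] := yl e e1; have [M2 HM2] := cc _ e0.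
have := He _ (HM1 _ (leq_maxl M1 M2)); have := HM2 _ (leq_maxr M1 M2); rewrite -yc => A B.
have := vnorm_dist_le (G (y (maxn M1 M2))) (G l) => C.
have := Rabs_triang (vnorm (G l) - vnorm (G (y (maxn M1 M2)))) (vnorm (G (y (maxn M1 M2))) - c0).
rewrite (_ : _ - _ + _ = vnorm (G l) - c0); last ring.
rewrite (Rabs_minus_sym (vnorm (G l)) (vnorm (G _))); lra.
Qed.

Lemma shifted_lim (z : nat -> vec n) (tau : nat -> R) l t0 : reg l -> vlim z l ->
  (forall eps, 0 < eps -> exists M, forall m, (M <= m)%N -> Rabs (tau m - t0) < eps) ->
  (forall m, shifted (z m) (tau m)) -> shifted l t0.
Proof.
move=> rl zl taul Hs; split=> // t td.
apply: (@vlim_gnorm (fun m => pt (z m) (t - tau m) (N (z m))) _ (fun _ => vnorm (G (pt x t (N x)))));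
  last 2 first.
- by move=> m; exact: (proj2 (Hs m)).
- by move=> eps eps0; exists O => m _; rewrite Rminus_diag Rabs_R0.
move=> eps eps0.
pose K := Rabs (t - t0) + 1.
have K0 : 0 < K by rewrite /K; have := Rabs_pos (t - t0); lra.
have [e [e0 He]] := N_cont rl (eps := eps / (3 * K)) ltac:(apply: Rdiv_lt_0_compat; lra).
have [M1 HM1] := zl (Rmin e (eps / 3)) ltac:(by apply: Rmin_glb_lt; lra).
have [M2 HM2] := taul (Rmin 1 (eps / 3)) ltac:(by apply: Rmin_glb_lt; lra).
exists (maxn M1 M2) => m; rewrite geq_max => /andP [/HM1 m1 /HM2 m2].
have m1e := Rlt_minl m1; have m1f := Rlt_minr m1.
have m2e := Rlt_minl m2; have m2f := Rlt_minr m2.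
apply: Rle_lt_trans (vdist_pt_pt _ _ _ _ _ _) _.
rewrite N_unit // (_ : t - tau m - (t - t0) = - (tau m - t0)); last ring.
rewrite Rabs_Ropp.
have tK : Rabs (t - tau m) <= K.
  rewrite (_ : t - tau m = (t - t0) + - (tau m - t0)); last ring.
  by apply: Rle_trans (Rabs_triang _ _) _; rewrite Rabs_Ropp /K; lra.
have Nm := He _ m1e.
have : Rabs (t - tau m) * vdist (N (z m)) (N l) <= K * (eps / (3 * K)).
  by apply: Rmult_le_compat => //; [exact: Rabs_pos|exact: vdist_ge0|lra].
rewrite (_ : K * _ = eps / 3); last by field; lra.
lra.
Qed.

(** The relation [shifted] is carried along the segment from [x] to [p]. At time [t = tau] it
    equates the gradient norm at the moving point with the one at [pt x tau (N x)], where |tau| <=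
    d. As the moving point tends to [p] the norm tends to 0, so it vanishes at a limit of the
    shifts, contrary to [xreg]. *)
Lemma hit_aux p : G p = vzero -> d = vdist p x ->
  (forall s, 0 <= s < 1 -> reg (pt x s (vsub p x))) -> False.
Proof.
move=> Gp dE Hs.
have d0 : 0 <= d by rewrite dE; exact: vdist_ge0.
have rx : reg x by have := Hs 0; rewrite pt0; apply; lra.
pose z s := pt x s (vsub p x).
have zd s s' : vdist (z s) (z s') = Rabs (s - s') * d by rewrite vdist_pt dE.
have dpos : 0 < d.
  case: (Rle_lt_or_eq_dec _ _ d0) => // E; move: dE; rewrite -E => /esym /vdist_eq0 E'.
  by move: rx; rewrite /reg -E' Gp vnorm0; lra.
have all S : 0 <= S < 1 -> exists tau, Rabs tau <= d * S /\ shifted (z S) tau.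
  move=> S01.
  apply: (@real_ind (fun S => exists tau, Rabs tau <= d * S /\ shifted (z S) tau)); first lra.
    exists 0; rewrite Rabs_R0; split; first lra.
    by rewrite /z pt0; split=> // t td; rewrite Rminus_0_r.
  move=> b bS.
  have [[tau [taub Hb]]|nb] := classic (exists tau, Rabs tau <= d * b /\ shifted (z b) tau).
    have [|e [e0 He]] := shifted_step _ Hb; first by nra.
    exists (e / d); split; first exact: Rdiv_lt_0_compat.
    move=> _ _ _ _ b1 b1b b1S.
    have zz : vdist (z b1) (z b) = (b1 - b) * d by rewrite zd Rabs_right; lra.
    have [|tau' [tt Hb1]] := He (z b1).
      rewrite zz; have : (b1 - b) * d < e / d * d by apply: Rmult_lt_compat_r; lra.
      by rewrite /Rdiv Rmult_assoc Rinv_l; lra.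
    exists tau'; split=> //; have := Rabs_triang (tau' - tau) tau.
    rewrite (_ : tau' - tau + tau = tau'); last ring.
    nra.
  (* If no point just below [b] has the property, the induction step is vacuous. Otherwise points
     with the property converge to [b], and a convergent subsequence of their shifts settles [b]
     itself. *)
  have [//|ne] := classic (exists eps, 0 < eps /\ forall b0, 0 <= b0 -> b - eps < b0 <= b ->
      ~ exists tau, Rabs tau <= d * b0 /\ shifted (z b0) tau).
    move=> [eps [eps0 He]]; exists eps; split=> // b0 b00 b0b Hb0.
    by case: (He b0 b00 b0b).
  exfalso; apply: nb.
  have /choice [bt Hbt] : forall m : nat, exists bt : R * R, 0 <= bt.1 /\ b - / INR m.+1 < bt.1 <= b /\
      Rabs bt.2 <= d * bt.1 /\ shifted (z bt.1) bt.2.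
    move=> m; apply: NNPP => N'; apply: ne; exists (/ INR m.+1); split.
      by apply: Rinv_0_lt_compat; apply: lt_0_INR; lia.
    by move=> b0 b00 b0b [tau Ht]; apply: N'; exists (b0, tau).
  have [|phi [t0 [phim Ht0]]] := @real_subseq (fun m => (bt m).2) d.
    by move=> m; have [A [B [C _]]] := Hbt m; nra.
  have Hs0 : shifted (z b) t0.
    apply: (@shifted_lim (fun m => z (bt (phi m)).1) (fun m => (bt (phi m)).2)) => //.
    - by apply: Hs; lra.
    - move=> eps eps0; have [M [HM M0]] := archimed_cor1 (eps / d) ltac:(exact: Rdiv_lt_0_compat).
      exists M => m Mm; rewrite zd; have [A [B _]] := Hbt (phi m).
      have : / INR (phi m).+1 <= / INR M.
        apply: Rinv_le_contravar; first by apply: lt_0_INR.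
        by apply: le_INR; apply/leP; apply: leq_trans Mm _; apply: leq_trans (phim _) _; exact: leqnSn.
      rewrite Rabs_left1; last lra.
      have : eps / d * d = eps by field; lra.
      nra.
    - by move=> m; have [_ [_ [_ ?]]] := Hbt (phi m).
  exists t0; split=> //.
  apply: le_epsilon => eps eps0; have [M HM] := Ht0 eps eps0.
  have := HM M (leqnn M); have [A [B [C _]]] := Hbt (phi M).
  have := Rabs_triang (t0 - (bt (phi M)).2) ((bt (phi M)).2).
  rewrite (_ : t0 - _ + _ = t0); last ring.
  rewrite (Rabs_minus_sym t0 (bt _).2); nra.
have /choice [tau Htau] : forall m : nat, exists tau, Rabs tau <= d /\ shifted (z (1 - / INR m.+1)) tau.
  move=> m.
  have m0 : 0 < / INR m.+1 by apply: Rinv_0_lt_compat; apply: lt_0_INR; lia.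
  have m1 : / INR m.+1 <= 1.
    by rewrite -[X in _ <= X]Rinv_1; apply: Rinv_le_contravar; [lra|rewrite S_INR; have := pos_INR m; lra].
  have [|tau [t1 t2]] := all (1 - / INR m.+1); first lra.
  by exists tau; split=> //; nra.
have [|phi [t0 [phim Ht0]]] := @real_subseq tau d; first by move=> m; exact: (proj1 (Htau m)).
have t0d : Rabs t0 <= d.
  apply: le_epsilon => eps eps0; have [M HM] := Ht0 eps eps0.
  have := HM M (leqnn M); have [A _] := Htau (phi M).
  have := Rabs_triang (t0 - tau (phi M)) (tau (phi M)).
  rewrite (_ : t0 - _ + _ = t0); last ring.
  rewrite (Rabs_minus_sym t0 (tau _)); lra.
have : vnorm (G (pt x t0 (N x))) = 0; last by have := xreg t0d; rewrite /reg; lra.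
apply: (@vlim_gnorm (fun m => pt x (tau (phi m)) (N x)) _ (fun m => vnorm (G (z (1 - / INR (phi m).+1))))).
- move=> eps eps0; have [M HM] := Ht0 eps eps0; exists M => m /HM H.
  by rewrite vdist_pt N_unit //; lra.
- move=> m; have [A [_ B]] := Htau (phi m).
  by rewrite -B // Rminus_diag pt0.
- move=> eps eps0; have [e [e0 He]] := @Gc p eps eps0.
  have [M [HM M0]] := archimed_cor1 (e / d) ltac:(exact: Rdiv_lt_0_compat).
  exists M => m Mm.
  have := He (z (1 - / INR (phi m).+1)); rewrite Gp /vdist.
  have pE : p = z 1 by rewrite /z pt1_sub.
  have : / INR (phi m).+1 <= / INR M.
    apply: Rinv_le_contravar; first by apply: lt_0_INR.
    by apply: le_INR; apply/leP; apply: leq_trans Mm _; apply: leq_trans (phim _) _; exact: leqnSn.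
  have : 0 < / INR (phi m).+1 by apply: Rinv_0_lt_compat; apply: lt_0_INR; lia.
  move=> i0 i1; rewrite -!/(vdist _ _) {1}pE zd Rabs_left1; last lra.
  have E : e / d * d = e by field; lra.
  move=> /(_ ltac:(nra)) B.
  have := vnorm_dist_le (G (z (1 - / INR (phi m).+1))) vzero; rewrite vnorm0; lra.
Qed.

End Base.

Lemma hit x p : G p = vzero -> (forall s, 0 <= s < 1 -> reg (pt x s (vsub p x))) ->
  exists t, Rabs t <= vdist p x /\ G (pt x t (N x)) = vzero.
Proof.
move=> Gp Hs; apply: NNPP => N'.
apply: (@hit_aux x (vdist p x) _ p Gp erefl Hs) => t td.
rewrite /reg; case: (Rle_lt_or_eq_dec _ _ (vnorm_ge0 (G (pt x t (N x))))) => // E.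
by case: N'; exists t; split=> //; exact/vnorm_eq0.
Qed.

(* Otherwise |G|, being constant on leaves, would stay bounded away from 0 along the segment from x to p. *)
Lemma normal_nearest x p : reg x -> G p = vzero ->
  (forall q, G q = vzero -> vdist x p <= vdist x q) ->
  p = pt x (vdist x p) (N x) \/ p = pt x (- vdist x p) (N x).
Proof.
move=> rx Gp Hp; set D := vdist x p in Hp *.
have D0 : 0 < D.
  case: (Rle_lt_or_eq_dec _ _ (vdist_ge0 x p)) => // /esym /vdist_eq0 E.
  by move: rx; rewrite /reg E Gp vnorm0; lra.
have DE : vnorm (vsub p x) = D by rewrite /D vdistC.
have regB y : vdist x y < D -> reg y.
  move=> yD; rewrite /reg; case: (Rle_lt_or_eq_dec _ _ (vnorm_ge0 (G y))) => // E.
  by have := Hp y (vnorm_eq0 (esym E)); lra.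
have [e [e1 eE]] : exists e, vnorm e = 1 /\ vsub p x = vscal D e.
  exists (unitize (vsub p x)); split; first by apply: unitize_norm; lra.
  by rewrite /unitize DE vscalA Rinv_r ?vscal1 //; lra.
(* At [x] itself [hit] would give a critical point at the minimal distance, but perhaps not [p].
   From a point [xs] strictly inside the segment it gives one within (1-s)D of [xs] and at least D
   away from [x]; equality in the triangle inequality then puts the normal at [xs] on the segment.
   Continuity of [N] finally lets s tend to 0. *)
have key s : 0 < s < 1 -> 1 <= Rabs (dot (N (pt x s (vsub p x))) e).
  move=> s01; set xs := pt x s _.
  have rs : reg xs by apply: regB; rewrite vdistC vdist_pt0 DE Rabs_right; nra.
  have pxs : vdist p xs = (1 - s) * D.
    by rewrite -{1}(pt1_sub x p) vdist_pt DE Rabs_right; lra.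
  have [|t [td Gt]] := @hit xs p Gp.
    move=> s' s'01; apply: regB.
    have -> : pt xs s' (vsub p xs) = pt x (s + s' * (1 - s)) (vsub p x).
      by apply: functional_extensionality => i; rewrite /xs /pt /vadd /vsub /vscal; ring.
    rewrite vdistC vdist_pt0 DE Rabs_right; last nra.
    have : 0 < (1 - s) * (1 - s') * D by repeat apply: Rmult_lt_0_compat; lra.
    nra.
  have := Hp _ Gt; have := N_unit rs; move: (N xs) td => v td v1 H {Gt}.
  have : D * D <= vdist x (pt xs t v) * vdist x (pt xs t v) by nra.
  rewrite (vdistC x) vdist_sqr (_ : vsub _ x = vadd (vscal (s * D) e) (vscal t v)); last first.
    rewrite -vscalA -eE; apply: functional_extensionality => i.
    by rewrite /xs /pt /vadd /vsub /vscal; ring.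
  rewrite /nrm2 !dotE -!/(nrm2 e) -!/(nrm2 v) -!vnorm_sqr e1 v1 (dotC e).
  set c := dot _ e => H2.
  have tt : t * t <= ((1 - s) * D) * ((1 - s) * D).
    rewrite pxs in td; have := Rabs_pos t; rewrite -(Rabs_right (t * t)); last exact: sqr_ge0.
    by rewrite Rabs_mult; nra.
  have tc : (1 - s) * D <= t * c.
    apply: (Rmult_le_reg_l (2 * s * D)); first nra.
    nra.
  have := Rle_abs (t * c); rewrite Rabs_mult => tc'.
  apply: (Rmult_le_reg_l ((1 - s) * D)); first nra.
  rewrite pxs in td; have := Rabs_pos c; nra.
have lim : 1 <= Rabs (dot (N x) e).
  apply: le_epsilon => eps eps0; have [dl [dl0 Hdl]] := N_cont rx eps0.
  pose s := Rmin (1 / 2) (dl / (2 * D)).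
  have s0 : 0 < s by apply: Rmin_glb_lt; [lra|apply: Rdiv_lt_0_compat; lra].
  have s1 : s <= 1 / 2 by exact: Rmin_l.
  have s2 : s * D <= dl / 2.
    apply: (@Rle_trans _ (dl / (2 * D) * D)); first by apply: Rmult_le_compat_r; [lra|exact: Rmin_r].
    by apply: Req_le; field; lra.
  have := key s ltac:(lra); have := Hdl (pt x s (vsub p x)).
  rewrite vdist_pt0 DE Rabs_right; last lra.
  move=> /(_ ltac:(lra)); set v := N (pt _ _ _) => vx.
  have := cauchy_schwarz (vsub v (N x)) e; rewrite e1 dotBl -/(vdist v (N x)) => cs.
  have := Rabs_triang (dot (N x) e) (dot v e - dot (N x) e).
  rewrite (_ : _ + (_ - _) = dot v e); last ring.
  lra.
have N1 := N_unit rx.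
have [c1|c1] : 1 <= dot (N x) e \/ 1 <= dot (N x) (vscal (-1) e).
  by rewrite dotZr; move: lim; rewrite /Rabs; case: Rcase_abs; [right|left]; lra.
- left; rewrite (unit_dot1 N1 e1 c1) -{1}(pt1_sub x p) eE pt_scal; congr pt; ring.
- right; rewrite (unit_dot1 N1 _ c1) ?vnormN // -{1}(pt1_sub x p) eE !pt_scal; congr pt; ring.
Qed.

End Transport.

(** * Proximal normals of the critical set *)

Definition comb {n c} (a : vec c) (g : 'I_c -> vec n) : vec n :=
  fun i => \big[Rplus/0]_(j < c) (a j * g j i).

Lemma dot_comb {n c} (a : vec c) (g : 'I_c -> vec n) v :
  dot (comb a g) v = \big[Rplus/0]_(j < c) (a j * dot (g j) v).
Proof.
rewrite /dot /comb.
under eq_bigr => i _ do rewrite Rmult_comm -sumR_scal.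
rewrite exchange_big /=; apply: eq_bigr => j _.
by rewrite -sumR_scal; apply: eq_bigr => i _; ring.
Qed.

Lemma comb_add {n c} (a b : vec c) (g : 'I_c -> vec n) :
  comb (vadd a b) g = vadd (comb a g) (comb b g).
Proof.
apply: functional_extensionality => i; rewrite /comb /vadd -sumR_add.
by apply: eq_bigr => j _; ring.
Qed.

Lemma comb_scal {n c} t (a : vec c) (g : 'I_c -> vec n) :
  comb (vscal t a) g = vscal t (comb a g).
Proof.
apply: functional_extensionality => i; rewrite /comb /vscal -sumR_scal.
by apply: eq_bigr => j _; ring.
Qed.

Definition basis {n} (j : 'I_n) : vec n := fun i => if i == j then 1 else 0.

Lemma dot_basis {n} (j : 'I_n) (y : vec n) : dot (basis j) y = y j.
Proof.
rewrite /dot (bigD1 j) //= /basis eqxx big1; first by ring.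
by move=> k /negbTE ->; ring.
Qed.

Lemma basis_unit {n} (j : 'I_n) : vnorm (basis j) = 1.
Proof. by rewrite /vnorm /nrm2 dot_basis /basis eqxx sqrt_1. Qed.

Lemma comb_basis {n c} (j : 'I_c) (g : 'I_c -> vec n) : comb (basis j) g = g j.
Proof.
apply: functional_extensionality => i; rewrite /comb (bigD1 j) //= /basis eqxx big1.
  by ring.
by move=> k /negbTE ->; ring.
Qed.

Lemma comb_id {n} (a : vec n) : comb a basis = a.
Proof.
apply: functional_extensionality => i; rewrite /comb (bigD1 i) //= /basis eqxx big1.
  by ring.
by move=> k; rewrite eq_sym => /negbTE ->; ring.
Qed.

Lemma comb_sub {n c} (a : vec c) (g h : 'I_c -> vec n) :
  vsub (comb a g) (comb a h) = comb a (fun j => vsub (g j) (h j)).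
Proof.
apply: functional_extensionality => i; rewrite vsubE /vadd /vscal /comb -sumR_scal -sumR_add.
by apply: eq_bigr => j _; rewrite /vsub; ring.
Qed.

Lemma sum_abs_le {c} (a b : vec c) k : (forall j, Rabs (b j) <= k) ->
  Rabs (\big[Rplus/0]_(j < c) (a j * b j)) <= INR c * (vnorm a * k).
Proof.
move=> bk.
apply: (@Rle_trans _ (\big[Rplus/0]_(j < c) (vnorm a * k))); last by rewrite sumR_const; lra.
elim/big_ind2: _ => [|x x' y y' H1 H2|j _]; first by rewrite Rabs_R0; lra.
  by apply: Rle_trans (Rabs_triang _ _) _; lra.
rewrite Rabs_mult; apply: Rmult_le_compat; [exact: Rabs_pos|exact: Rabs_pos| |exact: bk].
exact: vnorm_comp.
Qed.

Lemma comb_norm_le {n c} (a : vec c) (g : 'I_c -> vec n) k : (forall j, vnorm (g j) <= k) ->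
  vnorm (comb a g) <= INR c * k * vnorm a.
Proof.
move=> gk; have C0 := vnorm_ge0 (comb a g); have a0 := vnorm_ge0 a; have c0 := pos_INR c.
have H : vnorm (comb a g) * vnorm (comb a g) <= INR c * (vnorm a * (k * vnorm (comb a g))).
  rewrite vnorm_sqr /nrm2 dot_comb; apply: Rle_trans (Rle_abs _) _.
  apply: (@sum_abs_le c a (fun j => dot (g j) (comb a g))) => j.
  apply: Rle_trans (cauchy_schwarz _ _) _; apply: Rmult_le_compat_r => //.
have [E|p] : vnorm (comb a g) = 0 \/ 0 < vnorm (comb a g) by lra.
  have [E0|j] : c = O \/ inhabited 'I_c by case: (c) => [|c']; [left|right; exact: (inhabits ord0)].
    by rewrite E (_ : INR c = 0) ?E0 //; lra.
  case: j => j; have := gk j; have := vnorm_ge0 (g j) => g0 gk'.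
  by rewrite E; apply: Rmult_le_pos => //; apply: Rmult_le_pos; lra.
by apply: (Rmult_le_reg_r (vnorm (comb a g))) => //; nra.
Qed.

(** Linear independence in the quantitative form that survives small perturbations of [g]; [m] is
    the minimum of |comb a g| on the unit sphere. *)
Lemma indep_bound {n c} (g : 'I_c -> vec n) : (forall a : vec c, comb a g = vzero -> a = vzero) ->
  exists m, 0 < m /\ forall a : vec c, m * vnorm a <= vnorm (comb a g).
Proof.
move=> ind.
have [k [k0 gk]] : exists k, 0 <= k /\ forall j, vnorm (g j) <= k.
  exists (\big[Rplus/0]_j vnorm (g j)); split; first by apply: sumR_ge0 => j; exact: vnorm_ge0.
  by move=> j; apply: (@sumR_ge_term _ (fun j => vnorm (g j))) => i; exact: vnorm_ge0.
have lip a b : Rabs (vnorm (comb a g) - vnorm (comb b g)) <= INR c * k * vdist a b.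
  apply: Rle_trans (vnorm_dist_le _ _) _; rewrite /vdist.
  rewrite (_ : vsub (comb a g) (comb b g) = comb (vsub a b) g); first exact: comb_norm_le.
  by rewrite !vsubE comb_add comb_scal.
have c0 := pos_INR c.
have ck : 0 <= INR c * k by nra.
case: (c =P O) => [E|/eqP cn].
  exists 1; split; first lra.
  move=> a; rewrite (_ : a = vzero) ?vnorm0; first by have := vnorm_ge0 (comb vzero g); lra.
  by apply: functional_extensionality => -[i ic]; exfalso; move: ic; rewrite E.
have j0 : 'I_c by case: (c) cn => [|c'] // _; exact: ord0.
have [|||a|a [a1 amin]] := @compact_max c (fun a => vnorm a = 1) 1 (fun a => - vnorm (comb a g)).
- move=> x x1; exists (Rabs (vnorm x - 1)); split; first by apply: Rabs_pos_lt; lra.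
  by move=> y yx y1; have := vnorm_dist_le y x; rewrite y1 Rabs_minus_sym; lra.
- by move=> x ->; lra.
- exists (basis j0); exact: basis_unit.
- move=> _ eps eps0; exists (eps / (INR c * k + 1)); split; first by apply: Rdiv_lt_0_compat; lra.
  move=> b _ ba; rewrite (_ : - _ - - _ = - (vnorm (comb b g) - vnorm (comb a g))); last ring.
  rewrite Rabs_Ropp; apply: Rle_lt_trans (lip b a) _.
  have E : eps / (INR c * k + 1) * (INR c * k + 1) = eps by field; lra.
  have := vdist_ge0 b a; nra.
exists (vnorm (comb a g)); split.
  case: (Rle_lt_or_eq_dec _ _ (vnorm_ge0 (comb a g))) => // /esym /vnorm_eq0 /ind E.
  by move: a1; rewrite E vnorm0; lra.
move=> b; have [b0|b0] : vnorm b = 0 \/ 0 < vnorm b by have := vnorm_ge0 b; lra.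
  by rewrite b0; have := vnorm_ge0 (comb b g); lra.
have := amin (unitize b) (unitize_norm b0).
rewrite /unitize comb_scal vnormZ Rabs_right; last by apply/Rle_ge/Rlt_le/Rinv_0_lt_compat.
move=> H; apply: (@Rle_trans _ (/ vnorm b * vnorm (comb b g) * vnorm b)).
  by apply: Rmult_le_compat_r; lra.
by apply: Req_le; field; lra.
Qed.

Lemma quad_nonneg_lin b k : (forall t, 0 <= 2 * t * b + t * t * k) -> b = 0.
Proof.
move=> H; have k0 : 0 <= Rabs k by exact: Rabs_pos.
have kk := Rle_abs k.
have := H (- b / (Rabs k + 1)); set t := _ / _.
have tE : t * (Rabs k + 1) = - b by rewrite /t; field; lra.
have -> : b = - t * (Rabs k + 1) by lra.
have := Rle_0_sqr t; rewrite /Rsqr => tt H1.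
have : t * t * (Rabs k + 2) <= 0 by nra.
move=> H2; have : t = 0 by nra.
by move=> ->; ring.
Qed.

(** Orthogonal projection as a least-squares problem. Outside the ball of radius 2|w|/m the
    combination is longer than 2|w|, hence farther from [w] than 0 is, so a minimum over the ball is
    global. *)
Lemma orth_residual {n c} (g : 'I_c -> vec n) m w : 0 < m ->
  (forall a : vec c, m * vnorm a <= vnorm (comb a g)) ->
  exists a : vec c, forall j, dot (vsub w (comb a g)) (g j) = 0.
Proof.
move=> m0 ind.
have [k [k0 gk]] : exists k, 0 <= k /\ forall j, vnorm (g j) <= k.
  exists (\big[Rplus/0]_j vnorm (g j)); split; first by apply: sumR_ge0 => j; exact: vnorm_ge0.
  by move=> j; apply: (@sumR_ge_term _ (fun j => vnorm (g j))) => i; exact: vnorm_ge0.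
have c0 := pos_INR c; have w0 := vnorm_ge0 w.
have ck : 0 <= INR c * k by nra.
have [||a [aA amin]] := @ball_max c vzero (2 * vnorm w / m) (fun a => - vdist w (comb a g)).
- by apply: Rdiv_le_0_compat; lra.
- move=> a _ eps eps0; exists (eps / (INR c * k + 1)); split; first by apply: Rdiv_lt_0_compat; lra.
  move=> b ba; rewrite (_ : - _ - - _ = - (vdist w (comb b g) - vdist w (comb a g))); last ring.
  rewrite Rabs_Ropp; apply: (@Rle_lt_trans _ (INR c * k * vdist b a)).
    have : vdist (comb b g) (comb a g) <= INR c * k * vdist b a.
      rewrite /vdist (_ : vsub (comb b g) (comb a g) = comb (vsub b a) g); first exact: comb_norm_le.
      by rewrite !vsubE comb_add comb_scal.
    have := vdist_tri w (comb b g) (comb a g); have := vdist_tri w (comb a g) (comb b g).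
    by rewrite (vdistC (comb a g)) => *; apply: Rabs_le; lra.
  have E : eps / (INR c * k + 1) * (INR c * k + 1) = eps by field; lra.
  have := vdist_ge0 b a; nra.
have comb0 : comb (vzero : vec c) g = vzero.
  by rewrite -(vscal0 (vzero : vec c)) comb_scal vscal0.
have d0 (x : vec n) : vdist x vzero = vnorm x.
  by congr vnorm; vec_ring.
have d0c (x : vec c) : vdist x vzero = vnorm x.
  by congr vnorm; vec_ring.
have glob b : vdist w (comb a g) <= vdist w (comb b g).
  case: (Rle_dec (vnorm b) (2 * vnorm w / m)) => H; first by have := amin b; rewrite d0c; lra.
  have := amin vzero; rewrite vdist_xx comb0 d0 => /(_ ltac:(by apply: Rdiv_le_0_compat; lra)) A.
  have : m * vnorm b > 2 * vnorm w.
    by apply: Rnot_le_gt => H'; apply: H; apply: (Rmult_le_reg_l m) => //; rewrite /Rdiv; field_simplify; lra.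
  have := ind b; have := vdist_tri (comb b g) w vzero; rewrite !d0 (vdistC _ w); lra.
exists a => j.
apply: (@quad_nonneg_lin _ (nrm2 (g j))) => t.
have := glob (vadd a (vscal (- t) (basis j))).
rewrite comb_add comb_scal comb_basis.
have -> : vdist w (vadd (comb a g) (vscal (- t) (g j))) = vnorm (vadd (vsub w (comb a g)) (vscal t (g j))).
  by congr vnorm; vec_ring.
rewrite /vdist; move: (vsub w (comb a g)) => v H.
have : vnorm v * vnorm v <= vnorm (vadd v (vscal t (g j))) * vnorm (vadd v (vscal t (g j))).
  by have := vnorm_ge0 v; nra.
rewrite !vnorm_sqr /nrm2 !dotE (dotC (g j) v); lra.
Qed.

Lemma has_grad_sum {n c} (F : 'I_c -> vec n -> R) (D : 'I_c -> vec n) y :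
  (forall j, has_grad (F j) y (D j)) ->
  has_grad (fun z => \big[Rplus/0]_(j < c) F j z) y (fun i => \big[Rplus/0]_(j < c) D j i).
Proof.
move=> H.
have E (s : seq 'I_c) : has_grad (fun z => \big[Rplus/0]_(j <- s) F j z) y (fun i => \big[Rplus/0]_(j <- s) D j i).
  elim: s => [|j s IH].
    have := @has_grad_aff n vzero 0 y; congr has_grad.
      by apply: functional_extensionality => z; rewrite big_nil dot0l; ring.
    by apply: functional_extensionality => z; rewrite big_nil.
  have := has_grad_add (H j) IH; congr has_grad.
    by apply: functional_extensionality => z; rewrite big_cons.
  by apply: functional_extensionality => z; rewrite big_cons.
exact: E.
Qed.

(** * Normals of the zero set of independent equations *)

Section Zero.
Context {n : nat} (C : vec n -> Prop).

(** An open ball with centre on the ray from [q] along [w] and with [q] on its boundary misses [C].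
    The notion involves the set alone and no choice of equations, and a nearest point of [C]
    provides such a ball. *)
Definition proximal (q w : vec n) : Prop :=
  exists s, 0 < s /\ forall z, C z -> s * vnorm w <= vdist z (pt q s w).

(** The constants [m] and [K] are uniform over the ball, so that one radius of tangent balls serves
    all points of [C] near [p]. *)
Record zero_chart (p : vec n) (c : nat) (d m K : R) (F : 'I_c -> vec n -> R)
    (DF : 'I_c -> vec n -> vec n) : Prop := ZeroChart {
  zc_d : 0 < d;
  zc_m : 0 < m;
  zc_K : 0 < K;
  zc_grad : forall j y, has_grad (F j) y (DF j y);
  zc_lip : forall j y z, vdist y p < d -> vdist z p < d -> vdist (DF j y) (DF j z) <= K * vdist y z;
  zc_zero : forall y, vdist y p < d -> (C y <-> forall j, F j y = 0);
  zc_ind : forall y, vdist y p < d -> forall a : vec c, m * vnorm a <= vnorm (comb a (fun j => DF j y)) }.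

Section Chart.
Variables (p : vec n) (c : nat) (d m K : R) (F : 'I_c -> vec n -> R) (DF : 'I_c -> vec n -> vec n).
Hypothesis Z : zero_chart p d m K F DF.

Lemma zc_taylor j q z : vdist q p < d -> vdist z p < d ->
  Rabs (F j z - F j q - dot (DF j q) (vsub z q)) <= K * (vdist z q * vdist z q).
Proof.
move=> qd zd; have [t _|t [t01 ->]] := @mvt n (F j) (DF j) q z; first exact: (zc_grad Z).
rewrite -dotBl; apply: Rle_trans (cauchy_schwarz _ _) _.
rewrite -/(vdist _ _) -/(vdist z q).
have := zc_lip Z j (seg_ball qd zd t01) qd; rewrite vdist_pt0 -/(vdist z q) Rabs_right; last lra.
have := vdist_ge0 z q; have := zc_K Z; move: (vdist z q) => v K0 v0 H.
have : K * (t * v) <= K * v by apply: Rmult_le_compat_l; nra.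
nra.
Qed.

Let M := INR c * K / m.
Lemma zc_M0 : 0 <= M.
Proof.
have := zc_K Z; have := zc_m Z => m0 K0; have := pos_INR c => c0.
by apply: Rdiv_le_0_compat => //; nra.
Qed.

(** Both values of [F] vanish, so the Taylor estimate shows that chords of [C] are orthogonal to the
    normals at [q] up to second order. [M] is scaled by [m] to bound the coefficients by the length
    of the combination. *)
Lemma zc_quad q z a : vdist q p < d -> vdist z p < d -> C q -> C z ->
  Rabs (dot (comb a (fun j => DF j q)) (vsub z q)) <=
  M * vnorm (comb a (fun j => DF j q)) * (vdist z q * vdist z q).
Proof.
move=> qd zd /(zc_zero Z qd) Fq /(zc_zero Z zd) Fz.
have m0 := zc_m Z; have K0 := zc_K Z; have c0 := pos_INR c; have v0 := vdist_ge0 z q.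
rewrite dot_comb.
apply: Rle_trans (@sum_abs_le c a _ (K * (vdist z q * vdist z q)) _) _.
  move=> j; have := zc_taylor j qd zd; rewrite Fq Fz.
  by rewrite (_ : 0 - 0 - _ = - dot (DF j q) (vsub z q)) ?Rabs_Ropp //; ring.
have := zc_ind Z qd a => H.
have : INR c * K * (vdist z q * vdist z q) * (m * vnorm a) <= INR c * K * (vdist z q * vdist z q) * vnorm (comb a (fun j => DF j q)).
  by apply: Rmult_le_compat_l => //; repeat apply: Rmult_le_pos => //; lra.
move=> H2; apply: (Rmult_le_reg_r m) => //; rewrite /M.
have -> : INR c * K / m * vnorm (comb a (fun j : 'I_c => DF j q)) * (vdist z q * vdist z q) * m =
   INR c * K * (vdist z q * vdist z q) * vnorm (comb a (fun j => DF j q)) by field; lra.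
lra.
Qed.

(** A point [z] at distance at least twice the radius from [q] is outside by the triangle
    inequality. Any other [z] lies in the chart, since e <= d/4, and there the choice e <=
    1/(2(M+1)) makes the quadratic deviation smaller than the squared chord. *)
Lemma zc_ball : exists e, 0 < e /\ e <= d / 4 /\ forall q a s z, vdist q p < d / 2 -> C q -> C z ->
  Rabs s * vnorm (comb a (fun j => DF j q)) <= e ->
  Rabs s * vnorm (comb a (fun j => DF j q)) <= vdist z (pt q s (comb a (fun j => DF j q))).
Proof.
have d0 := zc_d Z; have M0 := zc_M0.
exists (Rmin (d / 4) (/ (2 * (M + 1)))).
have i0 : 0 < / (2 * (M + 1)) by apply: Rinv_0_lt_compat; lra.
split; first by apply: Rmin_glb_lt; lra.
split; first exact: Rmin_l.
move=> q a s z qd Cq Cz; set w := comb _ _ => sw.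
have sw1 := Rle_trans _ _ _ sw (Rmin_l _ _).
have sw2 := Rle_trans _ _ _ sw (Rmin_r _ _).
have Mw : Rabs s * vnorm w * M <= / 2.
  apply: (@Rle_trans _ (/ (2 * (M + 1)) * M)); first by apply: Rmult_le_compat_r.
  apply: (Rmult_le_reg_l (2 * (M + 1))); first lra.
  by rewrite -Rmult_assoc Rinv_r; lra.
case: (Rle_dec (2 * (Rabs s * vnorm w)) (vdist z q)) => H.
  have := vdist_tri z (pt q s w) q; rewrite vdist_pt0; lra.
have zd : vdist z p < d by have := vdist_tri z q p; lra.
have Q := @zc_quad q z a ltac:(lra) zd Cq Cz; rewrite -/w in Q.
apply: sqr_le_le; first exact: vdist_ge0.
rewrite vdist_sqr sub_pt.
move: (Q) Mw; rewrite /vdist; move: (vsub z q) w {sw sw1 sw2 H Q} => v w Q Mw.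
rewrite /nrm2 !dotE (dotC v w) -!/(nrm2 v) -!/(nrm2 w) -!vnorm_sqr.
have ss := abs_sqr s.
have : s * dot w v <= Rabs s * (M * vnorm w * (vnorm v * vnorm v)).
  apply: Rle_trans (Rle_abs _) _; rewrite Rabs_mult; apply: Rmult_le_compat_l => //; exact: Rabs_pos.
have v0 : 0 <= vnorm v * vnorm v by have := vnorm_ge0 v; nra.
have -> : Rabs s * vnorm w * (Rabs s * vnorm w) = s * s * (vnorm w * vnorm w) by rewrite -ss; ring.
have : Rabs s * (M * vnorm w * (vnorm v * vnorm v)) <= / 2 * (vnorm v * vnorm v).
  by rewrite (_ : Rabs s * _ = Rabs s * vnorm w * M * (vnorm v * vnorm v)); [apply: Rmult_le_compat_r|ring].
lra.
Qed.

(* Lyusternik's theorem: a minimizer of |F| + (m/2)|. - y0| near y0 = q + h w is a zero of F. *)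
Lemma zc_tangent q w : vdist q p < d / 2 -> C q -> (forall j, dot w (DF j q) = 0) ->
  exists K' h0, 0 < h0 /\ 0 <= K' /\ forall h, 0 < h < h0 ->
    exists z, C z /\ vdist z p < d /\ vdist z (pt q h w) <= K' * (h * h).
Proof.
move=> qd Cq worth.
have m0 := zc_m Z; have K0 := zc_K Z; have d0 := zc_d Z; have c0 := pos_INR c.
have w0 := vnorm_ge0 w.
pose A := INR c * (K * (vnorm w * vnorm w)).
have A0 : 0 <= A by rewrite /A; repeat apply: Rmult_le_pos => //; lra.
(* [A] times the square of [h] bounds |F| at [y0], and comparing the minimizer with [y0] bounds its
   distance to [y0] by 2/m times that. *)
pose K' := 2 / m * A.
have K'0 : 0 <= K' by apply: Rmult_le_pos => //; apply: Rdiv_le_0_compat; lra.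
pose h0 := Rmin 1 (d / (8 * (vnorm w + K' + 1))).
have hq0 : 0 < d / (8 * (vnorm w + K' + 1)) by apply: Rdiv_lt_0_compat; lra.
have h00 : 0 < h0 by apply: Rmin_glb_lt; lra.
exists K', h0; do 2![split=> //] => h hh.
have h1 : h < 1 by have := Rmin_l 1 (d / (8 * (vnorm w + K' + 1))); rewrite -/h0; lra.
have h2 : h * (vnorm w + K' + 1) <= d / 8.
  have := Rmin_r 1 (d / (8 * (vnorm w + K' + 1))); rewrite -/h0 => H.
  apply: (@Rle_trans _ (d / (8 * (vnorm w + K' + 1)) * (vnorm w + K' + 1))).
    by apply: Rmult_le_compat_r; lra.
  by apply: Req_le; field; lra.
pose y0 := pt q h w.
have y0q : vdist y0 q = h * vnorm w by rewrite vdist_pt0 Rabs_right; lra.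
have y0p : vdist y0 p < 5 * d / 8 by have := vdist_tri y0 q p; nra.
pose Fv y : vec c := fun j => F j y.
have Fy0 : vnorm (Fv y0) <= A * (h * h).
  rewrite (_ : A * (h * h) = INR c * (K * (vdist y0 q * vdist y0 q))); last by rewrite y0q /A; ring.
  apply: vnorm_le_comp; first by have := vdist_ge0 y0 q; nra.
  move=> j; have := zc_taylor j (q := q) (z := y0) ltac:(lra) ltac:(lra).
  rewrite (proj1 (zc_zero Z (_ : vdist q p < d)) Cq) //; last lra.
  by rewrite ptK dotZr dotC worth Rmult_0_r !Rminus_0_r.
have Fc y : cont_at (fun y => vnorm (Fv y)) y.
  move=> eps eps0; have [|e [e0 He]] := @vcont_of_comp n c Fv y _ eps eps0.
    by move=> j; exact: has_grad_cont (zc_grad Z j y).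
  by exists e; split=> // z /He H; apply: Rle_lt_trans (vnorm_dist_le _ _) H.
have [||y [yr ymin]] := @ball_max n y0 (d / 4) (fun y => - (vnorm (Fv y) + m / 2 * vdist y y0)); first lra.
  move=> y _ eps eps0.
  have [e [e0 He]] := Fc y (eps / 2) ltac:(lra).
  have [e' [e'0 He']] := @dist_cont n y0 y (eps / m) ltac:(exact: Rdiv_lt_0_compat).
  exists (Rmin e e'); split; first exact: Rmin_glb_lt.
  move=> z zy; have {}He := He z (Rlt_minl zy).
  have {}He' := He' z (Rlt_minr zy).
  rewrite (_ : - _ - - _ = - ((vnorm (Fv z) - vnorm (Fv y)) + m / 2 * (vdist z y0 - vdist y y0))); last ring.
  rewrite Rabs_Ropp; apply: Rle_lt_trans (Rabs_triang _ _) _.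
  rewrite Rabs_mult (Rabs_right (m / 2)); last lra.
  have : m / 2 * Rabs (vdist z y0 - vdist y y0) < m / 2 * (eps / m) by apply: Rmult_lt_compat_l; lra.
  rewrite (_ : m / 2 * (eps / m) = eps / 2); last by field; lra.
  lra.
have F0 := vnorm_ge0 (Fv y).
have yy0 : vdist y y0 <= K' * (h * h).
  have := ymin y0; rewrite vdist_xx => /(_ ltac:(lra)) H.
  apply: (Rmult_le_reg_l (m / 2)); first lra.
  rewrite (_ : m / 2 * (K' * (h * h)) = A * (h * h)); last by rewrite /K'; field; lra.
  lra.
have yy1 : vdist y y0 <= d / 8.
  apply: Rle_trans yy0 _; have : K' * (h * h) <= K' * h by apply: Rmult_le_compat_l => //; nra.
  nra.
have yd : vdist y p < d by have := vdist_tri y y0 p; lra.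
exists y; split=> //; apply/(zc_zero Z yd).
have [E|Fpos] : vnorm (Fv y) = 0 \/ 0 < vnorm (Fv y) by lra.
  by move=> j; move/vnorm_eq0: E => /(f_equal (fun v => v j)).
exfalso.
(* If |F| were positive at the minimizer [y], a step along minus the gradient of its square would
   lower |F| at a rate of at least [m], whereas the penalty term grows at rate m/2 at most. The
   square is used as its gradient is a plain combination of the [DF j]. *)
pose th z := \big[Rplus/0]_(j < c) (F j z * F j z).
have thE z : th z = vnorm (Fv z) * vnorm (Fv z) by rewrite vnorm_sqr.
pose v := comb (Fv y) (fun j => DF j y).
have vm : m * vnorm (Fv y) <= vnorm v by exact: (zc_ind Z yd).
have v0 : 0 < vnorm v by nra.
have thg : has_grad th y (vscal 2 v).
  have dsq r : is_derive (fun s => s * s) r (2 * r) by auto_derive => //; ring.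
  have := @has_grad_sum n c (fun j z => F j z * F j z) (fun j => vscal (2 * F j y) (DF j y)) y
    (fun j => has_grad_comp (zc_grad Z j y) (dsq (F j y))).
  congr has_grad; apply: functional_extensionality => i.
  by rewrite /vscal /v /comb -sumR_scal; apply: eq_bigr => j _; rewrite /Fv; ring.
have [|e [e0 He]] := (proj1 (has_gradP _ _ _) thg) (vnorm (Fv y) * m / 2); first nra.
pose t := Rmin e (d / 8) / 2.
have me0 : 0 < Rmin e (d / 8) by apply: Rmin_glb_lt; lra.
have t0 : 0 < t by rewrite /t; lra.
have te : t < e by have := Rmin_l e (d / 8); rewrite /t; lra.
have td : t < d / 8 by have := Rmin_r e (d / 8); rewrite /t; lra.
pose z := pt y (- t) (unitize v).
have u1 := unitize_norm v0.
have zy : vdist z y = t by rewrite vdist_pt0 u1 Rabs_Ropp Rabs_right; lra.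
have := He z ltac:(lra); rewrite zy ptK dotZr dotZl dot_unitize // !thE => /Rabs_le_between [_ H1].
have H2 := ymin z ltac:(have := vdist_tri z y y0; lra).
have H3 := vdist_tri z y y0.
have H4 : vnorm (Fv y) - m / 2 * t <= vnorm (Fv z) by nra.
have Fz0 := vnorm_ge0 (Fv z).
have H5 : vnorm (Fv y) * vnorm (Fv y) - m * t * vnorm (Fv y) <= vnorm (Fv z) * vnorm (Fv z).
  have [|] := Rle_dec 0 (vnorm (Fv y) - m / 2 * t); nra.
have H6 : t * (2 * vnorm v) <= t * (vnorm (Fv y) * m / 2 + m * vnorm (Fv y)) by lra.
have := Rmult_le_reg_l _ _ _ t0 H6; nra.
Qed.

(** Conversely to [zc_ball], let [w'] be the part of [w] orthogonal to all gradients. If it is not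
    zero, [zc_tangent] gives points of [C] at q + h w' up to second order; these enter the ball
    tangent at [q], since to first order they move towards its centre. *)
Lemma zc_proximal q w : vdist q p < d / 2 -> C q ->
  proximal q w <-> exists a, w = comb a (fun j => DF j q).
Proof.
move=> qd Cq; have m0 := zc_m Z; have d0 := zc_d Z; have M0 := zc_M0.
split; last first.
  move=> [a ->]; have [e [e0 [ed He]]] := zc_ball.
  set w' := comb _ _ in He *; have w0 := vnorm_ge0 w'.
  have s0 : 0 < e / (vnorm w' + 1) by apply: Rdiv_lt_0_compat; lra.
  exists (e / (vnorm w' + 1)); split=> // z Cz.
  have := He q a (e / (vnorm w' + 1)) z qd Cq Cz; rewrite -/w' Rabs_right; last lra.
  apply; have : e / (vnorm w' + 1) * (vnorm w' + 1) = e by field; lra.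
  nra.
move=> [s [s0 Hs]].
have qd' : vdist q p < d by lra.
have [a Ha] := orth_residual w m0 (zc_ind Z qd').
set w0 := comb _ _ in Ha; set w' := vsub w w0 in Ha.
suff w'0 : w' = vzero.
  exists a; apply: functional_extensionality => i.
  by have := f_equal (fun v => v i) w'0; rewrite /w' /vsub /vzero /w0; lra.
have [K' [h0 [h00 [K'0 Ht]]]] := zc_tangent qd Cq Ha.
apply: NNPP => ne; have wp : 0 < vnorm w'.
  by exact: vnorm_gt0.
pose B := M * vnorm w0 + / (2 * s).
have B0 : 0 <= B.
  have : 0 < / (2 * s) by apply: Rinv_0_lt_compat; lra.
  by have := vnorm_ge0 w0; rewrite /B; nra.
(* [L] collects all second-order terms: the comparison below reads h|w'|^2 <= h^2 L, which fails for
   the small [h] chosen next. *)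
pose L := K' * vnorm w' + B * ((vnorm w' + K') * (vnorm w' + K')).
have L0 : 0 <= L.
  have q2 : 0 <= (vnorm w' + K') * (vnorm w' + K') by exact: Rle_0_sqr.
  by have := Rmult_le_pos _ _ B0 q2; have := Rmult_le_pos _ _ K'0 (Rlt_le _ _ wp); rewrite /L; lra.
pose h := Rmin 1 (Rmin h0 (vnorm w' * vnorm w' / (L + 1))) / 2.
have mh : 0 < Rmin 1 (Rmin h0 (vnorm w' * vnorm w' / (L + 1))).
  by repeat apply: Rmin_glb_lt => //; [lra|apply: Rdiv_lt_0_compat; nra].
have hp : 0 < h by rewrite /h; lra.
have h1 : h <= 1 by have := Rmin_l 1 (Rmin h0 (vnorm w' * vnorm w' / (L + 1))); rewrite /h; lra.
have h2 := Rle_trans _ _ _ (Rmin_r 1 (Rmin h0 (vnorm w' * vnorm w' / (L + 1)))) (Rmin_l _ _).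
have h3 := Rle_trans _ _ _ (Rmin_r 1 (Rmin h0 (vnorm w' * vnorm w' / (L + 1)))) (Rmin_r _ _).
have [z [Cz [zd zt]]] := Ht h ltac:(rewrite /h; lra).
have Q := zc_quad a qd' zd Cq Cz; rewrite -/w0 in Q.
have zq : vdist z q <= h * (vnorm w' + K').
  have := vdist_tri z (pt q h w') q; rewrite vdist_pt0 Rabs_right; last lra.
  have : K' * (h * h) <= K' * h by apply: Rmult_le_compat_l => //; nra.
  lra.
have zq0 := vdist_ge0 z q.
have P1 : dot w (vsub z q) <= / (2 * s) * (vdist z q * vdist z q).
  have := Hs z Cz => H; have {}H : s * vnorm w * (s * vnorm w) <= vdist z (pt q s w) * vdist z (pt q s w).
    have : 0 <= s * vnorm w by apply: Rmult_le_pos; [lra|exact: vnorm_ge0].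
    by move=> ?; apply: Rmult_le_compat.
  move: H; rewrite vdist_sqr sub_pt.
  rewrite /vdist; move: (vsub z q) => v.
  rewrite /nrm2 !dotE (dotC v w) -!/(nrm2 v) -!/(nrm2 w) -!vnorm_sqr => H.
  apply: (Rmult_le_reg_l (2 * s)); first lra.
  rewrite -Rmult_assoc Rinv_r; lra.
have P2 : h * (vnorm w' * vnorm w') - K' * (h * h) * vnorm w' <= dot w' (vsub z q).
  have -> : vsub z q = vadd (vscal h w') (vsub z (pt q h w')).
    by vec_ring.
  rewrite dotDr dotZr -/(nrm2 w') -vnorm_sqr.
  have := cauchy_schwarz w' (vsub z (pt q h w')); rewrite -/(vdist z _) => /Rabs_le_between; nra.
have P3 : dot w (vsub z q) = dot w' (vsub z q) + dot w0 (vsub z q) by rewrite /w' dotBl; ring.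
move/Rabs_le_between: Q => Q.
have P4 : vdist z q * vdist z q <= h * h * ((vnorm w' + K') * (vnorm w' + K')) by nra.
have P5 : B * (vdist z q * vdist z q) <= B * (h * h * ((vnorm w' + K') * (vnorm w' + K'))) by apply: Rmult_le_compat_l.
have P6 : h * (vnorm w' * vnorm w') <= h * (h * L) by rewrite /L; move: P5; rewrite {1}/B; lra.
have P7 := Rmult_le_reg_l _ _ _ hp P6.
have : h * (L + 1) <= vnorm w' * vnorm w' / 2.
  have : 2 * h * (L + 1) <= vnorm w' * vnorm w' / (L + 1) * (L + 1) by apply: Rmult_le_compat_r; rewrite /h; lra.
  rewrite (_ : _ / (L + 1) * (L + 1) = vnorm w' * vnorm w'); last by field; lra.
  lra.
nra.
Qed.

End Chart.
End Zero.

Lemma fin_radius {I : finType} (P : I -> R -> Prop) :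
  (forall i r r', 0 < r' -> r' <= r -> P i r -> P i r') ->
  (forall i, exists r, 0 < r /\ P i r) -> exists r, 0 < r /\ forall i, P i r.
Proof.
move=> mono H.
suff: exists r, 0 < r /\ forall i, i \in enum I -> P i r.
  by move=> [r [r0 Hr]]; exists r; split=> // i; apply: Hr; rewrite mem_enum.
elim: (enum I) => [|i s [r [r0 Hr]]]; first by exists 1; split; [lra|].
have [r' [r'0 Hr']] := H i.
have m0 : 0 < Rmin r r' by exact: Rmin_glb_lt.
exists (Rmin r r'); split=> // j; rewrite in_cons => /orP [/eqP ->|/Hr].
  by apply: mono Hr' => //; exact: Rmin_r.
by apply: mono => //; exact: Rmin_l.
Qed.

Lemma gram_schmidt {n} (v w : vec n) : vnorm v = 1 -> w <> vscal (dot w v) v ->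
  0 < vnorm (vsub w (vscal (dot w v) v)) /\
  dot v (unitize (vsub w (vscal (dot w v) v))) = 0.
Proof.
move=> v1 ne; split.
  case: (Rle_lt_or_eq_dec _ _ (vnorm_ge0 (vsub w (vscal (dot w v) v)))) => // E.
  by case: ne; exact: vdist_eq0 (esym E).
rewrite /unitize dotZr dotBr dotZr -/(nrm2 v) -vnorm_sqr v1 (dotC v w); ring.
Qed.

Definition codim {n} (C : vec n -> Prop) (p : vec n) (c : nat) : Prop :=
  exists d m K (F : 'I_c -> vec n -> R) DF, zero_chart C p d m K F DF.

Definition focal {n} (C : vec n -> Prop) (p : vec n) : Prop :=
  exists v w, proximal C p v /\ proximal C p w /\ vnorm v = 1 /\ vnorm w = 1 /\ dot v w = 0.

(** Independence at the single point [p] spreads to a ball: the radius is chosen such that moving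
    the gradients costs at most half of the lower bound [m]. *)
Lemma codim_of_equations {n} (C : vec n -> Prop) p c r (F : 'I_c -> vec n -> R) : 0 < r ->
  (forall j, Ck 2 (F j)) ->
  (forall y, vdist y p < r -> (C y <-> forall j, F j y = 0)) ->
  (forall D : 'I_c -> vec n, (forall j, has_grad (F j) p (D j)) ->
     forall a : vec c, comb a D = vzero -> a = vzero) ->
  codim C p c.
Proof.
move=> r0 FC Fz ind.
have /choice [DF HDF] := fun j => C2_grad (FC j).
(* One number [k] serves as radius and as inverse Lipschitz constant; the condition is then monotone
   in [k] and [fin_radius] can treat all equations at once. *)
have [k [k0 Hk]] : exists k, 0 < k /\ forall j y z, vdist y p < k -> vdist z p < k ->
    vdist (DF j y) (DF j z) <= / k * vdist y z.
  apply: (@fin_radius _ (fun j k => forall y z, vdist y p < k -> vdist z p < k ->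
    vdist (DF j y) (DF j z) <= / k * vdist y z)).
    move=> j k k' k'0 k'k H y z yk zk; apply: Rle_trans (H y z _ _) _; try lra.
    by apply: Rmult_le_compat_r; [exact: vdist_ge0|apply: Rinv_le_contravar].
  move=> j; have [_ [_ /(_ p) [d [K [d0 [K0 HK]]]]]] := HDF j.
  have m0 : 0 < Rmin d (/ K) by apply: Rmin_glb_lt => //; exact: Rinv_0_lt_compat.
  exists (Rmin d (/ K)); split=> // y z yd zd.
  apply: Rle_trans (HK y z (Rlt_minl yd) (Rlt_minl zd)) _.
  apply: Rmult_le_compat_r; first exact: vdist_ge0.
  rewrite -[X in X <= _]Rinv_inv; apply: Rinv_le_contravar => //; exact: Rmin_r.
have [|m [m0 Hm]] := @indep_bound n c (fun j => DF j p).
  by move=> a; apply: ind => j; exact: (proj1 (HDF j)).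
have c0 := pos_INR c.
pose d := Rmin r (Rmin k (m / (2 * (INR c * / k + 1)))).
have ik : 0 < / k by exact: Rinv_0_lt_compat.
have q0 : 0 < m / (2 * (INR c * / k + 1)) by apply: Rdiv_lt_0_compat => //; nra.
have d0 : 0 < d by repeat apply: Rmin_glb_lt.
have dr : d <= r by exact: Rmin_l.
have dk : d <= k by exact: Rle_trans (Rmin_r _ _) (Rmin_l _ _).
have dm : INR c * / k * d <= m / 2.
  apply: (@Rle_trans _ ((INR c * / k + 1) * (m / (2 * (INR c * / k + 1))))).
    apply: Rmult_le_compat; [nra|lra|lra|exact: Rle_trans (Rmin_r _ _) (Rmin_r _ _)].
  by apply: Req_le; field; split; nra.
exists d, (m / 2), (/ k), F, DF; split=> //; first lra.
- by move=> j; exact: (proj1 (HDF j)).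
- by move=> j y z yd zd; apply: Hk; lra.
- by move=> y yd; apply: Fz; lra.
- move=> y yd a.
  have H1 : vdist (comb a (fun j => DF j p)) (comb a (fun j => DF j y)) <= INR c * (/ k * vdist p y) * vnorm a.
    rewrite /vdist comb_sub; apply: comb_norm_le => j; apply: Hk; last lra.
    by rewrite vdist_xx; lra.
  have := vnorm_le_dist (comb a (fun j => DF j p)) (comb a (fun j => DF j y)).
  have := Hm a; have a0 := vnorm_ge0 a.
  have : INR c * (/ k * vdist p y) * vnorm a <= m / 2 * vnorm a.
    apply: Rmult_le_compat_r => //; rewrite -Rmult_assoc vdistC; apply: Rle_trans dm.
    by apply: Rmult_le_compat_l; nra.
  lra.
Qed.

Lemma codim_isolated_point {n} (C : vec n -> Prop) p r : 0 < r ->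
  (forall y, vdist y p < r -> (C y <-> y = p)) -> codim C p n.
Proof.
move=> r0 H; exists r, 1, 1, (fun j y => dot (basis j) y + - p j), (fun j _ => basis j).
split=> //; try lra.
- by move=> j y; exact: has_grad_aff.
- by move=> j y z _ _; rewrite vdist_xx; have := vdist_ge0 y z; lra.
- move=> y /H ->; split=> [-> j|E]; first by rewrite dot_basis; ring.
  by apply: functional_extensionality => j; have := E j; rewrite dot_basis; lra.
- by move=> y _ a; rewrite comb_id; lra.
Qed.

Lemma conn_comp_sub {n} (S : vec n -> Prop) x y : conn_comp S x y -> S y.
Proof. by move=> [A [_ [AS [_ Ay]]]]; exact: AS. Qed.

Lemma conn_comp_sym {n} (S : vec n -> Prop) x y : conn_comp S x y -> conn_comp S y x.
Proof. by move=> [A [cA [AS [Ax Ay]]]]; exists A. Qed.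

Lemma conn_comp_refl {n} (S : vec n -> Prop) x : S x -> conn_comp S x x.
Proof.
move=> Sx; exists (fun z => z = x); split; last by split=> // z ->.
by move=> [U [V [_ [_ [_ [[_ [-> Ux]] [[_ [-> Vx]] dis]]]]]]]; exact: (dis x).
Qed.

(** * Codimension and normal spaces of the critical components *)

Section Critical.
Context {n : nat} (C : vec n -> Prop).
Hypothesis n0 : (0 < n)%N.
Hypothesis comps : forall x, C x ->
  (forall y, conn_comp C x y <-> (forall i, y i = x i)) \/ reg_surface (conn_comp C x).
Hypothesis isolated : forall x, C x -> exists r, 0 < r /\
  forall y, C y -> nrm2 (vsub y x) < r * r -> conn_comp C x y.

Lemma C_isolated x : C x -> exists r, 0 < r /\ forall y, vdist y x < r -> C y -> conn_comp C x y.
Proof.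
move=> /isolated [r [r0 Hr]]; exists r; split=> // y yx Cy; apply: Hr => //; exact/nrm2_lt.
Qed.

(** Isolation turns local equations of a component into local equations of all of [C]. The number of
    equations, [n] for a point and n-d for a surface, is the same along the component; this is what
    lets focality pass from point to point. *)
Lemma codim_comp p q : C p -> conn_comp C p q ->
  exists c, (0 < c)%N /\ codim C p c /\ codim C q c.
Proof.
move=> Cp pq; case: (comps Cp) => [pt|[d [d1 [dn H]]]].
  have -> : q = p by apply: functional_extensionality; exact/pt.
  exists n; suff: codim C p n by [].
  have [r [r0 Hr]] := C_isolated Cp.
  apply: (codim_isolated_point r0) => y yr; split=> [Cy|-> //].
  by apply: functional_extensionality; apply/pt; exact: Hr.
have local z : conn_comp C p z -> codim C z (n - d).
  move=> pz; have Cz := conn_comp_sub pz.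
  have [r [r0 [F [Fs [Fz Find]]]]] := H z pz.
  have [r' [r'0 Hr']] := C_isolated Cz.
  apply: (@codim_of_equations n C z (n - d) (Rmin r r') F); first exact: Rmin_glb_lt.
  - by move=> j; exact: (Fs j 2%N).
  - move=> y yr.
    have y1 : nrm2 (vsub y z) < r * r by apply/nrm2_lt => //; exact: Rlt_minl yr.
    have y2 := Rlt_minr yr.
    rewrite -(Fz y y1); split=> [Cy|]; last exact: conn_comp_sub.
    by apply: conn_comp_trans pz _; exact: Hr'.
  - move=> D HD a E; apply: functional_extensionality.
    apply: (Find z _ pz D HD); first by apply/nrm2_lt => //; rewrite -/(vdist z z) vdist_xx.
    by move=> i; exact: (f_equal (fun v => v i) E).
exists (n - d)%N; split; first by rewrite subn_gt0.
by split; apply: local => //; exact: conn_comp_refl.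
Qed.

Lemma codim_ex p : C p -> exists c, (0 < c)%N /\ codim C p c.
Proof. by move=> Cp; have [c [c0 [H _]]] := codim_comp Cp (conn_comp_refl Cp); exists c. Qed.

Lemma prox_lin q v w a b : C q -> proximal C q v -> proximal C q w ->
  proximal C q (vadd (vscal a v) (vscal b w)).
Proof.
move=> Cq; have [c [_ [d [m [K [F [DF Z]]]]]]] := codim_ex Cq.
have qd : vdist q q < d / 2 by rewrite vdist_xx; have := zc_d Z; lra.
move=> /(zc_proximal Z v qd Cq) [x ->] /(zc_proximal Z w qd Cq) [y ->].
apply/(zc_proximal Z _ qd Cq); exists (vadd (vscal a x) (vscal b y)).
by rewrite comb_add !comb_scal.
Qed.

Lemma prox_scal q v a : C q -> proximal C q v -> proximal C q (vscal a v).
Proof.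
move=> Cq pv; have := prox_lin a 0 Cq pv pv; congr proximal.
by vec_ring.
Qed.

(** [e] depends neither on [q] nor on the direction [w]. In particular, taking for [z] a point of
    the line itself, no critical point other than [q] lies on a normal line at [q] within distance
    [e]. *)
Lemma prox_unif p : C p -> exists e, 0 < e /\ forall q w s z, vdist q p < e -> C q ->
  proximal C q w -> C z -> Rabs s * vnorm w <= e -> Rabs s * vnorm w <= vdist z (pt q s w).
Proof.
move=> Cp; have [c [_ [d [m [K [F [DF Z]]]]]]] := codim_ex Cp.
have [e [e0 [ed He]]] := zc_ball Z.
exists e; split=> // q w s z qp Cq.
have qd : vdist q p < d / 2 by have := zc_d Z; lra.
by move=> /(zc_proximal Z w qd Cq) [a ->]; exact: He.
Qed.

Lemma prox_ex p : C p -> exists v, proximal C p v /\ vnorm v = 1.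
Proof.
move=> Cp; have [c [c0 [d [m [K [F [DF Z]]]]]]] := codim_ex Cp.
case: c c0 F DF Z => [//|c] _ F DF Z.
have pd : vdist p p < d / 2 by rewrite vdist_xx; have := zc_d Z; lra.
have pd' : vdist p p < d by rewrite vdist_xx; exact: zc_d Z.
have := zc_ind Z pd' (basis ord0); rewrite basis_unit => H; have m0 := zc_m Z.
exists (unitize (comb (basis ord0) (fun j => DF j p))); split; last by apply: unitize_norm; lra.
by apply: prox_scal => //; apply/(zc_proximal Z _ pd Cp); eexists.
Qed.

(** The proximal normals at [p] are the span of [c] independent gradients, which contains two
    orthonormal vectors exactly if c > 1. *)
Lemma focal_codim p c : C p -> codim C p c -> focal C p <-> (1 < c)%N.
Proof.
move=> Cp [d [m [K [F [DF Z]]]]].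
have pd : vdist p p < d / 2 by rewrite vdist_xx; have := zc_d Z; lra.
have pd' : vdist p p < d by rewrite vdist_xx; exact: zc_d Z.
have m0 := zc_m Z.
split=> [[v [w [/(zc_proximal Z v pd Cp) [a ->] [/(zc_proximal Z w pd Cp) [b ->] [v1 [w1 vw]]]]]]|c1].
  case: c F DF Z a b v1 w1 vw => [|[|//]] F DF Z a b v1 w1 vw.
    have E x : comb x (fun j => DF j p) = vzero.
      by apply: functional_extensionality => i; rewrite /comb big_ord0.
    by move: v1; rewrite E vnorm0; lra.
  have E x : comb x (fun j => DF j p) = vscal (x ord0) (DF ord0 p).
    by apply: functional_extensionality => i; rewrite /comb big_ord_recl big_ord0 /vscal Rplus_0_r.
  move: v1 w1 vw; rewrite !E !vnormZ dotZl dotZr -/(nrm2 _) -vnorm_sqr => v1 w1 vw.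
  move: (Rabs_pos (a ord0)) (Rabs_pos (b ord0)) (vnorm_ge0 (DF ord0 p)) => a0 b0 g0.
  have : Rabs (a ord0 * (b ord0 * (vnorm (DF ord0 p) * vnorm (DF ord0 p)))) = 0 by rewrite vw Rabs_R0.
  rewrite !Rabs_mult (Rabs_right (vnorm _)) ?v1; last exact: Rle_ge.
  by move=> E2; move: w1; nra.
pose j0 : 'I_c := Ordinal (ltnW c1 : (0 < c)%N); pose j1 : 'I_c := Ordinal c1.
have nz (t : R) : vadd (basis j1) (vscal t (basis j0)) <> vzero.
  by move=> /(f_equal (fun v => v j1)); rewrite /vadd /vscal /basis /vzero eqxx /=; lra.
have cpos (a : vec c) : a <> vzero -> 0 < vnorm (comb a (fun j => DF j p)).
  move=> an; have := zc_ind Z pd' a; have a0 := vnorm_ge0 a.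
  by case: (Rle_lt_or_eq_dec _ _ a0) => [|/esym /vnorm_eq0 //]; nra.
have b0 : 0 < vnorm (comb (basis j0) (fun j => DF j p)).
  by apply: cpos => /(f_equal (fun v => v j0)); rewrite /basis /vzero eqxx; lra.
set g0 := comb _ _ in b0; set v := unitize g0; set w := comb (basis j1) (fun j => DF j p).
have v1 : vnorm v = 1 by exact: unitize_norm.
have [|w0 vw] := @gram_schmidt n v w v1.
  move=> E; have := cpos _ (nz (- (dot w v / vnorm g0))).
  rewrite comb_add comb_scal -/w -/g0 {1}E.
  rewrite (_ : vadd _ _ = vzero) ?vnorm0; first lra.
  apply: functional_extensionality => i; rewrite /v /unitize /vadd /vscal /vzero; field; lra.
have pv : proximal C p v by apply: prox_scal => //; apply/(zc_proximal Z _ pd Cp); eexists.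
have pw : proximal C p w by apply/(zc_proximal Z _ pd Cp); eexists.
exists v, (unitize (vsub w (vscal (dot w v) v))); split=> //; split; last first.
  by split=> //; split=> //; exact: unitize_norm.
apply: prox_scal => //.
have := prox_lin 1 (- dot w v) Cp pw pv; congr proximal.
by vec_ring.
Qed.

Lemma focal_conn p q : C p -> conn_comp C p q -> focal C p -> focal C q.
Proof.
move=> Cp pq; have [c [_ [cp cq]]] := codim_comp Cp pq.
by move/(focal_codim Cp cp) => c1; apply/(focal_codim (conn_comp_sub pq) cq).
Qed.

Lemma nonfocal_chart p : C p -> ~ focal C p -> exists e F DF, 0 < e /\
  (forall y, vdist y p < e -> (C y <-> F y = 0)) /\
  (forall y : vec n, has_grad F y (DF y)) /\
  (forall q, vdist q p < e -> C q -> 0 < vnorm (DF q) /\ proximal C q (DF q)).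
Proof.
move=> Cp nf; have [c [c0 cc]] := codim_ex Cp.
case: c c0 cc => [//|[|c]] c0 cc; last by case: nf; apply/(focal_codim Cp cc).
case: cc => d [m [K [F [DF Z]]]].
have d0 := zc_d Z; have m0 := zc_m Z.
exists (d / 2), (F ord0), (DF ord0); split; first lra.
split=> [y yd|].
  rewrite (zc_zero Z (_ : vdist y p < d)); last lra.
  by split=> [|E j]; [apply|rewrite ord1].
split=> [y|q qd Cq]; first exact: (zc_grad Z).
have E : comb (basis ord0) (fun j => DF j q) = DF ord0 q by exact: (comb_basis ord0 (fun j => DF j q)).
split; last by apply/(zc_proximal Z _ qd Cq); exists (basis ord0).
have := zc_ind Z (_ : vdist q p < d) (basis ord0); rewrite E => /(_ ltac:(lra)) H.
by rewrite basis_unit in H; lra.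
Qed.

Lemma crit_no_interior p r : C p -> 0 < r -> exists y, vdist y p < r /\ ~ C y.
Proof.
move=> Cp r0; have [v [pv v1]] := prox_ex Cp.
have [e [e0 He]] := prox_unif Cp.
have m0 : 0 < Rmin r e by exact: Rmin_glb_lt.
pose s := Rmin r e / 2.
have sr : s < r by have := Rmin_l r e; rewrite /s; lra.
have se : s < e by have := Rmin_r r e; rewrite /s; lra.
have s0 : 0 < s by rewrite /s; lra.
exists (pt p s v); split; first by rewrite vdist_pt0 v1 Rabs_right; lra.
move=> Cy; have := He p v s _ _ Cp pv Cy; rewrite !vdist_xx v1 Rabs_right; last lra.
by move=> /(_ e0 ltac:(lra)); lra.
Qed.

End Critical.

(** A form of [real_ind] in which both steps may use the property at all earlier points and not just
    at one. *)
Lemma real_ind_closed_open (Q : R -> Prop) (B : R) : Q 0 ->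
  (forall b, 0 < b <= B -> (forall c, 0 <= c < b -> Q c) -> Q b) ->
  (forall b, 0 <= b < B -> (forall c, 0 <= c <= b -> Q c) ->
     exists eps, 0 < eps /\ forall c, b < c < b + eps -> c <= B -> Q c) ->
  forall b, 0 <= b <= B -> Q b.
Proof.
move=> Q0 cl op b bB.
suff: forall c, 0 <= c <= b -> Q c by apply; lra.
apply: (@real_ind (fun b => forall c, 0 <= c <= b -> Q c)); first lra.
  by move=> c c0; have -> : c = 0 by lra.
move=> a ab.
have [below|nb] := classic (forall c, 0 <= c < a -> Q c); last first.
  have [c [ca nQ]] : exists c, 0 <= c < a /\ ~ Q c.
    by apply: NNPP => N; apply: nb => c ca; apply: NNPP => nQ; apply: N; exists c.
  exists (a - c); split; first lra.
  by move=> b0 _ b0a Hb0; case: nQ; apply: Hb0; lra.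
have upto c : 0 <= c <= a -> Q c.
  move=> ca; case: (Req_dec c 0) => [->//|c0].
  by case: (Req_dec c a) => [E|ne]; [rewrite E; apply: cl => //; lra|apply: below; lra].
case: (Rle_lt_dec B a) => aB.
  by exists 1; split; [lra|move=> _ _ _ _ b1 ? ? c cb1; apply: upto; lra].
have [eps [eps0 He]] := op a ltac:(lra) upto.
exists eps; split=> // _ _ _ _ b1 b1a b1b c cb1.
by case: (Rle_dec c a) => ca; [apply: upto; lra|apply: He; lra].
Qed.

(** Subdivision into m+1 equal pieces divides the quadratic bound for the total variation by m+1. *)
Lemma const_of_quad (h : R -> R) K a b : a <= b ->
  (forall x y, a <= x <= b -> a <= y <= b -> Rabs (h x - h y) <= K * ((x - y) * (x - y))) ->
  h b = h a.
Proof.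
move=> ab H.
have key (m : nat) : Rabs (h b - h a) <= K * ((b - a) * (b - a)) * / INR m.+1.
  have m0 : 0 < INR m.+1 by apply: lt_0_INR; lia.
  pose d := (b - a) / INR m.+1.
  have d0 : 0 <= d by apply: Rdiv_le_0_compat; lra.
  have dE : INR m.+1 * d = b - a by rewrite /d; field; lra.
  have step (k : nat) : (k <= m.+1)%N -> Rabs (h (a + INR k * d) - h a) <= INR k * (K * (d * d)).
    elim: k => [|k IH] km.
      by rewrite Rmult_0_l Rplus_0_r Rminus_diag Rabs_R0 Rmult_0_l; lra.
    have {}IH := IH (ltnW km).
    have k0 := pos_INR k.
    have kd : INR k.+1 * d <= b - a.
      by rewrite -dE; apply: Rmult_le_compat_r => //; apply: le_INR; apply/leP.
    rewrite S_INR in kd *.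
    have := H (a + (INR k + 1) * d) (a + INR k * d) ltac:(nra) ltac:(nra).
    rewrite (_ : a + (INR k + 1) * d - (a + INR k * d) = d); last ring.
    move=> H1; have := Rabs_triang (h (a + (INR k + 1) * d) - h (a + INR k * d)) (h (a + INR k * d) - h a).
    rewrite (_ : _ - _ + (_ - _) = h (a + (INR k + 1) * d) - h a); last ring.
    lra.
  have := step m.+1 (leqnn _); rewrite dE (_ : a + (b - a) = b); last ring.
  move=> H1; apply: Rle_trans H1 _; apply: Req_le; rewrite /d; field; lra.
have : Rabs (h b - h a) <= 0.
  apply: le_epsilon => eps eps0; rewrite Rplus_0_l.
  have K0 : 0 <= Rabs (K * ((b - a) * (b - a))) by exact: Rabs_pos.
  have [m [Hm m0]] := archimed_cor1 (eps / (Rabs (K * ((b - a) * (b - a))) + 1)) ltac:(apply: Rdiv_lt_0_compat; lra).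
  have m1 : 0 < INR m by apply: lt_0_INR.
  have i1 : / INR m.+1 <= / INR m by apply: Rinv_le_contravar => //; apply: le_INR; lia.
  have i0 : 0 < / INR m.+1 by apply: Rinv_0_lt_compat; apply: lt_0_INR; lia.
  apply: Rle_trans (key m) _.
  have := Rle_abs (K * ((b - a) * (b - a))).
  have E : eps / (Rabs (K * ((b - a) * (b - a))) + 1) * (Rabs (K * ((b - a) * (b - a))) + 1) = eps by field; lra.
  nra.
have := Rle_abs (h b - h a); have := Rle_abs (- (h b - h a)); rewrite Rabs_Ropp; lra.
Qed.

Lemma abs_sin_le x : Rabs (sin x) <= Rabs x.
Proof.
have pos y : 0 <= y -> Rabs (sin y) <= y.
  move=> y0; have [y1|y1] := Rle_dec y PI; last first.
    by have := PI2_1; have := SIN_bound y => *; apply: Rabs_le; lra.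
  have s0 := sin_ge_0 y y0 y1; rewrite Rabs_right; last lra.
  by case: (Rle_lt_or_eq_dec _ _ y0) => [/sin_lt_x|<-]; [lra|rewrite sin_0; lra].
case: (Rle_dec 0 x) => H; first by rewrite (Rabs_right x); [exact: pos|lra].
have := pos (- x) ltac:(lra); rewrite sin_neg Rabs_Ropp (Rabs_left x); lra.
Qed.

Lemma one_minus_cos x : 2 * (1 - cos x) <= x * x.
Proof.
have := cos_2a_sin (x / 2); rewrite (_ : 2 * (x / 2) = x); last field.
move=> ->; have := abs_sin_le (x / 2).
have := abs_sqr (sin (x / 2)); have := abs_sqr (x / 2); have := Rabs_pos (sin (x / 2)); nra.
Qed.

(** * Circles in a plane and orthonormal families *)

Section Frames.
Context {n : nat}.

Definition circ (v w : vec n) (th : R) : vec n := vadd (vscal (cos th) v) (vscal (sin th) w).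

Lemma circ0 v w : circ v w 0 = v.
Proof. by apply: functional_extensionality => i; rewrite /circ cos_0 sin_0 /vadd /vscal; ring. Qed.

Lemma circPI v w : circ v w PI = vscal (-1) v.
Proof. by apply: functional_extensionality => i; rewrite /circ cos_PI sin_PI /vadd /vscal; ring. Qed.

Lemma circ_dot v w a b : vnorm v = 1 -> vnorm w = 1 -> dot v w = 0 ->
  dot (circ v w a) (circ v w b) = cos (a - b).
Proof.
move=> v1 w1 vw; rewrite /circ !dotE (dotC w v) vw -!/(nrm2 v) -!/(nrm2 w) -!vnorm_sqr v1 w1 cos_minus; ring.
Qed.

Lemma circ_unit v w a : vnorm v = 1 -> vnorm w = 1 -> dot v w = 0 -> vnorm (circ v w a) = 1.
Proof.
move=> v1 w1 vw; rewrite /vnorm /nrm2 circ_dot // (_ : a - a = 0); last ring.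
by rewrite cos_0 sqrt_1.
Qed.

Lemma circ_dist v w a b : vnorm v = 1 -> vnorm w = 1 -> dot v w = 0 ->
  vdist (circ v w a) (circ v w b) <= Rabs (a - b).
Proof.
move=> v1 w1 vw; apply: sqr_le_le; first exact: Rabs_pos.
rewrite abs_sqr vdist_sqr /nrm2 !dotBl !dotBr !circ_dot //.
rewrite !(_ : forall c, c - c = 0) ?cos_0; try by move=> *; ring.
rewrite (cos_sym (b - a)) (_ : - (b - a) = a - b); last ring.
have := one_minus_cos (a - b); lra.
Qed.

Lemma circ_path v w (p : vec n) t k : vnorm v = 1 -> vnorm w = 1 -> dot v w = 0 ->
  path_cont (fun s => pt p t (circ v w (k * s))).
Proof.
move=> v1 w1 vw s _ eps eps0.
have tk : 0 <= Rabs t * Rabs k by apply: Rmult_le_pos; exact: Rabs_pos.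
exists (eps / (Rabs t * Rabs k + 1)); split; first by apply: Rdiv_lt_0_compat; lra.
move=> s' _ ss; apply: Rle_lt_trans (vdist_pt_pt _ _ _ _ _ _) _.
rewrite vdist_xx Rminus_diag Rabs_R0.
have := circ_dist (k * s') (k * s) v1 w1 vw; rewrite -Rmult_minus_distr_l Rabs_mult => H.
have : Rabs t * vdist (circ v w (k * s')) (circ v w (k * s)) <= Rabs t * (Rabs k * Rabs (s' - s)).
  by apply: Rmult_le_compat_l => //; exact: Rabs_pos.
have : Rabs (s' - s) * (Rabs t * Rabs k + 1) < eps.
  by move: ss => /(Rmult_lt_compat_r (Rabs t * Rabs k + 1)); rewrite /Rdiv Rmult_assoc Rinv_l; lra.
have := Rabs_pos (s' - s); nra.
Qed.

Lemma bessel k (e : 'I_k -> vec n) (x : vec n) : orthonormal e ->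
  \big[Rplus/0]_(i < k) (dot x (e i) * dot x (e i)) <= nrm2 x.
Proof.
move=> on; pose a : vec k := fun i => dot x (e i).
have E1 : dot (comb a e) x = \big[Rplus/0]_(i < k) (a i * a i).
  by rewrite dot_comb; apply: eq_bigr => i _; rewrite dotC.
have E2 : dot (comb a e) (comb a e) = \big[Rplus/0]_(i < k) (a i * a i).
  rewrite dot_comb; apply: eq_bigr => i _; rewrite dotC dot_comb (bigD1 i) //= on eqxx big1; first by ring.
  by move=> j /negbTE ji; rewrite on ji; ring.
have := nrm2_ge0 (vsub x (comb a e)); rewrite /nrm2 !dotBl !dotBr E2 (dotC x) E1 -/(nrm2 x).
rewrite /a; lra.
Qed.

(** The squares of all coordinates of all [e i] add up to [k]; summed coordinate by coordinate, each
    of the [n] parts is at most 1 by [bessel] for a basis vector. *)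
Lemma orthonormal_card k (e : 'I_k -> vec n) : orthonormal e -> (k <= n)%N.
Proof.
move=> on; apply/leP; apply: INR_le.
have -> : INR k = \big[Rplus/0]_(i < k) \big[Rplus/0]_(c < n) (e i c * e i c).
  rewrite -[INR k]Rmult_1_r -sumR_const; apply: eq_bigr => i _.
  by rewrite -/(dot (e i) (e i)) on eqxx.
rewrite exchange_big /= -[INR n]Rmult_1_r -sumR_const; apply: sumR_le => c.
have := bessel (basis c) on; rewrite -vnorm_sqr basis_unit Rmult_1_r; apply: Rle_trans.
by apply/Req_le/eq_bigr => i _; rewrite dot_basis.
Qed.

End Frames.

(** * Normal lines and focal points *)

Section Lines.
Context {n : nat} (C : vec n -> Prop) (N : vec n -> vec n).
Hypothesis n0 : (0 < n)%N.
Hypothesis Cclosed : closed_set C.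
Hypothesis comps : forall x, C x ->
  (forall y, conn_comp C x y <-> (forall i, y i = x i)) \/ reg_surface (conn_comp C x).
Hypothesis isolated : forall x, C x -> exists r, 0 < r /\
  forall y, C y -> nrm2 (vsub y x) < r * r -> conn_comp C x y.
Hypothesis Nunit : forall x, ~ C x -> vnorm (N x) = 1.
Hypothesis Nloc : forall x, ~ C x -> exists r, 0 < r /\ forall y t, vdist y x < r -> Rabs t < r ->
  ~ C y /\ ~ C (pt y t (N y)) /\ N (pt y t (N y)) = N y.
Hypothesis Nnear : forall x p, ~ C x -> C p -> (forall q, C q -> vdist x p <= vdist x q) ->
  p = pt x (vdist x p) (N x) \/ p = pt x (- vdist x p) (N x).

(* The direction of a normal line through z, also at critical points. *)
Definition dir (z v : vec n) : Prop :=
  vnorm v = 1 /\ (~ C z -> v = N z \/ v = vscal (-1) (N z)) /\ (C z -> proximal C z v).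

Lemma dir_opp z v : dir z v -> dir z (vscal (-1) v).
Proof.
move=> [v1 [vU vC]]; split; first by rewrite vnormN.
split=> [/vU [->|->]|Cz]; [by right|by left; rewrite vscalN1K|].
by apply: (prox_scal n0) => //; exact: vC.
Qed.

Lemma dir_N z v : ~ C z -> dir z v -> v = N z \/ N z = vscal (-1) v.
Proof. by move=> nC [_ [/(_ nC) [->|->] _]]; [left|right; rewrite vscalN1K]. Qed.

Lemma dir_exists z : exists v, dir z v.
Proof.
have [Cz|nC] := classic (C z).
  by have [v [pv v1]] := prox_ex n0 comps isolated Cz; exists v; split.
by exists (N z); split; [exact: Nunit|split=> // _; left].
Qed.

Lemma near_dir x v p : ~ C x -> dir x v -> C p -> (forall q, C q -> vdist x p <= vdist x q) ->
  p = pt x (vdist x p) v \/ p = pt x (- vdist x p) v.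
Proof.
move=> nC dv Cp Hp; have := Nnear nC Cp Hp; set d := vdist x p.
case: (dir_N nC dv) => [<-//|->]; rewrite !pt_scal.
rewrite (_ : d * -1 = - d); last ring.
by rewrite (_ : - d * -1 = d); [case=> ?; [right|left]|ring].
Qed.

Lemma prox_of_near x p v t : C p -> (forall q, C q -> vdist x p <= vdist x q) ->
  vnorm v = 1 -> t <> 0 -> x = pt p t v -> proximal C p v.
Proof.
move=> Cp Hp v1 t0 xE.
have xp : vdist x p = Rabs t by rewrite xE vdist_pt0 v1; ring.
have [tp|tn] : 0 < t \/ t < 0 by lra.
  exists t; split=> // z Cz; have := Hp z Cz; rewrite xp -xE v1 vdistC Rabs_right; lra.
have : proximal C p (vscal (-1) v).
  exists (- t); split=> [|z Cz]; first lra.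
  have := Hp z Cz; rewrite xp pt_scal (_ : - t * -1 = t); last ring.
  by rewrite -xE vnormN v1 vdistC Rabs_left; lra.
by move=> /(prox_scal n0 comps isolated (-1) Cp); rewrite vscalN1K.
Qed.

(** The interesting case is a critical point [y] on the line. Arriving there, [v] is shown to be a
    proximal normal of [y]; leaving it, the balls of [prox_unif] make [y] the nearest critical point
    of the points just beyond, and [Nnear] returns [v] up to sign. *)
Lemma dir_line_pos z v t : 0 <= t -> dir z v -> dir (pt z t v) v.
Proof.
move=> t0 dz; have v1 := proj1 dz.
apply: (@real_ind (fun t => dir (pt z t v) v)) => //; first by rewrite pt0.
move=> b bt; set y := pt z b v.
have yb s : pt z s v = pt y (s - b) v by rewrite /y pt_pt; congr pt; ring.
have [Cy|nCy] := classic (C y); last first.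
  have [r [r0 Hr]] := Nloc nCy.
  exists (r / 2); split; first lra.
  move=> b0 b00 b0b d0 b1 b1b b1t.
  have y0r : vdist (pt z b0 v) y < r by rewrite vdist_pt v1 Rabs_left1; lra.
  have r1 : Rabs (b1 - b0) < r by rewrite Rabs_right; lra.
  have r2 : Rabs (- (b1 - b0)) < r by rewrite Rabs_Ropp.
  have [nC0 [nC1 N1]] := Hr _ _ y0r r1; have [_ [nC2 N2]] := Hr _ _ y0r r2.
  split=> //; case: (dir_N nC0 d0) => E.
    rewrite -E pt_pt (_ : b0 + (b1 - b0) = b1) in nC1 N1; last ring.
    by split=> // _; left; rewrite N1.
  rewrite E pt_scal pt_pt (_ : b0 + - (b1 - b0) * -1 = b1) in nC2 N2; last ring.
  by split=> // _; right; rewrite N2 vscalN1K.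
have [e [e0 He]] := prox_unif n0 comps isolated Cy.
have free q s : vdist q y < e -> C q -> proximal C q v -> s <> 0 -> Rabs s <= e -> ~ C (pt q s v).
  move=> qy Cq pq s0 se Cs; have := He q v s _ qy Cq pq Cs.
  by rewrite v1 vdist_xx Rmult_1_r => /(_ se); have := Rabs_pos_lt s s0; lra.
(* The critical point [p] nearest to [y0] lies on the line and has [v] as a normal. It is less than
   2e/3 away from [y], so by [free] it cannot differ from [y]. *)
have prox_y b0 : b - e / 3 < b0 <= b -> dir (pt z b0 v) v -> proximal C y v.
  move=> b0b d0; case: (Req_dec b0 b) => [E|ne]; first by move: d0; rewrite E; case=> _ [_ H]; exact: H.
  set y0 := pt z b0 v in d0.
  have y0y : vdist y0 y = b - b0 by rewrite vdist_pt v1 Rabs_left; lra.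
  have yE : y = pt y0 (b - b0) v by rewrite /y0 pt_pt; congr pt; ring.
  have nC0 : ~ C y0.
    move=> C0; apply: (free y0 (b - b0)) => //; [lra|exact: (proj2 (proj2 d0))|lra| |by rewrite -yE].
    by rewrite Rabs_right; lra.
  have [p [Cp Hp]] := nearest y0 Cclosed (ex_intro _ y Cy).
  have pd := Hp y Cy; rewrite y0y in pd.
  have pos : 0 < vdist y0 p.
    case: (Rle_lt_or_eq_dec _ _ (vdist_ge0 y0 p)) => // /esym /vdist_eq0 E.
    by case: nC0; rewrite E.
  have [c [cE cb]] : exists c, p = pt z c v /\ (c = b0 + vdist y0 p \/ c = b0 - vdist y0 p).
    have [E|E] := near_dir nC0 d0 Cp Hp.
      by exists (b0 + vdist y0 p); split; [rewrite {1}E /y0 pt_pt|left].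
    by exists (b0 - vdist y0 p); split; [rewrite {1}E /y0 pt_pt|right].
  have pp : proximal C p v.
    apply: (@prox_of_near y0 p v (b0 - c)) => //; first by case: cb; lra.
    by rewrite cE pt_pt; congr pt; ring.
  case: (Req_dec c b) => [E|cne]; first by move: pp; rewrite cE E.
  exfalso; apply: (free p (b - c)) => //; last 3 first.
  - by lra.
  - by apply: Rabs_le; case: cb; lra.
  - by rewrite cE pt_pt (_ : c + (b - c) = b) //; ring.
  by rewrite cE vdist_pt v1; have : Rabs (c - b) < e; [apply: Rabs_def1; case: cb; lra|lra].
exists (e / 3); split; first lra.
move=> b0 b00 b0b /(prox_y _ b0b) py b1 b1b b1t.
case: (Req_dec b1 b) => [->|ne].
  by split=> //; split.
have yy : vdist y y < e by rewrite vdist_xx.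
have nC1 : ~ C (pt z b1 v).
  by rewrite yb; apply: free => //; [lra|rewrite Rabs_right; lra].
split=> //; split=> // _.
have d1 : vdist (pt z b1 v) y = b1 - b by rewrite vdist_pt v1 Rabs_right; lra.
have Hy q : C q -> vdist (pt z b1 v) y <= vdist (pt z b1 v) q.
  move=> Cq; have := He y v (b1 - b) q yy Cy py Cq; rewrite v1 -yb vdistC Rabs_right; lra.
have [|] := Nnear nC1 Cy Hy; rewrite d1; move: (N _) (Nunit nC1) => w w1 E.
  right; have {}E : vscal (b - b1) v = vscal (b1 - b) w.
    by rewrite -(pt_sub z) -/y {1}E ptK.
  apply: functional_extensionality => i; have := f_equal (fun u => u i) E; rewrite /vscal => Ei.
  by apply: (Rmult_eq_reg_l (b1 - b)); lra.
left; have {}E : vscal (b - b1) v = vscal (- (b1 - b)) w.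
  by rewrite -(pt_sub z) -/y {1}E ptK.
apply: functional_extensionality => i; have := f_equal (fun u => u i) E; rewrite /vscal => Ei.
by apply: (Rmult_eq_reg_l (b1 - b)); lra.
Qed.

Lemma dir_line z v t : dir z v -> dir (pt z t v) v.
Proof.
move=> dz; case: (Rle_dec 0 t) => [t0|t0]; first exact: dir_line_pos.
have := @dir_line_pos z (vscal (-1) v) (- t) ltac:(lra) (dir_opp dz).
by rewrite pt_scal (_ : - t * -1 = t); [move/dir_opp; rewrite vscalN1K|ring].
Qed.

Lemma dir_prox z v : C z -> dir z v -> proximal C z v.
Proof. by move=> Cz [_ [_ H]]; exact: H. Qed.

Lemma prox_dir z v : C z -> proximal C z v -> vnorm v = 1 -> dir z v.
Proof. by move=> Cz pz v1; split. Qed.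

Lemma line_discrete z v : dir z v -> C z -> exists e, 0 < e /\ forall t, 0 < Rabs t <= e -> ~ C (pt z t v).
Proof.
move=> dz Cz; have [e [e0 He]] := prox_unif n0 comps isolated Cz.
exists e; split=> // t te Ct.
have := He z v t _ _ Cz (dir_prox Cz dz) Ct; rewrite !vdist_xx (proj1 dz) Rmult_1_r.
by move=> /(_ e0 ltac:(lra)); lra.
Qed.

(** * Rotating a normal line about a critical point *)

Section Circle.
Variables (p v w : vec n).
Hypothesis Cp : C p.
Hypothesis pv : proximal C p v.
Hypothesis pw : proximal C p w.
Hypothesis v1 : vnorm v = 1.
Hypothesis w1 : vnorm w = 1.
Hypothesis vw : dot v w = 0.
Let cv := circ v w.

Lemma circ_dir th t : dir (pt p t (cv th)) (cv th).
Proof.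
by apply: dir_line; apply: prox_dir => //; [exact: (prox_lin n0)|exact: circ_unit].
Qed.

Lemma cv1 th : vnorm (cv th) = 1. Proof. exact: circ_unit. Qed.

Lemma circ_pt_dist t th t' th' :
  vdist (pt p t (cv th)) (pt p t' (cv th')) <= Rabs t * Rabs (th - th') + Rabs (t - t').
Proof.
apply: Rle_trans (vdist_pt_pt _ _ _ _ _ _) _; rewrite vdist_xx cv1.
have := circ_dist th th' v1 w1 vw; rewrite -/(cv th) -/(cv th') => H.
by have := Rmult_le_compat_l _ _ _ (Rabs_pos t) H; lra.
Qed.

(* The distance g to C from p + t cv(th), t < T, equals |q - p| - t for the next critical point q on the ray, and comparing with neighbouring rays shows that g varies at most quadratically in th, hence is constant. *)
Lemma circle_step A B t' T th0 th1 : 0 <= t' -> t' < T ->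
  A <= th0 <= B -> A <= th1 <= B ->
  (forall th s, A <= th <= B -> t' < s < T -> ~ C (pt p s (cv th))) ->
  C (pt p T (cv th0)) -> C (pt p T (cv th1)).
Proof.
move=> t'0 t'T th0B th1B free CT.
have /choice [pi Hpi] := fun x => nearest x Cclosed (ex_intro _ p Cp).
(* The observation point lies at distance [a] below [T] and 2a above [t']. As long as g < 2a, the
   critical point nearest to it cannot lie backwards on the ray, and forwards it cannot be closer
   than [a]; so [a] is the least possible value of [g]. *)
pose a := (T - t') / 3; pose t := (t' + 2 * T) / 3.
have a0 : 0 < a by rewrite /a; lra.
have tT : T - t = a by rewrite /a /t; field.
have tt' : t - t' = 2 * a by rewrite /a /t; field.
have t0 : 0 < t by lra.
pose x th := pt p t (cv th); pose g th := vdist (x th) (pi (x th)).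
have nCx th : A <= th <= B -> ~ C (x th) by move=> ?; apply: free => //; lra.
have next th : A <= th <= B -> g th < 2 * a -> C (pt p (t + g th) (cv th)) /\ a <= g th.
  move=> thB ga; have [Cq Hq] := Hpi (x th).
  have g0 : 0 <= g th by exact: vdist_ge0.
  have [E|E] := near_dir (nCx th thB) (circ_dir th t) Cq Hq.
    rewrite -/(g th) /x pt_pt in E; rewrite E in Cq; split=> //.
    by apply: Rnot_lt_le => ga'; apply: (free th (t + g th)) => //; lra.
  rewrite -/(g th) /x pt_pt in E; rewrite E in Cq.
  by exfalso; apply: (free th (t + - g th)) => //; lra.
(* Law of cosines: the critical point on the ray [th'] is a competitor for the distance from the ray
   [th]. *)
have quad th th' : A <= th <= B -> A <= th' <= B -> g th < 2 * a -> g th' < 2 * a ->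
    g th - g th' <= t * (t + 2 * a) / (2 * a) * ((th - th') * (th - th')).
  move=> thB th'B gth gth'; have [_ ga] := next th thB gth; have [Cq' ga'] := next th' th'B gth'.
  have := proj2 (Hpi (x th)) _ Cq'; rewrite -/(g th) => H.
  have {}H : g th * g th <= vdist (x th) (pt p (t + g th') (cv th')) * vdist (x th) (pt p (t + g th') (cv th')) by nra.
  have E : vsub (x th) (pt p (t + g th') (cv th')) = vsub (vscal t (cv th)) (vscal (t + g th') (cv th')).
    by apply: functional_extensionality => i; rewrite /x /pt /vadd /vsub /vscal; ring.
  rewrite vdist_sqr E /nrm2 !(dotBl, dotBr, dotZl, dotZr) !circ_dot // in H.
  rewrite !(_ : forall c, c - c = 0) ?cos_0 in H; try by move=> *; ring.
  rewrite (cos_sym (th' - th)) (_ : - (th' - th) = th - th') in H; last ring.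
  have oc := one_minus_cos (th - th').
  set D := (th - th') * (th - th') in oc *; have D0 : 0 <= D by exact: Rle_0_sqr.
  have H1 : (g th - g th') * (g th + g th') <= t * (t + 2 * a) * D.
    apply: (@Rle_trans _ (t * (t + g th') * (2 * (1 - cos (th - th'))))); first lra.
    apply: (@Rle_trans _ (t * (t + g th') * D)); first by apply: Rmult_le_compat_l => //; nra.
    by apply: Rmult_le_compat_r => //; apply: Rmult_le_compat_l; lra.
  case: (Rle_dec (g th - g th') 0) => s.
    apply: (@Rle_trans _ 0) => //; apply: Rmult_le_pos => //.
    by apply: Rdiv_le_0_compat; nra.
  apply: (Rmult_le_reg_r (2 * a)); first lra.
  rewrite (_ : t * (t + 2 * a) / (2 * a) * D * (2 * a) = t * (t + 2 * a) * D); last by field; lra.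
  apply: Rle_trans H1; apply: Rmult_le_compat_l; lra.
have lip th th' : g th <= g th' + t * Rabs (th - th').
  have := proj2 (Hpi (x th)) _ (proj1 (Hpi (x th'))); rewrite -/(g th) => H.
  have := vdist_tri (x th) (x th') (pi (x th')); rewrite -/(g th').
  have := circ_pt_dist t th t th'; rewrite Rminus_diag Rabs_R0 -/(x th) -/(x th') (Rabs_right t); lra.
pose k := th1 - th0.
have k0 := Rabs_pos k.
have inB c : 0 <= c <= 1 -> A <= th0 + k * c <= B by rewrite /k => ?; nra.
have : g (th0 + k * 1) = a.
  apply: (@real_ind (fun b => g (th0 + k * b) = a)); first lra.
    rewrite Rmult_0_r Rplus_0_r.
    have : g th0 <= a.
      have := proj2 (Hpi (x th0)) _ CT; rewrite -/(g th0) /x vdist_pt cv1 Rabs_left; lra.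
    by move=> ga; have [_] := next th0 th0B ltac:(lra); lra.
  move=> b b01; pose eps := a / (2 * (t * Rabs k + 1)).
  have tk : 0 <= t * Rabs k by nra.
  have eps0 : 0 < eps by apply: Rdiv_lt_0_compat; lra.
  have epsE : (t * Rabs k + 1) * (2 * eps) = a by rewrite /eps; field; lra.
  exists eps; split=> // b0 b00 b0b gb0 b1 b1b b11.
  have small c : b0 <= c <= b1 -> g (th0 + k * c) < 2 * a.
    move=> cb; have := lip (th0 + k * c) (th0 + k * b0); rewrite gb0.
    rewrite (_ : th0 + k * c - _ = k * (c - b0)); last ring.
    rewrite Rabs_mult (Rabs_right (c - b0)); last lra.
    nra.
  rewrite -gb0; apply: (@const_of_quad (fun c => g (th0 + k * c)) (t * (t + 2 * a) / (2 * a) * (k * k))); first lra.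
  move=> c c' cb c'b; have gc := small c cb; have gc' := small c' c'b.
  have cB := inB c ltac:(lra); have c'B := inB c' ltac:(lra).
  have E : t * (t + 2 * a) / (2 * a) * ((th0 + k * c - (th0 + k * c')) * (th0 + k * c - (th0 + k * c'))) =
     t * (t + 2 * a) / (2 * a) * (k * k) * ((c - c') * (c - c')) by ring.
  have E' : t * (t + 2 * a) / (2 * a) * ((th0 + k * c' - (th0 + k * c)) * (th0 + k * c' - (th0 + k * c))) =
     t * (t + 2 * a) / (2 * a) * (k * k) * ((c - c') * (c - c')) by ring.
  have := quad _ _ cB c'B gc gc'; have := quad _ _ c'B cB gc' gc; rewrite E E' => *.
  by apply: Rabs_le; lra.
rewrite /k (_ : th0 + (th1 - th0) * 1 = th1); last ring.
move=> ga; have [] := next th1 th1B ltac:(lra); rewrite ga (_ : t + a = T) //; lra.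
Qed.

(** Induction on the radius. Just below a critical radius one ray is free of critical points by
    [line_discrete], hence all rays are by the induction hypothesis, and [circle_step] applies. Just
    above any radius all rays are free by compactness of the circle, so the claim is vacuous
    there. *)
Lemma circle_all T : 0 <= T -> forall th th', 0 <= th <= 2 * PI -> 0 <= th' <= 2 * PI ->
  C (pt p T (cv th)) -> C (pt p T (cv th')).
Proof.
move=> T0; have PI0 := PI_RGT_0.
apply: (@real_ind_closed_open (fun T => forall th th', 0 <= th <= 2 * PI -> 0 <= th' <= 2 * PI ->
  C (pt p T (cv th)) -> C (pt p T (cv th'))) T _ _ _ T (conj T0 (Rle_refl T))).
- by move=> th th' _ _; rewrite !pt0.
- move=> b b0 below th th' thb th'b Cb.
  have [e [e0 He]] := line_discrete (circ_dir th b) Cb.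
  pose t' := Rmax 0 (b - e).
  have t'0 : 0 <= t' by exact: Rmax_l.
  have t'b : b - e <= t' by exact: Rmax_r.
  have t'lt : t' < b by apply: Rmax_lub_lt; lra.
  apply: (@circle_step 0 (2 * PI) t' b th th') => // th1 s th1b sb Cs.
  have := below s ltac:(lra) th1 th th1b thb Cs.
  have -> : pt p s (cv th) = pt (pt p b (cv th)) (s - b) (cv th) by rewrite pt_pt; congr pt; ring.
  by apply: He; rewrite Rabs_left; lra.
- move=> b bT upto.
  suff [e [e0 He]] : exists e, 0 < e /\ forall th, 0 <= th <= 2 * PI -> forall t, b < t < b + e -> ~ C (pt p t (cv th)).
    by exists e; split=> // c cb _ th th' thb _ Cc; case: (He th thb c cb).
  have loc th : 0 <= th <= 2 * PI -> exists e, 0 < e /\ forall th', 0 <= th' <= 2 * PI -> Rabs (th' - th) < e ->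
      forall t, b < t < b + e -> ~ C (pt p t (cv th')).
    move=> thb; have [Cb|nCb] := classic (C (pt p b (cv th))).
      have [e [e0 He]] := prox_unif n0 comps isolated Cb.
      exists (Rmin e (e / (b + 1))); split; first by apply: Rmin_glb_lt => //; apply: Rdiv_lt_0_compat; lra.
      move=> th' th'b tt t tb Ct.
      have := Rmin_l e (e / (b + 1)) => m1; have t1 := Rlt_minr tt.
      have Cb' := upto b ltac:(lra) th th' thb th'b Cb.
      have := He _ (cv th') (t - b) _ _ Cb' (dir_prox Cb' (circ_dir th' b)) Ct.
      rewrite pt_pt (_ : b + (t - b) = t) ?vdist_xx; last ring.
      rewrite cv1 Rabs_right; last lra.
      move=> H; have := H _ ltac:(lra).
      have := circ_pt_dist b th' b th; rewrite Rminus_diag Rabs_R0 Rabs_right; last lra.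
      have E : e / (b + 1) * (b + 1) = e by field; lra.
      have := Rabs_pos (th' - th) => p0 D Hc.
      have : (t - b) * 1 <= 0 by apply: Hc; nra.
      lra.
    have [r [r0 Hr]] := Cclosed nCb.
    exists (r / (2 * (b + 1))).
    have e0 : 0 < r / (2 * (b + 1)) by apply: Rdiv_lt_0_compat; lra.
    have E : r / (2 * (b + 1)) * (b + 1) = r / 2 by field; lra.
    split=> // th' _ tt t tb; apply: Hr.
    rewrite vdistC; have := circ_pt_dist b th t th'; rewrite (Rabs_minus_sym th) (Rabs_right b); last lra.
    rewrite (Rabs_left (b - t)); last lra.
    move: tt tb E e0; set e := r / _ => tt tb E e0; have := Rabs_pos (th' - th) => p0.
    have : b * Rabs (th' - th) <= b * e by apply: Rmult_le_compat_l; lra.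
    lra.
  (* Real induction over the angle replaces the choice of a finite subcover. *)
  have [||e [e0 He]] := @real_ind (fun c => exists e, 0 < e /\ forall th, 0 <= th <= c -> forall t, b < t < b + e -> ~ C (pt p t (cv th))) (2 * PI) ltac:(lra).
  - have [|e [e0 He]] := loc 0; first lra.
    exists e; split=> // th th0; have -> : th = 0 by lra.
    by apply: He; [lra|rewrite Rminus_diag Rabs_R0].
  - move=> c cb; have [e [e0 He]] := loc c cb.
    exists e; split=> // b0 b00 b0c [e' [e'0 He']] b1 b1c b1B.
    exists (Rmin e e'); split; first exact: Rmin_glb_lt.
    move=> th thb t tb; have := Rmin_l e e'; have := Rmin_r e e' => m1 m2.
    case: (Rle_dec th b0) => H; first by apply: He'; lra.
    by apply: He; [lra|apply: Rabs_def1; lra|lra].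
  by exists e.
Qed.

End Circle.
Lemma focal_perp p v : C p -> focal C p -> proximal C p v -> vnorm v = 1 ->
  exists w, proximal C p w /\ vnorm w = 1 /\ dot v w = 0.
Proof.
move=> Cp [a [b [pa [pb [a1 [b1 ab]]]]]] pv v1.
have gs w : proximal C p w -> w <> vscal (dot w v) v -> exists w, proximal C p w /\ vnorm w = 1 /\ dot v w = 0.
  move=> pw /(gram_schmidt v1) [w0 vw]; exists (unitize (vsub w (vscal (dot w v) v))); split; last by split; [exact: unitize_norm|].
  apply: (prox_scal n0) => //.
  have := prox_lin n0 comps isolated 1 (- dot w v) Cp pw pv; congr proximal.
  by vec_ring.
have [aE|/(gs a pa) //] := classic (a = vscal (dot a v) v).
have [bE|/(gs b pb) //] := classic (b = vscal (dot b v) v).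
exfalso; move: ab a1 b1; rewrite aE bE !vnormZ dotZl dotZr -/(nrm2 v) -vnorm_sqr v1 => ab a1 b1.
have : Rabs (dot a v * (dot b v * (1 * 1))) = 0 by rewrite ab Rabs_R0.
by rewrite !Rabs_mult Rabs_R1 => E; have := Rabs_pos (dot b v); nra.
Qed.

(* Rotating v to -v in the normal space of p stays in C. *)
Lemma focal_reflect p v t : C p -> focal C p -> dir p v -> C (pt p t v) ->
  conn_comp C (pt p t v) (pt p (- t) v).
Proof.
move=> Cp fp dv Ct.
have PI0 := PI_RGT_0.
have pos t' v' : 0 <= t' -> dir p v' -> C (pt p t' v') -> conn_comp C (pt p t' v') (pt p (- t') v').
  move=> t'0 dv' Ct'; have pv := dir_prox Cp dv'; have v1 := proj1 dv'.
  have [w [pw [w1 vw]]] := focal_perp Cp fp pv v1.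
  have -> : pt p t' v' = pt p t' (circ v' w (PI * 0)) by rewrite Rmult_0_r circ0.
  have -> : pt p (- t') v' = pt p t' (circ v' w (PI * 1)).
    by rewrite Rmult_1_r circPI pt_scal; congr pt; ring.
  apply: (@path_conn n C (fun s => pt p t' (circ v' w (PI * s)))); first exact: circ_path.
  move=> s s01; apply: (circle_all Cp pv pw v1 w1 vw t'0 (th := 0)); first lra.
    by nra.
  by rewrite circ0.
case: (Rle_dec 0 t) => t0; first exact: pos.
have := pos (- t) (vscal (-1) v) ltac:(lra) (dir_opp dv).
rewrite !pt_scal !(_ : forall c, - c * -1 = c); try by move=> *; ring.
by apply.
Qed.

(** By [circle_all] a whole circle of critical points passes through [pt p T v] with tangent [w]; a
    tangent ball in a direction with positive component along [w] would contain points of it.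
    Applied to [u] and to its opposite, this gives orthogonality. *)
Lemma prox_circle_perp p v w T u : C p -> proximal C p v -> proximal C p w ->
  vnorm v = 1 -> vnorm w = 1 -> dot v w = 0 -> 0 < T -> C (pt p T v) ->
  proximal C (pt p T v) u -> vnorm u = 1 -> dot u v = 0 -> dot u w <= 0.
Proof.
move=> Cp pv pw v1 w1 vw T0 CT [s [s0 Hs]] u1 uv.
have PI0 := PI2_3_2.
apply: Rnot_lt_le => pos.
(* The competing point sits at angle 2h, so that half-angle formulas reduce the comparison to s cos
   h (u.w) <= T sin h; this fails for the present [h] because cos h >= 1/2. *)
pose h := Rmin 1 (s * dot u w / (4 * T)).
have h0 : 0 < h by apply: Rmin_glb_lt; [lra|apply: Rdiv_lt_0_compat; nra].
have h1 : h <= 1 by exact: Rmin_l.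
have h2 : h * (4 * T) <= s * dot u w.
  apply: (@Rle_trans _ (s * dot u w / (4 * T) * (4 * T))).
    by apply: Rmult_le_compat_r; [lra|exact: Rmin_r].
  by apply: Req_le; field; lra.
have Cz : C (pt p T (circ v w (2 * h))).
  by apply: (circle_all Cp pv pw v1 w1 vw (Rlt_le _ _ T0) (th := 0)); rewrite ?circ0 //; lra.
have := Hs _ Cz; rewrite u1 Rmult_1_r => H.
have {}H : s * s <= vdist (pt p T (circ v w (2 * h))) (pt (pt p T v) s u) * vdist (pt p T (circ v w (2 * h))) (pt (pt p T v) s u) by nra.
have E : vsub (pt p T (circ v w (2 * h))) (pt (pt p T v) s u) =
    vadd (vadd (vscal (T * (cos (2 * h) - 1)) v) (vscal (T * sin (2 * h)) w)) (vscal (- s) u).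
  by apply: functional_extensionality => i; rewrite /circ /pt /vadd /vsub /vscal; ring.
rewrite vdist_sqr E /nrm2 !dotE (dotC w v) (dotC v u) (dotC w u) vw uv -!/(nrm2 v) -!/(nrm2 w) -!/(nrm2 u) -!vnorm_sqr v1 w1 u1 in H.
have sh : sin h < h by apply: sin_lt_x.
have sh0 : 0 < sin h by apply: sin_gt_0; lra.
have ch := one_minus_cos h.
have ch' : 1 / 2 <= cos h by nra.
rewrite cos_2a_sin sin_2a in H.
have sc := sin2_cos2 h; rewrite /Rsqr in sc.
have H1 : s * (sin h * cos h) * dot u w <= T * (sin h * sin h).
  apply: (Rmult_le_reg_l (4 * T)); first lra.
  have : cos h * cos h = 1 - sin h * sin h by lra.
  nra.
have H2 : s * cos h * dot u w <= T * sin h.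
  by apply: (Rmult_le_reg_l (sin h)) => //; lra.
have su : 0 < s * dot u w by nra.
have : s * dot u w * (1 / 2) <= s * dot u w * cos h by apply: Rmult_le_compat_l; lra.
have : T * sin h < T * h by apply: Rmult_lt_compat_l.
nra.
Qed.

(* Reflecting in each other, two focal points on a line generate infinitely many, whose normal directions perpendicular to the line are pairwise orthogonal. *)
Lemma one_focal_per_line p v a : C p -> focal C p -> dir p v -> 0 < a ->
  C (pt p a v) -> focal C (pt p a v) -> False.
Proof.
move=> Cp fp dv a0 Ca fa; have v1 := proj1 dv.
pose q (j : nat) := pt p (INR j * a) v.
have qd j : dir (q j) v by exact: dir_line.
(* Two consecutive points are carried along, since [q j.+2] is the reflection of [q j] in
   [q j.+1]. *)
have F j : (C (q j) /\ focal C (q j)) /\ (C (q j.+1) /\ focal C (q j.+1)).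
  elim: j => [|j [[Cj fj] [Cj1 fj1]]].
    by rewrite /q /= Rmult_0_l pt0 Rmult_1_l.
  split=> //.
  have E1 : q j = pt (q j.+1) (- a) v by rewrite /q pt_pt S_INR; congr pt; ring.
  have E2 : q j.+2 = pt (q j.+1) (- - a) v by rewrite /q pt_pt !S_INR; congr pt; ring.
  have := @focal_reflect (q j.+1) v (- a) Cj1 fj1 (qd _); rewrite -E1 -E2 => /(_ Cj) cc.
  by split; [exact: conn_comp_sub cc|exact: (focal_conn n0 comps isolated Cj cc fj)].
have /choice [u Hu] : forall j, exists w, proximal C (q j) w /\ vnorm w = 1 /\ dot v w = 0.
  by move=> j; have [[Cj fj] _] := F j; apply: focal_perp => //; exact: dir_prox.
have lt i j : (i < j)%N -> dot (u j) (u i) = 0.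
  move=> ij; have [pi [ui1 vui]] := Hu i; have [pj [uj1 vuj]] := Hu j.
  have [[Ci _] _] := F i; have [[Cj _] _] := F j.
  pose T := (INR j - INR i) * a.
  have T0 : 0 < T by apply: Rmult_lt_0_compat => //; have := lt_INR i j; move/ltP: ij => ij /(_ ij); lra.
  have E : q j = pt (q i) T v by rewrite /q pt_pt; congr pt; rewrite /T; ring.
  have := @prox_circle_perp (q i) v (u i) T; rewrite -E => H.
  have pv := dir_prox Ci (qd i).
  have := H (u j) Ci pv pi v1 ui1 vui T0 Cj pj uj1; rewrite dotC => /(_ vuj) L1.
  have := H (vscal (-1) (u j)) Ci pv pi v1 ui1 vui T0 Cj.
  rewrite vnormN !dotZl (dotC _ v) vuj Rmult_0_r => /(_ _ uj1 erefl) L2.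
  have := L2 (prox_scal n0 comps isolated (-1) Cj pj); lra.
have on : @orthonormal n n.+1 (fun j => u j).
  move=> i j; case: (ltngtP i j) => [ij|ji|ij].
  - by rewrite dotC lt // ; case: eqP => // e; move: ij; rewrite e ltnn.
  - by rewrite lt //; case: eqP => // e; move: ji; rewrite e ltnn.
  - have -> : i = j by exact: val_inj.
    by rewrite eqxx -/(nrm2 _) -vnorm_sqr; have [_ [-> _]] := Hu j; ring.
by have := orthonormal_card on; rewrite ltnn.
Qed.

(** * The focal set is an affine subspace *)

Definition focal_set (z : vec n) : Prop := C z /\ focal C z.

Lemma focal_set_local z : focal_set z -> exists r, 0 < r /\ forall y, vdist y z < r -> C y -> focal_set y.
Proof.
move=> [Cz fz]; have [r [r0 Hr]] := C_isolated isolated Cz.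
exists r; split=> // y yr Cy; split=> //.
exact: (focal_conn n0 comps isolated Cz (Hr y yr Cy) fz).
Qed.

Lemma focal_set_closed : closed_set focal_set.
Proof.
move=> z nZ; have [Cz|nCz] := classic (C z); last first.
  have [r [r0 Hr]] := Cclosed nCz; exists r; split=> // y yr [Cy _]; exact: (Hr y).
have [r [r0 Hr]] := C_isolated isolated Cz.
exists r; split=> // y yr [Cy fy]; apply: nZ; split=> //.
by apply: (focal_conn n0 comps isolated Cy) fy; apply: conn_comp_sym; exact: Hr.
Qed.

(* Being nearest in the focal set is enough to be a proximal normal, since the other critical points are far away. *)
Lemma focal_near_dir x q : focal_set q -> x <> q ->
  (forall z, focal_set z -> vdist x q <= vdist x z) -> dir q (unitize (vsub x q)).
Proof.
move=> Zq xq near; have [Cq fq] := Zq.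
have D0 : 0 < vnorm (vsub x q).
  by case: (Rle_lt_or_eq_dec _ _ (vnorm_ge0 (vsub x q))) => // /esym /vdist_eq0.
apply: prox_dir => //; last exact: unitize_norm.
apply: (prox_scal n0) => //.
have [r [r0 Hr]] := focal_set_local Zq.
pose D := vnorm (vsub x q).
pose s := Rmin 1 (r / (2 * D)).
have s0 : 0 < s by apply: Rmin_glb_lt; [lra|apply: Rdiv_lt_0_compat => //; rewrite /D; lra].
have s1 : s <= 1 by exact: Rmin_l.
have s2 : s * D <= r / 2.
  apply: (@Rle_trans _ (r / (2 * D) * D)); first by apply: Rmult_le_compat_r; [exact: vnorm_ge0|exact: Rmin_r].
  by apply: Req_le; field; rewrite /D; lra.
exists s; split=> // z Cz; rewrite -/D.
have ys : vdist (pt q s (vsub x q)) q = s * D by rewrite vdist_pt0 Rabs_right //; lra.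
case: (Rlt_dec (vdist z q) r) => zr; last first.
  have := vdist_tri z (pt q s (vsub x q)) q; lra.
have H := near z (Hr z zr Cz); have DE : vdist x q = D by [].
have xs : vdist x (pt q s (vsub x q)) = (1 - s) * D.
  by rewrite -{1}(pt1_sub q x) vdist_pt -/D Rabs_right; lra.
have := vdist_tri x (pt q s (vsub x q)) z; rewrite xs (vdistC (pt q s _) z); lra.
Qed.

Lemma dir_unique z v w : ~ focal_set z -> dir z v -> dir z w -> w = v \/ w = vscal (-1) v.
Proof.
move=> nZ dv dw; have [Cz|nC] := classic (C z); last first.
  case: (dir_N nC dv) (dir_N nC dw) => [->|->] [->|E]; [by left| | |].
  - by right; rewrite E vscalN1K.
  - by right.
  - by left; rewrite -(vscalN1K w) -E vscalN1K.
have [wE|ne] := classic (w = vscal (dot w v) v).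
  move: (dot w v) wE => c wE.
  have := proj1 dw; rewrite wE vnormZ (proj1 dv) Rmult_1_r /Rabs.
  by case: Rcase_abs => _ E; [right; congr vscal; lra|left; rewrite E vscal1].
case: nZ; split=> //; have v1 := proj1 dv.
have [w0 vw] := gram_schmidt v1 ne.
exists v, (unitize (vsub w (vscal (dot w v) v))); split; first exact: dir_prox.
split; last by split=> //; split=> //; exact: unitize_norm.
apply: (prox_scal n0) => //.
have := prox_lin n0 comps isolated 1 (- dot w v) Cz (dir_prox Cz dw) (dir_prox Cz dv); congr proximal.
by vec_ring.
Qed.

Lemma one_focal p v a : focal_set p -> dir p v -> focal_set (pt p a v) -> a = 0.
Proof.
move=> [Cp fp] dv [Ca fa]; case: (Rtotal_order a 0) => [a0|[//|a0]]; exfalso.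
  apply: (@one_focal_per_line p (vscal (-1) v) (- a)) => //; [exact: dir_opp|lra| |];
  by rewrite pt_scal (_ : - a * -1 = a) //; ring.
exact: (@one_focal_per_line p v a).
Qed.

Lemma pt_unitize (x q : vec n) : x <> q -> x = pt q (vdist x q) (unitize (vsub x q)).
Proof.
move=> ne; have D0 : 0 < vdist x q.
  by exact: vdist_gt0.
rewrite /unitize pt_scal -/(vdist x q) Rinv_r; last lra.
by rewrite pt1_sub.
Qed.

(** Here [t] is arbitrary, unlike in [prox_unif]. The focal point nearest to [x = pt q t v] is
    joined to [x] by a normal line; the direction at the non-focal point [x] is unique up to sign,
    so this is the given line, and its only focal point is [q]. *)
Lemma focal_line_nearest q v t z : focal_set q -> dir q v -> focal_set z -> Rabs t <= vdist z (pt q t v).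
Proof.
move=> Zq dv Zz; case: (Req_dec t 0) => [->|t0]; first by rewrite Rabs_R0; exact: vdist_ge0.
set x := pt q t v; have v1 := proj1 dv.
have nZ : ~ focal_set x by move=> Zx; apply: t0; exact: (one_focal Zq dv Zx).
have [q' [Zq' near]] := nearest x focal_set_closed (ex_intro _ q Zq).
have xq' : x <> q' by move=> E; apply: nZ; rewrite E.
have dq' := focal_near_dir Zq' xq' near.
have xE := pt_unitize xq'.
have D0 : 0 < vdist x q'.
  by exact: vdist_gt0.
have dx : dir x (unitize (vsub x q')) by rewrite {1}xE; exact: dir_line.
have dx' : dir x v by exact: dir_line.
have q'E : q' = pt x (- vdist x q') (unitize (vsub x q')).
  by rewrite {1}xE pt_pt (_ : _ + _ = 0) ?pt0 //; ring.
have qq' : exists s, q' = pt q s v.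
  case: (dir_unique nZ dx' dx) => E; rewrite E in q'E.
    by exists (t + - vdist x q'); rewrite {1}q'E {1}/x pt_pt.
  by exists (t + - vdist x q' * -1); rewrite {1}q'E pt_scal {1}/x pt_pt.
case: qq' => s sE; have s0 : s = 0 by apply: (one_focal Zq dv); rewrite -sE.
have E : q' = q by rewrite sE s0 pt0.
have := near z Zz; rewrite E vdist_pt0 v1 (vdistC x z); lra.
Qed.

(** The focal set avoids the open balls of every radius that touch at [q] from both sides along [v].
    Letting the radii grow leaves only the hyperplane through [q] perpendicular to [v]. *)
Lemma focal_flat q v z : focal_set q -> proximal C q v -> focal_set z -> dot (vsub z q) v = 0.
Proof.
move=> Zq pv Zz.
case: (Rle_lt_or_eq_dec _ _ (vnorm_ge0 v)) => [v0|/esym /vnorm_eq0 ->]; last exact: dot0r.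
have d : dir q (unitize v).
  by apply: prox_dir; [exact: (proj1 Zq)|apply: (prox_scal n0) => //; exact: (proj1 Zq)|exact: unitize_norm].
have H s : 0 <= nrm2 (vsub z q) - 2 * s * dot (vsub z q) (unitize v).
  have := focal_line_nearest s Zq d Zz => H.
  have {}H : Rabs s * Rabs s <= vdist z (pt q s (unitize v)) * vdist z (pt q s (unitize v)).
    by have := Rabs_pos s; nra.
  move: H; rewrite vdist_sqr sub_pt.
  have := proj1 d; move: (unitize v) (vsub z q) => w y w1.
  rewrite /nrm2 !dotE (dotC w y) -!/(nrm2 w) -!/(nrm2 y) -(vnorm_sqr w) w1.
  rewrite abs_sqr; lra.
have : dot (vsub z q) (unitize v) = 0.
  apply: NNPP => b0; have := H ((nrm2 (vsub z q) + 1) / (2 * dot (vsub z q) (unitize v))).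
  rewrite (_ : 2 * _ * _ = nrm2 (vsub z q) + 1); last by field.
  lra.
rewrite /unitize dotZr => E.
have : / vnorm v <> 0 by apply: Rinv_neq_0_compat; lra.
by move=> i0; apply: (Rmult_eq_reg_l (/ vnorm v)) => //; lra.
Qed.

(** The converse of [focal_flat]. Together they describe the normals at a focal point through the
    focal set alone, so that all focal points have the same normal space. *)
Lemma flat_proximal q w : focal_set q -> (forall z, focal_set z -> dot (vsub z q) w = 0) -> proximal C q w.
Proof.
move=> Zq H; have [r [r0 Hr]] := focal_set_local Zq; have w0 := vnorm_ge0 w.
have s0 : 0 < r / (2 * (vnorm w + 1)) by apply: Rdiv_lt_0_compat; lra.
exists (r / (2 * (vnorm w + 1))); split=> // z Cz; set s := r / _ in s0 *.
have sE : s * (vnorm w + 1) = r / 2 by rewrite /s; field; lra.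
have ys : vdist (pt q s w) q = s * vnorm w by rewrite vdist_pt0 Rabs_right //; lra.
case: (Rlt_dec (vdist z q) r) => zr; last first.
  have := vdist_tri z (pt q s w) q; lra.
have := H z (Hr z zr Cz) => zw.
apply: sqr_le_le; first exact: vdist_ge0.
rewrite vdist_sqr sub_pt.
move: (vsub z q) zw => y yw.
rewrite /nrm2 !dotE (dotC w y) yw -!/(nrm2 w) -!/(nrm2 y) -(vnorm_sqr w).
have := nrm2_ge0 y; lra.
Qed.

(** [V] is the normal space at [p], [W] its orthogonal complement with orthonormal basis [e], and
    the focal set turns out to be p + W. Two orthonormal normals at [p] extend [e], whence k + 2 <=
    n. *)
Lemma focal_structure p : focal_set p -> exists (k : nat) (e : 'I_k -> vec n) (V W : vec n -> Prop),
  orthonormal e /\ (k + 2 <= n)%N /\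
  (forall a b v w, V v -> V w -> V (vadd (vscal a v) (vscal b w))) /\
  (forall a b v w, W v -> W w -> W (vadd (vscal a v) (vscal b w))) /\
  (forall v, V v -> vnorm v = 1 -> exists w, V w /\ vnorm w = 1 /\ dot v w = 0) /\
  (forall v w, V v -> W w -> dot w v = 0) /\
  (forall y, exists q u, W (vsub q p) /\ V u /\ y = vadd q u) /\
  (forall q u, W (vsub q p) -> V u -> dist2_affine p e (vadd q u) = nrm2 u) /\
  (forall q, W (vsub q p) -> C q) /\
  (forall q u, W (vsub q p) -> V u -> 0 < vnorm u -> dir (vadd q u) (unitize u)).
Proof.
move=> Zp; have [Cp fp] := Zp.
pose V v := proximal C p v.
pose W w := forall v, V v -> dot w v = 0.
have Wlin a b v w : W v -> W w -> W (vadd (vscal a v) (vscal b w)).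
  by move=> Wv Ww u Vu; rewrite !dotE (Wv u Vu) (Ww u Vu); ring.
have Vlin a b v w : V v -> V w -> V (vadd (vscal a v) (vscal b w)) by exact: (prox_lin n0).
have ext k (e : 'I_k -> vec n) u : orthonormal e -> vnorm u = 1 -> (forall i, dot (e i) u = 0) ->
    exists e' : 'I_k.+1 -> vec n, orthonormal e' /\ forall i, e' i = u \/ exists j, e' i = e j.
  move=> on u1 ou.
  exists (fun i => oapp e u (unlift ord_max i)); split; last first.
    by move=> i; case: (unlift ord_max i) => [j|] /=; [right; exists j|left].
  have uu : dot u u = 1 by rewrite -/(nrm2 u) -vnorm_sqr u1; ring.
  move=> i j; case: (unliftP ord_max i) => [i' ->|->]; case: (unliftP ord_max j) => [j' ->|->] /=.
  - by rewrite on (inj_eq (@lift_inj _ ord_max)).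
  - by rewrite ou eq_sym (negbTE (neq_lift _ _)).
  - by rewrite dotC ou (negbTE (neq_lift _ _)).
  - by rewrite eqxx.
(* If no orthonormal family in [W] spanned it, residuals would extend such families to every length,
   against [orthonormal_card]. *)
have [k [e [on [eW emax]]]] : exists k (e : 'I_k -> vec n), orthonormal e /\ (forall i, W (e i)) /\
    forall w, W w -> w = comb (fun i => dot w (e i)) e.
  apply: NNPP => ne.
  have all k : exists e : 'I_k -> vec n, orthonormal e /\ forall i, W (e i).
    elim: k => [|k [e [on eW]]]; first by exists (fun _ => vzero); split; case.
    have [w [Ww wne]] : exists w, W w /\ w <> comb (fun i => dot w (e i)) e.
      apply: NNPP => N'; apply: ne; exists k, e; split=> //; split=> // w Ww.
      by apply: NNPP => wne; apply: N'; exists w.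
    pose r := vsub w (comb (fun i => dot w (e i)) e).
    have r0 : 0 < vnorm r.
      by case: (Rle_lt_or_eq_dec _ _ (vnorm_ge0 r)) => // /esym /vdist_eq0.
    have re i : dot (e i) r = 0.
      rewrite /r dotBr (dotC _ (comb _ _)) dot_comb (bigD1 i) //= on eqxx big1 ?(dotC w); first by ring.
      by move=> j /negbTE ji; rewrite on ji; ring.
    have rW : W r.
      move=> v Vv; rewrite /r dotBl (Ww v Vv) dot_comb big1; first by ring.
      by move=> i _; rewrite (eW i v Vv); ring.
    have [|i|e' [on' He']] := @ext k e (unitize r) on; first exact: unitize_norm.
      by rewrite /unitize dotZr re; ring.
    exists e'; split=> // i; have [->|[j ->]] := He' i; last exact: eW.
    by move=> v Vv; rewrite /unitize dotZl (rW v Vv); ring.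
  by have [e [/orthonormal_card]] := all n.+1; rewrite ltnn.
have ZW z : focal_set z -> W (vsub z p) by move=> Zz v Vv; exact: focal_flat.
have sub3 (x q : vec n) : vsub x q = vadd (vscal 1 (vsub x p)) (vscal (-1) (vsub q p)).
  by vec_ring.
have Vq q w : focal_set q -> V w -> proximal C q w.
  move=> Zq Vw; apply: flat_proximal => // z Zz.
  have A := ZW z Zz w Vw; have B := ZW q Zq w Vw.
  by rewrite dotBl in A; rewrite dotBl in B; rewrite dotBl; lra.
have qV q w : focal_set q -> proximal C q w -> V w.
  move=> Zq pw; apply: flat_proximal => // z Zz.
  have A := focal_flat Zq pw Zz; have B := focal_flat Zq pw Zp.
  by rewrite dotBl in A; rewrite dotBl in B; rewrite dotBl; lra.
have decomp y : exists q, focal_set q /\ V (vsub y q).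
  have [q [Zq near]] := nearest y focal_set_closed (ex_intro _ p Zp).
  exists q; split=> //.
  have [E|ne] := classic (y = q).
    rewrite E (_ : vsub q q = vscal 0 vzero).
      have [v [pv _]] := prox_ex n0 comps isolated Cp.
      have := Vlin 0 0 v v pv pv; congr proximal.
      by vec_ring.
    by vec_ring.
  have d := focal_near_dir Zq ne near.
  apply: (qV q) => //.
  have := prox_scal n0 comps isolated (vdist y q) (proj1 Zq) (dir_prox (proj1 Zq) d); congr proximal.
  have := pt_unitize ne; move: (unitize _) => u yE.
  by rewrite {2}yE ptK.
(* With [z] the focal point from [decomp], q - z belongs to [V] and to [W], hence vanishes. *)
have WZ q : W (vsub q p) -> focal_set q.
  move=> Wq; have [z [Zz Vz]] := decomp q.
  suff -> : q = z by [].
  apply/vdist_eq0; have E : dot (vsub q z) (vsub q z) = 0.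
    by rewrite {1}(sub3 q z) dotDl !dotZl (Wq _ Vz) (ZW z Zz _ Vz); ring.
  have := vdist_sqr q z; rewrite /nrm2 E; have := vdist_ge0 q z; nra.
exists k, e, V, W; split=> //.
split.
  have [a [b [Va [Vb [a1 [b1 ab]]]]]] := fp.
  have [i|e1 [on1 He1]] := @ext k e a on a1; first by exact: (eW i a Va).
  have [i|e2 [on2 He2]] := @ext k.+1 e1 b on1 b1.
    by have [->|[j ->]] := He1 i; [exact: ab|exact: (eW j b Vb)].
  by rewrite addn2; exact: orthonormal_card on2.
do 2![split=> //].
split; first by move=> v Vv v1; exact: focal_perp.
split; first by move=> v w Vv Ww; exact: Ww.
split.
  move=> y; have [q [Zq Vu]] := decomp y; exists q, (vsub y q); split; first exact: ZW.
  by split=> //; rewrite subK.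
split.
  move=> q u Wq Vu; rewrite /dist2_affine.
  have -> : vsub (vadd q u) p = vadd (vsub q p) u.
    by vec_ring.
  have E : nrm2 (vsub q p) = \big[Rplus/0]_(i < k) Rsqr (dot (vadd (vsub q p) u) (e i)).
    rewrite {1}/nrm2 {1}(emax _ Wq) dot_comb; apply: eq_bigr => i _.
    by rewrite dotDl (dotC u) (eW i u Vu) (dotC (e i)) /Rsqr; ring.
  rewrite -E; move: (vsub q p) (Wq u Vu) => x xu.
  by rewrite /nrm2 !dotDl !dotDr (dotC u x) xu; ring.
split; first by move=> q /WZ [].
move=> q u Wq Vu u0; have Zq := WZ q Wq; have [Cq fq] := Zq.
have -> : vadd q u = pt q (vnorm u) (unitize u).
  by rewrite /unitize pt_scal Rinv_r ?/pt ?vscal1 //; lra.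
apply: dir_line; apply: prox_dir => //; last exact: unitize_norm.
by apply: (prox_scal n0) => //; exact: Vq.
Qed.

(** * No focal points *)

Section NoFocal.
Hypothesis Neik : forall x, ~ C x -> exists r u, 0 < r /\ (forall y, vdist y x < r -> ~ C y) /\ eikonal u N x r.
Hypothesis nofocal : forall z, ~ focal_set z.

(** A potential of the normal directions. The sign of the gradient is free at each point, as [N] may
    flip at critical points; it becomes locally coherent through [eik_grad_cont]. *)
Definition chart (B : vec n -> Prop) (u : vec n -> R) : Prop :=
  forall y, B y -> exists v, dir y v /\ has_grad u y v.

Definition open_convex (B : vec n -> Prop) : Prop :=
  (forall x, B x -> exists r, 0 < r /\ forall y, vdist y x < r -> B y) /\
  (forall x y t, B x -> B y -> 0 <= t <= 1 -> B (pt x t (vsub y x))).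

Lemma chart_sub (B B' : vec n -> Prop) u : chart B u -> (forall y, B' y -> B y) -> chart B' u.
Proof. by move=> H sub y /sub; exact: H. Qed.

Lemma chart_grad B u : chart B u -> exists g : vec n -> vec n, forall y, B y -> dir y (g y) /\ has_grad u y (g y).
Proof.
move=> H; have /choice [g Hg] : forall y, exists v, B y -> dir y v /\ has_grad u y v.
  by move=> y; have [/H [v Hv]|] := classic (B y); [exists v|exists vzero].
by exists g.
Qed.

(** Without focal points the two gradients agree up to sign at each point. Both are continuous, so
    the sign is constant along segments from [x0], and the mean value theorem gives the constant
    [c]. *)
Lemma chart_unique B u u' x0 : open_convex B -> B x0 -> chart B u -> chart B u' ->
  exists sg c, (sg = 1 \/ sg = -1) /\ forall y, B y -> u' y = sg * u y + c.
Proof.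
move=> [Bo Bc] Bx0 /chart_grad [g Hg] /chart_grad [g' Hg'].
have gcont (h : vec n -> vec n) (w : vec n -> R) y : (forall y, B y -> dir y (h y) /\ has_grad w y (h y)) -> B y -> vcont_at h y.
  move=> H /Bo [r [r0 Hr]]; apply: (@eik_grad_cont n w h y r r0) => z /Hr /H [dz gz].
  by split=> //; exact: (proj1 dz).
have [sg [sg1 E0]] : exists sg, (sg = 1 \/ sg = -1) /\ g' x0 = vscal sg (g x0).
  have [] := dir_unique (@nofocal x0) (proj1 (Hg x0 Bx0)) (proj1 (Hg' x0 Bx0)) => E.
    by exists 1; split; [left|rewrite vscal1].
  by exists (-1); split; [right|].
have same y : B y -> g' y = vscal sg (g y).
  move=> By; pose ga t := pt x0 t (vsub y x0).
  have ga1 : ga 1 = y by exact: pt1_sub.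
  rewrite -ga1; apply: (@real_ind (fun t => g' (ga t) = vscal sg (g (ga t)))); first lra.
    by rewrite /ga pt0.
  move=> b b01; have Bb : B (ga b) by exact: Bc.
  have [d [d0 Hd]] := gcont g u _ Hg Bb (1 / 4) ltac:(lra).
  have [d' [d'0 Hd']] := gcont g' u' _ Hg' Bb (1 / 4) ltac:(lra).
  have D0 := vdist_ge0 y x0.
  pose eps := Rmin d d' / (vdist y x0 + 1).
  have m0 : 0 < Rmin d d' by exact: Rmin_glb_lt.
  have eps0 : 0 < eps by apply: Rdiv_lt_0_compat; lra.
  have epsE : eps * (vdist y x0 + 1) = Rmin d d' by rewrite /eps; field; lra.
  have near t : Rabs (t - b) < eps -> vdist (ga t) (ga b) < Rmin d d'.
    by move=> tb; rewrite vdist_pt -/(vdist y x0); have := Rabs_pos (t - b); nra.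
  exists eps; split=> // b0 b00 b0b E1 b1 b1b b11.
  have n0' := near b0 ltac:(apply: Rabs_def1; lra).
  have n1' := near b1 ltac:(apply: Rabs_def1; lra).
  have A0 := Hd _ (Rlt_minl n0').
  have A1 := Hd _ (Rlt_minl n1').
  have A0' := Hd' _ (Rlt_minr n0').
  have A1' := Hd' _ (Rlt_minr n1').
  have B1 : B (ga b1) by apply: Bc => //; lra.
  have B0 : B (ga b0) by apply: Bc => //; lra.
  have [dg _] := Hg _ B1; have [dg' _] := Hg' _ B1.
  have [g01 _] := proj1 (Hg _ B0).
  have H1 := vdist_tri (g (ga b1)) (g (ga b)) (g (ga b0)).
  have H2 := vdist_tri (g' (ga b1)) (g' (ga b)) (g' (ga b0)).
  rewrite (vdistC (g (ga b))) in H1; rewrite (vdistC (g' (ga b))) in H2.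
  have {}H1 : vdist (g (ga b1)) (g (ga b0)) < 1 / 2 by lra.
  have {}H2 : vdist (g' (ga b1)) (g' (ga b0)) < 1 / 2 by lra.
  (* A change of sign would make both the sum and the difference of two unit vectors shorter than
     1/2, yet they add up to a vector of length 2. *)
  have flip : g' (ga b1) <> vscal (- sg) (g (ga b1)).
    move=> E; move: H2 H1; rewrite E E1; move: (g (ga b1)) (g (ga b0)) g01 => x z z1 H2 H1.
    have E2 : vdist (vscal (- sg) x) (vscal sg z) = vnorm (vadd x z).
      rewrite /vdist (_ : vsub _ _ = vscal (- sg) (vadd x z)).
        by rewrite vnormZ Rabs_Ropp; case: sg1 => ->; rewrite ?Rabs_Ropp Rabs_R1; ring.
      by vec_ring.
    have T1 := vnorm_tri (vadd x z) (vsub z x).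
    rewrite (_ : vadd (vadd x z) (vsub z x) = vscal 2 z) in T1; last first.
      by vec_ring.
    have T2 : vnorm (vsub z x) = vdist x z by exact: vdistC.
    rewrite vnormZ z1 Rabs_right in T1; last lra.
    by rewrite E2 in H2; lra.
  have [] := dir_unique (@nofocal _) dg dg' => E; rewrite E; case: sg1 flip E => ->.
  - by rewrite vscal1.
  - by rewrite Ropp_involutive vscal1.
  - by [].
  - by [].
exists sg, (u' x0 - sg * u x0); split=> // y By.
pose h z := u' z + (- sg) * u z.
have hg z : B z -> has_grad h z vzero.
  move=> Bz; have := has_grad_add (proj2 (Hg' z Bz)) (has_grad_scal (- sg) (proj2 (Hg z Bz))).
  rewrite (same z Bz); congr has_grad.
  by vec_ring.
have [t t01|t [_]] := @mvt n h (fun _ => vzero) x0 y; first by apply: hg; exact: Bc.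
rewrite dot0l /h; lra.
Qed.

Lemma open_convex_inter B1 B2 : open_convex B1 -> open_convex B2 -> open_convex (fun y => B1 y /\ B2 y).
Proof.
move=> [o1 c1] [o2 c2]; split=> [x [/o1 [r [r0 Hr]] /o2 [r' [r'0 Hr']]]|x y t [x1 x2] [y1 y2] t01].
  exists (Rmin r r'); split=> [|y yx]; first exact: Rmin_glb_lt.
  by split; [apply: Hr; exact: Rlt_minl yx|apply: Hr'; exact: Rlt_minr yx].
by split; [exact: c1|exact: c2].
Qed.

(** The overlap is convex and contains [x0], so a single sign and constant adjust [u2] to [u1] on
    all of it. *)
Lemma chart_glue B1 B2 u1 u2 x0 : open_convex B1 -> open_convex B2 -> B1 x0 -> B2 x0 ->
  chart B1 u1 -> chart B2 u2 -> exists u, chart (fun y => B1 y \/ B2 y) u.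
Proof.
move=> oc1 oc2 x1 x2 ch1 ch2.
have [||||sg [c [sg1 E]]] := @chart_unique (fun y => B1 y /\ B2 y) u2 u1 x0.
- exact: open_convex_inter.
- by [].
- by apply: chart_sub ch2 _ => y [].
- by apply: chart_sub ch1 _ => y [].
pose u y := if excluded_middle_informative (B1 y) then u1 y else sg * u2 y + c.
exists u => y [By|By].
  have [v [dv gv]] := ch1 y By; exists v; split=> //.
  have [r [r0 Hr]] := proj1 oc1 y By.
  apply: (has_grad_local r0) gv => z /Hr Bz.
  by rewrite /u; case: excluded_middle_informative.
have [v [dv gv]] := ch2 y By; exists (vscal sg v); split.
  by case: sg1 => ->; [rewrite vscal1|exact: dir_opp].
have [r [r0 Hr]] := proj1 oc2 y By.
have lin s : is_derive (fun s => sg * s + c) s sg by auto_derive => //; ring.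
apply: (has_grad_local r0 _ (has_grad_comp gv (lin (u2 y)))) => z /Hr Bz.
by rewrite /u; case: excluded_middle_informative => // B1z; apply: E.
Qed.

Lemma chart_regular z : ~ C z -> exists r u, 0 < r /\ chart (fun y => vdist y z < r) u.
Proof.
move=> nC; have [r [u [r0 [reg ek]]]] := Neik nC.
exists r, u; split=> // y yr; have [gy y1] := ek y yr; exists (N y); split=> //.
by split=> //; split=> [_|Cy]; [left|case: (reg y yr)].
Qed.

(* Near a critical hypersurface {F = 0} the chart is the signed distance to it. *)
Lemma chart_critical p : C p -> exists r u, 0 < r /\ chart (fun y => vdist y p < r) u.
Proof.
move=> Cp; have [|e1 [F [DF [e10 [F0 [Fg Fn]]]]]] := nonfocal_chart n0 comps isolated Cp.
  by move=> fp; exact: (@nofocal p).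
have [e2 [e20 He2]] := prox_unif n0 comps isolated Cp.
pose e := Rmin e1 e2; have e0 : 0 < e by exact: Rmin_glb_lt.
have ee1 : e <= e1 by exact: Rmin_l.
have ee2 : e <= e2 by exact: Rmin_r.
have /choice [pi Hpi] := fun x => nearest x Cclosed (ex_intro _ p Cp).
pose rho x := vdist x (pi x).
have rho0 x : 0 <= rho x by exact: vdist_ge0.
have rhole x q : C q -> rho x <= vdist x q by exact: (proj2 (Hpi x)).
have rholip x y : rho x <= vdist x y + rho y.
  by have := rhole x _ (proj1 (Hpi y)); have := vdist_tri x y (pi y); rewrite /rho; lra.
pose u y := if Rle_dec 0 (F y) then rho y else - rho y.
pose nu q := unitize (DF q).
have nudir q : vdist q p < e -> C q -> dir q (nu q).
  move=> qp Cq; have [D0 pD] := Fn q ltac:(lra) Cq.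
  by apply: prox_dir => //; [exact: (prox_scal n0)|exact: unitize_norm].
have rhoE q s : vdist q p < e -> C q -> Rabs s <= e -> rho (pt q s (nu q)) = Rabs s.
  move=> qp Cq se; have [nu1 _] := nudir q qp Cq.
  apply: Rle_antisym; first by have := rhole (pt q s (nu q)) q Cq; rewrite vdist_pt0 nu1; lra.
  have := He2 q (nu q) s (pi (pt q s (nu q))) ltac:(lra) Cq (dir_prox Cq (nudir q qp Cq)) (proj1 (Hpi _)).
  by rewrite nu1 vdistC -/(rho _); lra.
(* [F] has the right sign for small [s] by its derivative at [q]. It keeps it, since a zero would be
   a critical point on the normal line, at positive distance from [C]. *)
have Fsign q sg s : vdist q p < e / 2 -> C q -> (sg = 1 \/ sg = -1) -> 0 < s < e / 2 -> 0 < sg * F (pt q (sg * s) (nu q)).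
  move=> qp Cq sg1 se.
  have qe : vdist q p < e by lra.
  have [nu1 _] := nudir q qe Cq.
  have sgA t := abs_sign t sg1.
  have nz t : 0 < t < e / 2 -> sg * F (pt q (sg * t) (nu q)) <> 0.
    move=> te Ez.
    have Cz : C (pt q (sg * t) (nu q)).
      apply/F0; last by case: sg1 Ez => ->; lra.
      have := vdist_tri (pt q (sg * t) (nu q)) q p; rewrite vdist_pt0 nu1 sgA Rabs_right; lra.
    have := rhole (pt q (sg * t) (nu q)) _ Cz; rewrite vdist_xx (rhoE q (sg * t) qe Cq) sgA Rabs_right; lra.
  apply: Rnot_le_lt => neg.
  have [D0 pD] := Fn q ltac:(lra) Cq.
  have Fq : F q = 0 := proj1 (F0 q ltac:(lra)) Cq.
  have [|d [d0 Hd]] := proj1 (has_gradP _ _ _) (Fg q) (vnorm (DF q) / 2); first lra.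
  pose s' := Rmin s d / 2.
  have m0 : 0 < Rmin s d by apply: Rmin_glb_lt; lra.
  have s'0 : 0 < s' by rewrite /s'; lra.
  have s's : s' < s by have := Rmin_l s d; rewrite /s'; lra.
  have s'd : s' < d by have := Rmin_r s d; rewrite /s'; lra.
  have pos : 0 < sg * F (pt q (sg * s') (nu q)).
    have := Hd (pt q (sg * s') (nu q)); rewrite vdist_pt0 nu1 sgA Rabs_right; last lra.
    rewrite ptK dotZr dot_unitize // Fq => /(_ ltac:(lra)) /Rabs_le_between.
    by case: sg1 => ->; nra.
  have [||t [tb tE]] := IVT_gen (fun t => sg * F (pt q (sg * t) (nu q))) s' s 0.
  - move=> t; apply/continuity_pt_filterlim; apply: ex_derive_continuous.
    have := @has_grad_line n F q (sg * t) (nu q) _ (Fg _) => D.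
    eexists; apply: is_derive_scal; apply: (is_derive_comp (fun r => F (pt q r (nu q))) (fun t => sg * t)); first exact: D.
    by auto_derive.
  - by rewrite Rmin_right ?Rmax_left; lra.
  rewrite Rmin_left ?Rmax_right in tb; try lra.
  by apply: (nz t) => //; lra.
have uE q s : vdist q p < e / 2 -> C q -> Rabs s < e / 2 -> u (pt q s (nu q)) = s.
  move=> qp Cq se; rewrite /u (rhoE q s) //; try lra.
  case: (Rtotal_order s 0) => [s0|[->|s0]].
  - rewrite Rabs_left in se *; try lra.
    have := Fsign q (-1) (- s) qp Cq (or_intror erefl) ltac:(lra).
    rewrite (_ : -1 * - s = s) => [Fs|]; last ring.
    by case: Rle_dec => ? /=; lra.
  - by rewrite Rabs_R0; case: Rle_dec => ? /=; lra.
  - rewrite Rabs_right in se *; try lra.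
    have := Fsign q 1 s qp Cq (or_introl erefl) ltac:(lra).
    rewrite !Rmult_1_l => Fs.
    by case: Rle_dec => ? /=; lra.
(* If [a] and [b] lie on different sides, the segment between them meets [C], and the two distances
   to [C] add up to at most its length. *)
have ulip a b : vdist a p < e -> vdist b p < e -> u a - u b <= vdist a b.
  move=> ap bp; rewrite /u; have ra := rho0 a; have rb := rho0 b.
  have L1 := rholip a b; have L2 := rholip b a; rewrite (vdistC b a) in L2.
  have ab := vdist_ge0 a b.
  case: Rle_dec => Fa; case: Rle_dec => Fb /=; try lra.
  have [|t [tb tE]] := IVT_gen (fun t => F (pt a t (vsub b a))) 0 1 0 (cont_line _ _ Fg).
    by rewrite pt0 pt1_sub Rmin_right ?Rmax_left; lra.
  rewrite Rmin_left ?Rmax_right in tb; try lra.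
  have Cc : C (pt a t (vsub b a)).
    by apply/F0 => //; have := seg_ball ap bp tb; lra.
  have ca : vdist a (pt a t (vsub b a)) = t * vdist a b.
    by rewrite vdistC vdist_pt0 -/(vdist b a) (vdistC b a) Rabs_right //; lra.
  have cb : vdist b (pt a t (vsub b a)) = (1 - t) * vdist a b.
    by rewrite -{1}(pt1_sub a b) vdist_pt -/(vdist b a) (vdistC b a) Rabs_right //; lra.
  by have := rhole a _ Cc; have := rhole b _ Cc; rewrite ca cb; lra.
exists (e / 8), u; split=> [|y yp]; first lra.
have [Cq Hq] := Hpi y; set q := pi y in Cq Hq.
have yq : vdist y q < e / 8 by have := Hq p Cp; lra.
have qp : vdist q p < e / 2 by have := vdist_tri q y p; rewrite (vdistC q y); lra.
have dq : dir q (nu q) by apply: nudir => //; lra.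
have [s [se sE]] : exists s, Rabs s < e / 8 /\ y = pt q s (nu q).
  have [E|ne] := classic (y = q); first by exists 0; rewrite Rabs_R0 pt0; split=> //; lra.
  have D0 : 0 < vdist y q by exact: vdist_gt0.
  have y1 : vnorm (unitize (vsub y q)) = 1 by exact: unitize_norm.
  have yE := pt_unitize ne.
  have pq : proximal C q (unitize (vsub y q)).
    by apply: (@prox_of_near y q _ (vdist y q)) => //; lra.
  have [E|E] := dir_unique (@nofocal q) dq (prox_dir Cq pq y1); rewrite E in yE.
    by exists (vdist y q); rewrite Rabs_right //; lra.
  exists (- vdist y q); rewrite Rabs_Ropp Rabs_right; last lra.
  by split=> //; rewrite {1}yE pt_scal; congr pt; ring.
exists (nu q); split; first by rewrite sE; exact: dir_line.
apply: (@has_grad_of_line n u y (nu q) (e / 8)); first exact: (proj1 dq); first lra.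
- move=> a b ay by'; apply: ulip; [have := vdist_tri a y p|have := vdist_tri b y p]; lra.
- move=> t te; rewrite sE pt_pt !uE //; try lra.
  by apply: Rle_lt_trans (Rabs_triang _ _) _; lra.
Qed.

Lemma chart_local z : exists r u, 0 < r /\ chart (fun y => vdist y z < r) u.
Proof. by have [/chart_critical|/chart_regular] := classic (C z). Qed.

(** * Gluing charts over boxes *)

Definition box (lo hi : vec n) (y : vec n) : Prop := forall i, lo i < y i < hi i.

Lemma box_open_convex lo hi : open_convex (box lo hi).
Proof.
split=> [x Bx|x y t Bx By t01 i].
  have [||r [r0 Hr]] := @fin_radius 'I_n (fun i r => r <= x i - lo i /\ r <= hi i - x i).
  - by move=> i r r' r'0 rr; lra.
  - move=> i; exists (Rmin (x i - lo i) (hi i - x i)); have := Bx i => b.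
    by split; [apply: Rmin_glb_lt; lra|split; [exact: Rmin_l|exact: Rmin_r]].
  exists r; split=> // y yx i; have := vnorm_comp (vsub y x) i; rewrite -/(vdist y x) /vsub.
  by move=> /Rabs_le_between H; have := Hr i; lra.
rewrite /pt /vadd /vscal /vsub; have := Bx i; have := By i => bx by'.
have E : x i + t * (y i - x i) = (1 - t) * x i + t * y i by ring.
rewrite E; split.
  have [m [mx [my ml]]] : exists m, m <= x i /\ m <= y i /\ lo i < m.
    exists (Rmin (x i) (y i)); split; first exact: Rmin_l.
    by split; [exact: Rmin_r|apply: Rmin_glb_lt; lra].
  nra.
have [m [mx [my ml]]] : exists m, x i <= m /\ y i <= m /\ m < hi i.
  exists (Rmax (x i) (y i)); split; first exact: Rmax_l.
  by split; [exact: Rmax_r|apply: Rmax_lub_lt; lra].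
nra.
Qed.

Definition half (k : nat) (r d : R) (i : 'I_n) : R := if (i < k)%N then r else d.

(** Starting from a small cube, the box is stretched to half-width [r] in one coordinate after the
    other, while the remaining widths [d] may shrink. Boxes are used because the overlap of two
    successive ones is again a box, hence convex, as [chart_glue] requires. *)
Lemma chart_box k z r : 0 < r -> exists d u, 0 < d /\
  chart (fun y => forall i, Rabs (y i - z i) < half k r d i) u.
Proof.
move=> r0; elim: k z => [|k IH] z.
  have [e [u [e0 ch]]] := chart_local z; have c0 := pos_INR n.
  exists (e / (INR n + 1)), u; split; first by apply: Rdiv_lt_0_compat; lra.
  apply: chart_sub ch _ => y By.
  apply: (@Rle_lt_trans _ (INR n * (e / (INR n + 1)))).
    apply: vnorm_le_comp => [|i]; first by apply: Rdiv_le_0_compat; lra.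
    by have := By i; rewrite /half ltn0 /vsub; lra.
  have := Rdiv_lt_0_compat e (INR n + 1) e0 ltac:(lra).
  have : (INR n + 1) * (e / (INR n + 1)) = e by field; lra.
  nra.
have [kn|nk] := ltnP k n; last first.
  have [d [u [d0 ch]]] := IH z; exists d, u; split=> //.
  apply: chart_sub ch _ => y By i; have := By i; rewrite /half.
  by rewrite (leq_trans (ltn_ord i) nk) (leq_trans (ltn_ord i) (leqW nk)).
pose kk := Ordinal kn.
pose zT T : vec n := fun i => if i == kk then T else z i.
pose lo d : vec n := fun i => if (i < k.+1)%N then z i - r else z i - d.
pose hi d b : vec n := fun i => if (i < k)%N then z i + r else if i == kk then b else z i + d.
pose B0 := z kk - r; have B0E : B0 = z kk - r by [].
have kkE (i : 'I_n) : (i == kk) = (i == k :> nat) by [].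
have cases (i : 'I_n) : ((i < k)%N /\ (i < k.+1)%N /\ (i == kk) = false) \/
    ((i < k)%N = false /\ (i < k.+1)%N /\ (i == kk) /\ i = kk) \/
    ((i < k)%N = false /\ (i < k.+1)%N = false /\ (i == kk) = false).
  rewrite kkE ltnS; case: (ltngtP i k) => ik; [by left|by right; right|right; left].
  by do 3![split=> //]; exact: val_inj.
suff [d [u [d0 ch]]] : exists d u, 0 < d /\ chart (box (lo d) (hi d (B0 + 2 * r + d))) u.
  exists d, u; split=> //; apply: chart_sub ch _ => y By i.
  have := By i; rewrite /half /lo /hi.
  case: (cases i) => [[E1 [E2 E3]]|[[E1 [E2 [E3 iE]]]|[E1 [E2 E3]]]]; rewrite ?E1 ?E2 ?E3.
  - by move=> /Rabs_def2; lra.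
  - by rewrite iE => /Rabs_def2; lra.
  - by move=> /Rabs_def2; lra.
(* The box grows in coordinate [k] from its lower face [B0] up to [B0 + t + d]. The surplus [d]
   keeps an open overlap with the next slab, which the induction hypothesis on [k] supplies around
   height [B0 + b]. *)
apply: (@real_ind (fun t => exists d u, 0 < d /\ chart (box (lo d) (hi d (B0 + t + d))) u)); first lra.
  have [d [u [d0 ch]]] := IH (zT B0); exists d, u; split=> //.
  apply: chart_sub ch _ => y By i.
  have := By i; rewrite /half /lo /hi /zT.
  case: (cases i) => [[E1 [E2 E3]]|[[E1 [E2 [E3 iE]]]|[E1 [E2 E3]]]]; rewrite ?E1 ?E2 ?E3.
  - by move=> ?; apply: Rabs_def1; lra.
  - by rewrite iE => ?; apply: Rabs_def1; lra.
  - by move=> ?; apply: Rabs_def1; lra.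
move=> b bb; have [d2 [u2 [d20 ch2]]] := IH (zT (B0 + b)).
exists (d2 / 2); split; first lra.
move=> b0 b00 b0b [d1 [u1 [d10 ch1]]] b1 b1b b1r.
pose d := Rmin d1 d2; have d0 : 0 < d by exact: Rmin_glb_lt.
have dd1 : d <= d1 by exact: Rmin_l.
have dd2 : d <= d2 by exact: Rmin_r.
pose lo2 : vec n := fun i => if (i < k)%N then z i - r else if i == kk then B0 + b - d2 else z i - d.
(* The point at height [B0 + b0 + eta] lies below the top [B0 + b0 + d1] of the old box and, as b0 >
   b - d2/2, inside the new slab. *)
pose eta := Rmin d1 (d2 / 2) / 2.
have m0 : 0 < Rmin d1 (d2 / 2) by apply: Rmin_glb_lt; lra.
have eta1 : eta < d1 by have := Rmin_l d1 (d2 / 2); rewrite /eta; lra.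
have eta2 : eta < d2 / 2 by have := Rmin_r d1 (d2 / 2); rewrite /eta; lra.
have eta0 : 0 < eta by rewrite /eta; lra.
have [||||u ch] := @chart_glue (box (lo d) (hi d (B0 + b0 + d1))) (box lo2 (hi d (B0 + b + d2))) u1 u2
    (zT (B0 + b0 + eta)) (box_open_convex _ _) (box_open_convex _ _).
- move=> i; rewrite /lo /hi /zT.
  case: (cases i) => [[E1 [E2 E3]]|[[E1 [E2 [E3 iE]]]|[E1 [E2 E3]]]]; rewrite ?E1 ?E2 ?E3; try lra.
  by rewrite iE; lra.
- move=> i; rewrite /lo2 /hi /zT.
  case: (cases i) => [[E1 [E2 E3]]|[[E1 [E2 [E3 iE]]]|[E1 [E2 E3]]]]; rewrite ?E1 ?E2 ?E3; try lra.
- apply: chart_sub ch1 _ => y By i; have := By i; rewrite /lo /hi.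
  case: (cases i) => [[E1 [E2 E3]]|[[E1 [E2 [E3 iE]]]|[E1 [E2 E3]]]]; rewrite ?E1 ?E2 ?E3; try lra.
- apply: chart_sub ch2 _ => y By i; have := By i; rewrite /lo2 /hi /half /zT.
  case: (cases i) => [[E1 [E2 E3]]|[[E1 [E2 [E3 iE]]]|[E1 [E2 E3]]]]; rewrite ?E1 ?E2 ?E3.
  + by move=> ?; apply: Rabs_def1; lra.
  + by rewrite iE => ?; apply: Rabs_def1; lra.
  + by move=> ?; apply: Rabs_def1; lra.
(* Since b1 < b + d2/2, the top [B0 + b1 + d3] stays below the top [B0 + b + d2] of the new slab. *)
pose d3 := Rmin d (d2 / 2); have d30 : 0 < d3 by apply: Rmin_glb_lt; lra.
have d3d : d3 <= d by exact: Rmin_l.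
have d32 : d3 <= d2 / 2 by exact: Rmin_r.
exists d3, u; split=> //; apply: chart_sub ch _ => y By.
case: (Rlt_dec (y kk) (B0 + b0 + d1)) => yk; [left|right] => i.
  have := By i; rewrite /lo /hi.
  case: (cases i) => [[E1 [E2 E3]]|[[E1 [E2 [E3 iE]]]|[E1 [E2 E3]]]]; rewrite ?E1 ?E2 ?E3; try lra.
  by rewrite iE; lra.
have := By i; rewrite /lo /lo2 /hi.
case: (cases i) => [[E1 [E2 E3]]|[[E1 [E2 [E3 iE]]]|[E1 [E2 E3]]]]; rewrite ?E1 ?E2 ?E3; try lra.
by rewrite iE; lra.
Qed.

Lemma chart_global z r : 0 < r -> exists u, chart (fun y => vdist y z < r) u.
Proof.
move=> r0; have [d [u [d0 ch]]] := chart_box n z r0; exists u.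
apply: chart_sub ch _ => y yz i; rewrite /half ltn_ord.
by apply: Rle_lt_trans yz; exact: (vnorm_comp (vsub y z) i).
Qed.

(** Take a potential on a large ball. Going up from [z] by T and down from [y] by T yields a
    difference of at least 2T - D, with D the distance of [z] and [y]; the Lipschitz bound then
    forces |g z + g y| >= 2 - 2D/T. Letting T grow aligns the two unit gradients. *)
Lemma parallel_lines z y v w : dir z v -> dir y w -> w = v \/ w = vscal (-1) v.
Proof.
move=> dv dw; have v1 := proj1 dv; have w1 := proj1 dw.
set D := vdist z y; have D0 : 0 <= D by exact: vdist_ge0.
have key T : 0 < T -> D <= T -> 1 - 4 * D / T <= Rabs (dot v w).
  move=> T0 DT.
  have [|u /chart_grad [g Hg]] := @chart_global z (T + D + 1); first lra.
  have ekz : eikonal u g z (T + D + 1).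
    by move=> x /Hg [dx gx]; split=> //; exact: (proj1 dx).
  have eky : eikonal u g y (T + 1).
    by apply: (eikonal_sub ekz); rewrite vdistC -/D; lra.
  have zz : vdist z z < T + D + 1 by rewrite vdist_xx; lra.
  have yz : vdist y z < T + D + 1 by rewrite vdistC -/D; lra.
  have gz := proj1 (Hg z zz); have gy := proj1 (Hg y yz).
  have gz1 := proj1 gz; have gy1 := proj1 gy.
  have [|u1 _] := eik_line ekz (t := T); first by rewrite Rabs_right; lra.
  have [|u2 _] := eik_line eky (t := - T); first by rewrite Rabs_Ropp Rabs_right; lra.
  have p1 : vdist (pt z T (g z)) z < T + D + 1 by rewrite vdist_pt0 gz1 Rabs_right; lra.
  have p2 : vdist (pt y (- T) (g y)) z < T + D + 1.
    have := vdist_tri (pt y (- T) (g y)) y z; rewrite vdist_pt0 gy1 Rabs_Ropp Rabs_right; last lra.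
    by rewrite (vdistC y z) -/D; lra.
  have L1 := eik_lip ekz p1 p2; have L2 := eik_lip ekz yz zz.
  rewrite (vdistC y z) -/D in L2.
  have L3 : vdist (pt z T (g z)) (pt y (- T) (g y)) <= D + T * vnorm (vadd (g z) (g y)).
    rewrite /vdist (_ : vsub _ _ = vadd (vsub z y) (vscal T (vadd (g z) (g y)))); last first.
      by vec_ring.
    apply: Rle_trans (vnorm_tri _ _) _; rewrite vnormZ Rabs_right -/(vdist z y) -/D; lra.
  have L4 : 2 * T - 2 * D <= T * vnorm (vadd (g z) (g y)) by lra.
  have n2 : vnorm (vadd (g z) (g y)) * vnorm (vadd (g z) (g y)) = 2 + 2 * dot (g z) (g y).
    move: gz1 gy1; rewrite vnorm_sqr; move: (g z) (g y) => a c a1 c1.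
    by rewrite /nrm2 !dotE (dotC c a) -!/(nrm2 a) -!/(nrm2 c) -!vnorm_sqr a1 c1; ring.
  have gvw : Rabs (dot (g z) (g y)) = Rabs (dot v w).
    have [->|->] := dir_unique (@nofocal z) dv gz; have [->|->] := dir_unique (@nofocal y) dw gy;
    by rewrite ?dotZl ?dotZr // !Rabs_mult ?Rabs_Ropp ?Rabs_R1; ring.
  have := Rle_abs (dot (g z) (g y)); rewrite gvw => ab.
  have L5 : (2 * T - 2 * D) * (2 * T - 2 * D) <= T * T * (2 + 2 * dot (g z) (g y)).
    rewrite -n2 (_ : T * T * _ = (T * vnorm (vadd (g z) (g y))) * (T * vnorm (vadd (g z) (g y)))); last ring.
    by apply: Rmult_le_compat; lra.
  apply: (Rmult_le_reg_l (T * T)); first nra.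
  rewrite (_ : T * T * (1 - 4 * D / T) = T * T - 4 * D * T); last by field; lra.
  nra.
have lim : 1 <= Rabs (dot v w).
  apply: le_epsilon => eps eps0.
  pose T := D + 4 * D / eps + 1.
  have q0 : 0 <= 4 * D / eps by apply: Rdiv_le_0_compat; lra.
  have T0 : 0 < T by rewrite /T; lra.
  have := key T T0 ltac:(rewrite /T; lra).
  have : 4 * D / T <= eps.
    apply: (Rmult_le_reg_r T) => //; rewrite /Rdiv Rmult_assoc Rinv_l ?Rmult_1_r; last lra.
    have : eps * (4 * D / eps) = 4 * D by field; lra.
    by rewrite /T; nra.
  lra.
have [c1|c1] : 1 <= dot w v \/ 1 <= dot w (vscal (-1) v).
  by rewrite dotZr (dotC w v); move: lim; rewrite /Rabs; case: Rcase_abs; [right|left]; lra.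
- by left; apply: unit_dot1.
- by right; apply: unit_dot1 => //; rewrite vnormN.
Qed.

End NoFocal.
End Lines.

(** * Leaves *)

Lemma has_grad_curve {n} (f : vec n -> R) (ga : R -> vec n) t g v : has_grad f (ga t) g ->
  (forall eps, 0 < eps -> exists d, 0 < d /\ forall s, Rabs (s - t) < d ->
     vdist (ga s) (pt (ga t) (s - t) v) <= eps * Rabs (s - t)) ->
  is_derive (fun s => f (ga s)) t (dot g v).
Proof.
move=> /has_gradP fg gg; apply/is_derive_Reals => eps eps0.
have g0 := vnorm_ge0 g; have v0 := vnorm_ge0 v.
pose e1 := Rmin 1 (eps / (3 * (vnorm g + 1))).
have q1 : 0 < eps / (3 * (vnorm g + 1)) by apply: Rdiv_lt_0_compat; lra.
have e10 : 0 < e1 by apply: Rmin_glb_lt; lra.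
have e11 : e1 <= 1 by exact: Rmin_l.
have e1g : e1 * (vnorm g + 1) <= eps / 3.
  apply: (@Rle_trans _ (eps / (3 * (vnorm g + 1)) * (vnorm g + 1))).
    by apply: Rmult_le_compat_r; [lra|exact: Rmin_r].
  by apply: Req_le; field; lra.
have e20 : 0 < eps / (3 * (vnorm v + 1)) by apply: Rdiv_lt_0_compat; lra.
set e2 := eps / _ in e20.
have e2v : e2 * (vnorm v + 1) = eps / 3 by rewrite /e2; field; lra.
have [d1 [d10 Hd1]] := gg e1 e10.
have [d2 [d20 Hd2]] := fg e2 e20.
have q2 : 0 < d2 / (vnorm v + 1) by apply: Rdiv_lt_0_compat; lra.
have m0 : 0 < Rmin d1 (d2 / (vnorm v + 1)) by exact: Rmin_glb_lt.
exists (mkposreal _ m0) => h h0 /= hm.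
have h1 := Rlt_minl hm; have h2 := Rlt_minr hm.
have hh : 0 < Rabs h by exact: Rabs_pos_lt.
have A := Hd1 (t + h); rewrite (_ : t + h - t = h) in A; last ring.
have {}A := A h1.
set y := ga (t + h) in A *; set x := ga t in fg A Hd2 *.
have yx : vdist y x <= Rabs h * (vnorm v + 1).
  have := vdist_tri y (pt x h v) x; rewrite vdist_pt0; nra.
have B := Hd2 y; have {}B : Rabs (f y - f x - dot g (vsub y x)) <= e2 * (Rabs h * (vnorm v + 1)).
  apply: Rle_trans (B _) _; last by apply: Rmult_le_compat_l; lra.
  apply: Rle_lt_trans yx _.
  by move: h2 => /(Rmult_lt_compat_r (vnorm v + 1)); rewrite /Rdiv Rmult_assoc Rinv_l; lra.
have E : vsub y x = vadd (vscal h v) (vsub y (pt x h v)).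
  by vec_ring.
have cs := cauchy_schwarz g (vsub y (pt x h v)); rewrite -/(vdist y _) in cs.
have H : Rabs (f y - f x - h * dot g v) <= Rabs h * (2 / 3 * eps).
  rewrite (_ : _ - h * _ = (f y - f x - dot g (vsub y x)) + dot g (vsub y (pt x h v))); last first.
    by rewrite E dotDr dotZr; ring.
  apply: Rle_trans (Rabs_triang _ _) _.
  have : vnorm g * vdist y (pt x h v) <= vnorm g * (e1 * Rabs h) by apply: Rmult_le_compat_l.
  nra.
rewrite (_ : (_ - _) / h - dot g v = (f y - f x - h * dot g v) / h); last by field.
rewrite Rabs_div //; apply: (Rmult_lt_reg_r (Rabs h)) => //.
rewrite /Rdiv Rmult_assoc Rinv_l; last lra.
nra.
Qed.

Lemma has_grad_circ {n} (f : vec n -> R) q r v w k t g : vnorm v = 1 -> vnorm w = 1 ->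
  has_grad f (pt q r (circ v w (k * t))) g ->
  is_derive (fun s => f (pt q r (circ v w (k * s)))) t
    (r * k * dot g (circ w (vscal (-1) v) (k * t))).
Proof.
move=> v1 w1 fg.
rewrite -dotZr; apply: (@has_grad_curve n f (fun s => pt q r (circ v w (k * s)))) fg _.
move=> eps eps0.
have c := Rabs_pos r.
have e0 : 0 < eps / (2 * (Rabs r + 1)) by apply: Rdiv_lt_0_compat; lra.
have dc : derivable_pt_lim (fun s => cos (k * s)) t (- k * sin (k * t)).
  by apply/is_derive_Reals; auto_derive => //; ring.
have ds : derivable_pt_lim (fun s => sin (k * s)) t (k * cos (k * t)).
  by apply/is_derive_Reals; auto_derive => //; ring.
have [d1 Hd1] := dc _ e0; have [d2 Hd2] := ds _ e0.
exists (Rmin d1 d2); split; first by apply: Rmin_glb_lt; exact: cond_pos.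
move=> s st; have s1 := Rlt_minl st; have s2 := Rlt_minr st.
set e := eps / _ in e0 Hd1 Hd2.
have eE : 2 * (Rabs r + 1) * e = eps by rewrite /e; field; lra.
pose a := cos (k * s) - cos (k * t) - (s - t) * (- k * sin (k * t)).
pose b := sin (k * s) - sin (k * t) - (s - t) * (k * cos (k * t)).
have bound (ph : R -> R) l (dd : posreal) : (forall h, h <> 0 -> Rabs h < dd -> Rabs ((ph (t + h) - ph t) / h - l) < e) ->
    Rabs (s - t) < dd -> Rabs (ph s - ph t - (s - t) * l) <= e * Rabs (s - t).
  move=> Hd sd; case: (Req_dec (s - t) 0) => [E|ne].
    have -> : s = t by lra.
    by rewrite !Rminus_diag Rmult_0_l Rminus_0_r Rabs_R0; lra.
  have := Hd _ ne sd; rewrite (_ : t + (s - t) = s); last ring.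
  move=> H; rewrite (_ : _ - _ - _ = ((ph s - ph t) / (s - t) - l) * (s - t)); last by field.
  rewrite Rabs_mult; apply: Rmult_le_compat_r; [exact: Rabs_pos|lra].
have A : Rabs a <= e * Rabs (s - t) := bound (fun s => cos (k * s)) _ _ Hd1 s1.
have B : Rabs b <= e * Rabs (s - t) := bound (fun s => sin (k * s)) _ _ Hd2 s2.
have -> : vdist (pt q r (circ v w (k * s))) (pt (pt q r (circ v w (k * t))) (s - t)
    (vscal (r * k) (circ w (vscal (-1) v) (k * t)))) = vnorm (vscal r (vadd (vscal a v) (vscal b w))).
  by congr vnorm; apply: functional_extensionality => i; rewrite /circ /pt /vsub /vadd /vscal /a /b; ring.
rewrite vnormZ.
have := vnorm_tri (vscal a v) (vscal b w); rewrite !vnormZ v1 w1 => H.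
have := Rabs_pos (s - t) => p.
apply: (@Rle_trans _ (Rabs r * (2 * (e * Rabs (s - t))))).
  by apply: Rmult_le_compat_l => //; lra.
rewrite -eE; have : 0 <= e * Rabs (s - t) by nra.
lra.
Qed.

Lemma circ_tangent {n} (v w : vec n) a : vnorm v = 1 -> vnorm w = 1 -> dot v w = 0 ->
  dot (circ v w a) (circ w (vscal (-1) v) a) = 0.
Proof.
move=> v1 w1 vw; rewrite /circ !dotE (dotC w v) vw -!/(nrm2 v) -!/(nrm2 w) -!vnorm_sqr v1 w1; ring.
Qed.

(** Two unit vectors of [V] lie on a common great circle. If they are parallel, the given
    perpendicular vector spans the plane; otherwise Gram-Schmidt does, with the angle
    [acos (dot v' v)]. *)
Lemma circ_reach {n} (V : vec n -> Prop) v v' :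
  (forall a b v w, V v -> V w -> V (vadd (vscal a v) (vscal b w))) ->
  V v -> V v' -> vnorm v = 1 -> vnorm v' = 1 ->
  (exists w, V w /\ vnorm w = 1 /\ dot v w = 0) ->
  exists w th, V w /\ vnorm w = 1 /\ dot v w = 0 /\ v' = circ v w th.
Proof.
move=> Vlin Vv Vv' v1 v'1 [w0 [Vw0 [w01 vw0]]].
have [E|ne] := classic (v' = vscal (dot v' v) v).
  have c1 : Rabs (dot v' v) = 1 by move: v'1; rewrite {1}E vnormZ v1 Rmult_1_r.
  move: (dot v' v) E c1 => c -> {v'1 Vv'}; rewrite /Rabs; case: Rcase_abs => _ c1.
    exists w0, PI; do 3![split=> //]; rewrite circPI; congr vscal; lra.
  by exists w0, 0; do 3![split=> //]; rewrite circ0 c1 vscal1.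
have [r0 vr] := gram_schmidt v1 ne.
have rE : nrm2 (vsub v' (vscal (dot v' v) v)) = 1 - dot v' v * dot v' v.
  have E c : nrm2 (vsub v' (vscal c v)) = 1 - 2 * c * dot v' v + c * c.
    by rewrite /nrm2 !(dotBl, dotBr, dotZl, dotZr) (dotC v v') -!/(nrm2 v) -!/(nrm2 v') -!vnorm_sqr v1 v'1; ring.
  by rewrite E; ring.
have ab : -1 <= dot v' v <= 1.
  by have := nrm2_ge0 (vsub v' (vscal (dot v' v) v)); rewrite rE; nra.
exists (unitize (vsub v' (vscal (dot v' v) v))), (acos (dot v' v)).
split.
  have := Vlin (/ vnorm (vsub v' (vscal (dot v' v) v))) (- (/ vnorm (vsub v' (vscal (dot v' v) v)) * dot v' v)) v' v Vv' Vv.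
  congr V; rewrite /unitize; vec_ring.
split; first exact: unitize_norm.
split=> //.
rewrite /circ cos_acos // sin_acos //.
have -> : sqrt (1 - (dot v' v)²) = vnorm (vsub v' (vscal (dot v' v) v)) by rewrite /vnorm rE.
rewrite /unitize vscalA Rinv_r ?vscal1; last lra.
by vec_ring.
Qed.

Lemma sum_sq_cont {n c} (a : 'I_c -> vec n) (b : 'I_c -> R) (y : vec n) :
  exists g, has_grad (fun y => \big[Rplus/0]_(j < c) Rsqr (dot (a j) y + b j)) y g.
Proof.
have dsq s : is_derive Rsqr s (2 * s) by rewrite /Rsqr; auto_derive => //; ring.
eexists; apply: (@has_grad_sum n c (fun j y => Rsqr (dot (a j) y + b j))) => j.
exact: has_grad_comp (has_grad_aff (a j) (b j) y) (dsq _).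
Qed.

Lemma dist2_affine_cont {n k} (p : vec n) (e : 'I_k -> vec n) y : cont_at (dist2_affine p e) y.
Proof.
have [g1 H1] := sum_sq_cont basis (fun j => - p j) y.
have [g2 H2] := sum_sq_cont e (fun j => - dot (e j) p) y.
have := has_grad_cont (has_grad_add H1 (has_grad_scal (-1) H2)); congr cont_at.
apply: functional_extensionality => x; rewrite /dist2_affine.
have -> : nrm2 (vsub x p) = \big[Rplus/0]_(j < n) Rsqr (dot (basis j) x + - p j).
  by rewrite /nrm2 /dot; apply: eq_bigr => j _; rewrite -/(dot (basis j) x) dot_basis /vsub /Rsqr; ring.
have -> : \big[Rplus/0]_(i < k) Rsqr (dot (vsub x p) (e i)) = \big[Rplus/0]_(j < k) Rsqr (dot (e j) x + - dot (e j) p).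
  by apply: eq_bigr => j _; rewrite dotBl !(dotC (e j)).
ring.
Qed.

Lemma dot_cont {n} (v y : vec n) : cont_at (fun y => dot y v) y.
Proof.
have := has_grad_cont (has_grad_aff v 0 y); congr cont_at.
by apply: functional_extensionality => x; rewrite dotC; ring.
Qed.

(** * Leaves of a metric function *)

Section Metric.
Context {n : nat} (f : vec n -> R) (G : vec n -> vec n).
Hypothesis HG : forall x, has_grad f x (G x).
Hypothesis Gc : forall x, vcont_at G x.
Hypothesis Hm : forall x y, leaf f x y -> vnorm (G x) = vnorm (G y).
Hypothesis n0 : (0 < n)%N.
Hypothesis comps : forall x, crit f x ->
  (forall y, conn_comp (crit f) x y <-> (forall i, y i = x i)) \/ reg_surface (conn_comp (crit f) x).
Hypothesis isolated : forall x, crit f x -> exists r, 0 < r /\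
  forall y, crit f y -> nrm2 (vsub y x) < r * r -> conn_comp (crit f) x y.
Let N y := unitize (G y).

Lemma critP x : crit f x <-> G x = vzero.
Proof.
by split=> [cx|E]; [exact: has_grad_uniq (HG x) cx|rewrite /crit -E; exact: HG].
Qed.

Lemma not_crit x : ~ crit f x -> 0 < vnorm (G x).
Proof.
by move=> nc; case: (Rle_lt_or_eq_dec _ _ (vnorm_ge0 (G x))) => // /esym /vnorm_eq0 /critP.
Qed.

Lemma crit_vnorm x : 0 < vnorm (G x) -> ~ crit f x.
Proof. by move=> g0 /critP E; move: g0; rewrite E vnorm0; lra. Qed.

Lemma crit_closed : closed_set (crit f).
Proof.
move=> x /not_crit g0; have [d [d0 Hd]] := @Gc x _ g0; exists d; split=> // y /Hd H.
by move=> /critP E; have := vnorm_le_dist (G x) (G y); rewrite (vdistC (G x)) E vnorm0 in H *; lra.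
Qed.

Lemma normal_unit x : ~ crit f x -> vnorm (N x) = 1.
Proof. by move=> /not_crit; exact: unitize_norm. Qed.

Lemma normal_eikonal x : ~ crit f x -> exists r u, 0 < r /\
  (forall y, vdist y x < r -> ~ crit f y) /\ eikonal u N x r.
Proof.
move=> /not_crit /(local_eikonal HG Gc Hm) [r [u [r0 [reg [ek _]]]]].
by exists r, u; split=> //; split=> // y /reg; exact: crit_vnorm.
Qed.

Lemma normal_local x : ~ crit f x -> exists r, 0 < r /\ forall y t, vdist y x < r -> Rabs t < r ->
  ~ crit f y /\ ~ crit f (pt y t (N y)) /\ N (pt y t (N y)) = N y.
Proof.
move=> /normal_eikonal [r [u [r0 [reg ek]]]].
exists (r / 2); split=> [|y t yx tr]; first lra.
have ny : ~ crit f y by apply: reg; lra.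
split=> //; split.
  apply: reg; have := vdist_tri (pt y t (N y)) y x; rewrite vdist_pt0 normal_unit //; lra.
by apply: (proj2 (eik_line (@eikonal_sub _ _ _ _ _ y (r / 2) ek _) tr)); lra.
Qed.

Lemma normal_near x p : ~ crit f x -> crit f p -> (forall q, crit f q -> vdist x p <= vdist x q) ->
  p = pt x (vdist x p) (N x) \/ p = pt x (- vdist x p) (N x).
Proof.
move=> /not_crit g0 /critP Gp Hp; apply: (normal_nearest HG Gc Hm g0 Gp) => q Gq.
by apply: Hp; apply/critP.
Qed.

Lemma leaf_sym x y : leaf f x y -> leaf f y x.
Proof.
move=> xy; have fxy := conn_comp_sub xy; rewrite /level in fxy.
by have := conn_comp_sym xy; rewrite /leaf (_ : level f x = level f y) // /level fxy.
Qed.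

Lemma leaf_trans x y z : leaf f x y -> leaf f y z -> leaf f x z.
Proof.
move=> xy yz; have fxy := conn_comp_sub xy; rewrite /level in fxy.
apply: conn_comp_trans xy _; move: yz; rewrite /leaf (_ : level f x = level f y) // /level fxy //.
Qed.

(** If a leaf took two values of [D], it would take all values in between, and [f] would be constant
    on the open set where [D] lies between them. That set would consist of critical points, contrary
    to [crit_no_interior]. *)
Lemma leaf_of_function (D : vec n -> R) : (forall x, cont_at D x) ->
  (forall x y, D x = D y -> leaf f x y) -> forall x y, leaf f x y <-> D x = D y.
Proof.
move=> Dc Dl.
have key x y : leaf f x y -> ~ D x < D y.
  move=> [A [cA [AS [Ax Ay]]]] lt.
  have const w : D x < D w < D y -> f w = f x.
    move=> wb; have [z [Az Dz]] := connected_ivt cA Dc Ax Ay wb.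
    by have := conn_comp_sub (Dl w z (esym Dz)); rewrite /level => <-; exact: (AS z Az).
  have [z [Az Dz]] := connected_ivt cA Dc Ax Ay (c := (D x + D y) / 2) ltac:(lra).
  have [r [r0 Hr]] := Dc z ((D y - D x) / 2) ltac:(lra).
  have fz w : vdist w z < r -> f w = f x.
    by move=> /Hr /Rabs_def2; rewrite Dz => H; apply: const; lra.
  have crz w : vdist w z < r -> crit f w.
    move=> wz; have g0 := @has_grad_aff n vzero (f x) w.
    apply: (has_grad_local (r := r - vdist w z) _ _ g0); first lra.
    by move=> y' y'w; rewrite dot0l Rplus_0_l; apply: fz; have := vdist_tri y' w z; lra.
  have cz : crit f z by apply: crz; rewrite vdist_xx.
  by have [w [wz]] := crit_no_interior n0 comps isolated cz r0; case; exact: crz.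
move=> x y; split; last exact: Dl.
move=> xy; have H1 := key x y xy; have H2 := key y x (leaf_sym xy); lra.
Qed.

Lemma path_leaf (ga : R -> vec n) : path_cont ga ->
  (forall t, 0 <= t <= 1 -> is_derive (fun s => f (ga s)) t 0) -> leaf f (ga 0) (ga 1).
Proof.
move=> gc gd; apply: (path_conn gc) => t t01; rewrite /level.
have [||c [_ E]] := @MVT_gen (fun s => f (ga s)) 0 t (fun _ => 0).
- by rewrite Rmin_left ?Rmax_right; try lra; move=> s sb; apply: gd; lra.
- rewrite Rmin_left ?Rmax_right; try lra; move=> s sb.
  by apply/continuity_pt_filterlim; apply: ex_derive_continuous; eexists; apply: gd; lra.
lra.
Qed.

Lemma grad_perp z v w : dir (crit f) N z v -> dot v w = 0 -> dot (G z) w = 0.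
Proof.
move=> [v1 [vU _]] vw; have [/critP ->|nc] := classic (crit f z); first exact: dot0l.
have g0 := not_crit nc.
have GE : G z = vscal (vnorm (G z)) (N z).
  by rewrite /N /unitize vscalA Rinv_r ?vscal1 //; lra.
have Nw : dot (N z) w = 0.
  by case: (vU nc) => E; move: vw; rewrite E ?dotZl; lra.
by rewrite GE dotZl Nw; ring.
Qed.

(** Spheres and cylinders are treated together, as k = 0 is allowed in the second alternative. In
    both alternatives it remains to join points with equal [D] by paths perpendicular to the normal
    directions; [leaf_of_function] supplies the converse. *)
Lemma leaves_classified :
  (exists v : vec n, nrm2 v = 1 /\ forall x y, leaf f x y <-> dot y v = dot x v) \/
  (exists k (p : vec n) (e : 'I_k -> vec n), (k + 2 <= n)%N /\ orthonormal e /\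
     (forall x y, leaf f x y <-> dist2_affine p e y = dist2_affine p e x) /\
     (forall y, dist2_affine p e y = 0 -> crit f y)).
Proof.
have [[p Zp]|nofocal] := classic (exists p, focal_set (crit f) p); last first.
  left; have [v dv] := dir_exists n0 comps isolated normal_unit vzero.
  exists v; split; first by rewrite -vnorm_sqr (proj1 dv); ring.
  have Dl x y : dot x v = dot y v -> leaf f x y.
    move=> E; have := @path_leaf (fun t => pt x t (vsub y x)) (pt_path_cont _ _).
    rewrite pt0 pt1_sub; apply => t _.
    have [w dw] := dir_exists n0 comps isolated normal_unit (pt x t (vsub y x)).
    have := has_grad_line (HG (pt x t (vsub y x))); rewrite (grad_perp dw) //.
    have nf z : ~ focal_set (crit f) z by move=> Zz; apply: nofocal; exists z.
    have vyx : dot v (vsub y x) = 0 by rewrite dotBr !(dotC v); lra.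
    have [->|->] := parallel_lines n0 crit_closed comps isolated normal_unit normal_local normal_near normal_eikonal nf dv dw => //.
    by rewrite dotZl vyx; ring.
  move=> x y; rewrite (leaf_of_function (dot_cont v) Dl x y); split=> ->; done.
right.
have [k [e [V [W [on [kn [Vlin [Wlin [Vperp [VW [dec [De [WC Wdir]]]]]]]]]]]]] :=
  focal_structure n0 crit_closed comps isolated normal_unit normal_local normal_near Zp.
exists k, p, e; do 2![split=> //].
have Dl x y : dist2_affine p e x = dist2_affine p e y -> leaf f x y.
  have [q [u [Wq [Vu ->]]]] := dec x; have [q' [u' [Wq' [Vu' ->]]]] := dec y.
  rewrite !De // => uE.
  have {}uE : vnorm u = vnorm u' by rewrite /vnorm uE.
  have Wqq : W (vsub q' q).
    have := Wlin 1 (-1) _ _ Wq' Wq; congr W.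
    by vec_ring.
  have Wt t : W (vsub (pt q t (vsub q' q)) p).
    have := Wlin 1 t _ _ Wq Wqq; congr W.
    by vec_ring.
  (* The path has two pieces: a translation parallel to the axis, then a rotation of [u] into [u']
     inside the normal space at [q']. *)
  have trans : leaf f (vadd q u) (vadd q' u).
    have shift t : pt (vadd q u) t (vsub q' q) = vadd (pt q t (vsub q' q)) u.
      by vec_ring.
    have := @path_leaf (fun t => pt (vadd q u) t (vsub q' q)) (pt_path_cont _ _).
    rewrite !shift pt0 pt1_sub; apply => t _.
    have := has_grad_line (HG (pt (vadd q u) t (vsub q' q))).
    suff -> : dot (G (pt (vadd q u) t (vsub q' q))) (vsub q' q) = 0 by [].
    rewrite shift; have [u0|u0] : vnorm u = 0 \/ 0 < vnorm u by have := vnorm_ge0 u; lra.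
      have -> : vadd (pt q t (vsub q' q)) u = pt q t (vsub q' q).
        by rewrite (vnorm_eq0 u0); vec_ring.
      by rewrite (proj1 (critP _) (WC _ (Wt t))) dot0l.
    apply: (grad_perp (Wdir _ _ (Wt t) Vu u0)).
    by rewrite /unitize dotZl dotC (VW u _ Vu Wqq); ring.
  apply: leaf_trans trans _.
  have [u0|u0] : vnorm u = 0 \/ 0 < vnorm u by have := vnorm_ge0 u; lra.
    by rewrite (vnorm_eq0 u0) (vnorm_eq0 (etrans (esym uE) u0)); exact: conn_comp_refl.
  have u'0 : 0 < vnorm u' by rewrite -uE.
  have Vs a v : V v -> V (vscal a v).
    move=> Vv; have := Vlin a 0 _ _ Vv Vv; congr V.
    by vec_ring.
  have v1 := unitize_norm u0; have v'1 := unitize_norm u'0.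
  have Vv : V (unitize u) by exact: Vs.
  have Vv' : V (unitize u') by exact: Vs.
  have [w [th [Vw [w1 [vw v'E]]]]] := circ_reach Vlin Vv Vv' v1 v'1 (Vperp _ Vv v1).
  have back a : 0 < vnorm a -> vadd q' a = pt q' (vnorm a) (unitize a).
    by move=> a0; rewrite /unitize pt_scal Rinv_r ?/pt ?vscal1 //; lra.
  rewrite (back u u0) (back u' u'0) v'E -uE.
  have := @path_leaf (fun t => pt q' (vnorm u) (circ (unitize u) w (th * t))) (circ_path _ _ _ v1 w1 vw).
  rewrite Rmult_0_r Rmult_1_r circ0; apply => t _.
  have := has_grad_circ v1 w1 (HG (pt q' (vnorm u) (circ (unitize u) w (th * t)))).
  set c := circ (unitize u) w (th * t).
  have c1 : vnorm c = 1 by exact: circ_unit.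
  have Vc : V (vscal (vnorm u) c) by apply: Vs; exact: Vlin.
  have uc : vnorm (vscal (vnorm u) c) = vnorm u by rewrite vnormZ c1 Rabs_right; lra.
  have := Wdir q' (vscal (vnorm u) c) Wq' Vc; rewrite uc => /(_ u0) dz.
  have cE : unitize (vscal (vnorm u) c) = c.
    by rewrite /unitize uc vscalA Rinv_l ?vscal1 //; lra.
  rewrite cE -/(pt q' (vnorm u) c) in dz.
  by rewrite (grad_perp dz) ?Rmult_0_r //; exact: circ_tangent.
split.
  move=> x y; rewrite (leaf_of_function (dist2_affine_cont p e) Dl x y); split=> ->; done.
move=> y; have [q [u [Wq [Vu ->]]]] := dec y; rewrite De // => /nrm2_eq0 ->.
have -> : vadd q vzero = q by vec_ring.
exact: WC.
Qed.

End Metric.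

Theorem theorem1p15 (n : nat) (f : vec n -> R) :
  metric_function f ->
  (* each connected component of the critical set is a point or a regular surface *)
  (forall x, crit f x ->
     (forall y, conn_comp (crit f) x y <-> (forall i, y i = x i)) \/
     reg_surface (conn_comp (crit f) x)) ->
  (* each component is isolated from the others *)
  (forall x, crit f x -> exists r, 0 < r /\
     forall y, crit f y -> nrm2 (vsub y x) < r * r -> conn_comp (crit f) x y) ->
  (* (1) parallel hyperplanes *)
  (exists v : vec n, nrm2 v = 1 /\
     forall x y, leaf f x y <-> dot y v = dot x v)
  \/
  (* (2) concentric hyperspheres together with their common center *)
  (exists p : vec n,
     forall x y, leaf f x y <-> nrm2 (vsub y p) = nrm2 (vsub x p))
  \/
  (* (3) concentric cylinders S^{n-k-1} x R^k around a critical axis R^k *)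
  (exists (k : nat) (p : vec n) (e : 'I_k -> vec n),
     is_true (leq 1 k) /\ is_true (leq (k + 2)%nat n) /\ orthonormal e /\
     (forall x y, leaf f x y <-> dist2_affine p e y = dist2_affine p e x) /\
     (forall y, dist2_affine p e y = 0 -> crit f y)).
Proof.
move=> [/C2_grad [G [HG [Gc _]]] fm] comps isolated.
have Hm x y : leaf f x y -> vnorm (G x) = vnorm (G y).
  by move=> xy; rewrite /vnorm (fm x y (G x) (G y)).
(* The single point of the zero-dimensional space is its only leaf; it is counted as the centre of
   spheres. *)
have [n0|n0] := posnP n.
  right; left; exists vzero => x y.
  have -> : y = x by apply: functional_extensionality => -[i i0]; exfalso; move: i0; rewrite n0.
  by split=> // _; exact: conn_comp_refl.
have [H|[k [p [e [kn [on [He Hc]]]]]]] := leaves_classified HG Gc Hm n0 comps isolated; first by left.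
(* For k = 0 the axis is a point, and [dist2_affine] is the squared distance to it. *)
right; case: k e kn on He Hc => [|k] e kn on He Hc; last by right; exists k.+1, p, e.
by left; exists p => x y; rewrite He /dist2_affine !big_ord0 !Rminus_0_r.
Qed.
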